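(* Let $\tau\in\overline\Delta$, $\eta\in\partial\Delta$, $\eta\neq\tau$, and let $h\in\mathrm{Star}[\tau,\eta]$ with $Q_h(\eta)=\nu$. Denote $$\theta:=\lim_{r\to1^-}\arg h(r\eta).$$ Then the image $h(\Delta)$ contains the wedge $$W=\left\{w\in\mathbb C:\ |\arg w-\theta|<\frac{|\nu|\pi}{2}\right\}$$ and contains no larger wedge with the same bisector.
   Context: $\Delta$ is the open unit disk in $\mathbb C$; $\angle\lim$ denotes the angular (nontangential) limit. A univalent (holomorphic) function $h$ on $\Delta$ is called starlike if for some real $\mu>0$ and for each $z\in\Delta$ one has $\{e^{-\mu t}h(z):t\ge0\}\subset h(\Delta)$. For $\tau\in\overline\Delta$, $\mathrm{Star}[\tau]$ is the class of starlike functions satisfying $h(\tau)=0$, where for $\tau\in\partial\Delta$ (in which case $0\notin h(\Delta)$, i.e. $h$ is starlike with respect to a boundary point) $h(\tau):=\angle\lim_{z\to\tau}h(z)$. For $\eta\in\partial\Delta$, $\eta\ne\tau$, the subclass $\mathrm{Star}[\tau,\eta]$ consists of those $h\in\mathrm{Star}[\tau]$ for which the angular limit $$Q_h(\eta):=\angle\lim_{z\to\eta}\frac{(z-\eta)h'(z)}{h(z)}$$ exists finitely and is different from zero. *)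

(* Defs.v *)
(* Stdlib reals, with Coquelicot's complex numbers, filters and derivatives. *)
From Stdlib Require Import Reals.
From Coquelicot Require Import Coquelicot.

Local Open Scope R_scope.

Definition unit_disk (z : C) : Prop := Cmod z < 1.

Definition disk_image (h : C -> C) (w : C) : Prop :=
  exists z : C, unit_disk z /\ h z = w.

(* Functions on the disk are encoded as total functions [C -> C]; the values
   outside the disk play no role. *)
Definition univalent (h : C -> C) : Prop :=
  (forall z : C, unit_disk z -> ex_derive h z) /\
  (forall z w : C, unit_disk z -> unit_disk w -> h z = h w -> z = w).

Definition starlike (h : C -> C) : Prop :=
  univalent h /\
  exists mu : R, 0 < mu /\
    forall z : C, unit_disk z ->
    forall t : R, 0 <= t ->
      disk_image h (RtoC (exp (- mu * t)) * h z)%C.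

(* For [0 < M] this is a subset of the unit disk (it is empty unless [1 < M]). *)
Definition stolz_region (zeta : C) (M : R) (z : C) : Prop :=
  Cmod (z - zeta)%C < M * (1 - Cmod z).

Definition is_angular_lim (f : C -> C) (zeta l : C) : Prop :=
  forall M : R, 1 < M ->
    filterlim f (within (stolz_region zeta M) (locally zeta)) (locally l).

(* At a boundary point [tau] the condition [h(tau) = 0] concerns the angular
   limit, not the value of the total function [h] at [tau]. That 0 is then
   outside the image of the disk is a consequence of univalence. *)
Definition Star (tau : C) (h : C -> C) : Prop :=
  starlike h /\
  (Cmod tau < 1 -> h tau = 0%C) /\
  (Cmod tau = 1 -> is_angular_lim h tau 0%C).

Definition is_Q (h : C -> C) (eta nu : C) : Prop :=
  is_angular_lim (fun z : C => ((z - eta) * C_derive h z / h z)%C) eta nu.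

Definition Star_at (tau eta : C) (h : C -> C) : Prop :=
  Star tau h /\ exists nu : C, nu <> 0%C /\ is_Q h eta nu.

(* [alpha] is one of the values of the multivalued argument of [w]. *)
Definition is_arg (w : C) (alpha : R) : Prop :=
  w <> 0%C /\ w = (RtoC (Cmod w) * (cos alpha, sin alpha))%C.

(* [arg h(r eta)] is read along a branch continuous for [r < 1] close to 1,
   so that its limit is determined up to a multiple of [2 PI]. *)
Definition is_radial_arg_lim (h : C -> C) (eta : C) (theta : R) : Prop :=
  exists a : R -> R,
    at_left 1 (fun r : R => continuous a r /\ is_arg (h (RtoC r * eta)%C) (a r)) /\
    filterlim a (at_left 1) (locally theta).

Definition wedge (theta beta : R) (w : C) : Prop :=
  exists alpha : R, is_arg w alpha /\ Rabs (alpha - theta) < beta.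

(* Main.v *)
Require Import Defs.
From Stdlib Require Import Reals Lra Psatz ClassicalEpsilon Ranalysis5.
From Coquelicot Require Import Coquelicot.

(** After a rotation [eta = 1]; write [H] for the rotated function and
    [ray t phi = 1 - t e^(i phi)].

    The limit [nu] is a negative real number [- n].  The maps
    [z -> H^-1 (e^-t H z)] send the disk into itself, so they do not increase
    the pseudo-hyperbolic distance.  Slightly contracted, they have fixed
    points; letting [t] tend to 0 yields a point [p] of the closed disk for
    which the Berkson-Porta inequality holds, a sign condition on [H / H']
    ([berkson_porta]).  If [p] is not 1, this condition near 1, where [H / H']
    behaves like [(z - 1) / nu] in every Stolz angle, leaves only negative
    values of [nu] ([nu_negative]).  If [p] were 1, it would make [|H|]
    decrease along circular arcs ending at 1; one of them starts at [tau / eta],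
    where [H] has the limit 0, so that [H] would vanish ([no_limit_zero]).

    Integrating [H' / H], which is close to [- n / (z - 1)], shows that
    [|H (ray t 0)|] is [t^(- n)] up to arbitrarily small changes of the exponent
    ([radial_growth]), and that on the small arc [phi -> ray t phi] the argument
    of [H] runs like [- n phi] ([values_on_arc]).  If [H (ray t 0)] points nearly
    in the direction [theta] for arbitrarily small [t], these arcs therefore
    meet every ray of the wedge of half-angle [n PI / 2] about [theta], at
    arbitrarily large moduli, and starlikeness gives the whole wedge
    ([wedge_of_cluster_direction]).

    Conversely, if the image contains a wedge of half-angle [beta], then
    [H^-1], composed with a power map from the half-plane onto that wedge, maps
    into the disk, and the Schwarz-Pick inequality forces [|H|] to grow at least
    like [t^(- 2 beta / PI)] wherever [H] points into the wedge; hence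
    [beta <= n PI / 2] ([wedge_sharp]).  The same comparison makes
    [arg H (ray t 0)] converge: two different limit directions, close to each
    other, would give two wedges whose union is too large
    ([radial_direction_converges]).

    The function theory rests on a maximum principle for functions that are
    continuous on a disk and holomorphic except possibly at one point
    ([max_principle]), obtained from Goursat's theorem in logarithmic
    coordinates.  Applied to difference quotients it yields the Schwarz-Pick
    inequality, and, through reciprocals, the open mapping property and the
    nonvanishing of the derivative of an injective function. *)

Local Open Scope R_scope.

(** * Complex arithmetic *)

Lemma C_ext (a b : C) : Re a = Re b -> Im a = Im b -> a = b.
Proof. destruct a, b; simpl; intros -> ->; reflexivity. Qed.

Lemma re_minus (a b : C) : Re (a - b)%C = Re a - Re b.
Proof. reflexivity. Qed.

Lemma im_minus (a b : C) : Im (a - b)%C = Im a - Im b.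
Proof. reflexivity. Qed.

Lemma Cmod_sqr (z : C) : Cmod z * Cmod z = Re z * Re z + Im z * Im z.
Proof. generalize (Cmod2_alt z); intros H; simpl in H; lra. Qed.

Lemma Cmod_minus_sym (a b : C) : Cmod (a - b)%C = Cmod (b - a)%C.
Proof. rewrite <- (Cmod_opp (a - b)%C); f_equal; ring. Qed.

Lemma Cmod_triangle_3 (a b c : C) : Cmod (a - c)%C <= Cmod (a - b)%C + Cmod (b - c)%C.
Proof. replace (a - c)%C with ((a - b) + (b - c))%C by ring; apply Cmod_triangle. Qed.

Lemma Cmod_triangle_inv (a b : C) : Cmod a - Cmod b <= Cmod (a - b)%C.
Proof.
generalize (Cmod_triangle (a - b)%C b); replace (a - b + b)%C with a by ring; lra.
Qed.

Lemma im_le_Cmod (c : C) : Rabs (Im c) <= Cmod c.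
Proof. generalize (Rmax_Cmod c) (Rmax_r (Rabs (fst c)) (Rabs (snd c))); unfold Im; lra. Qed.

Lemma Cmod_le_re_im (c : C) : Cmod c <= Rabs (Re c) + Rabs (Im c).
Proof.
apply Rsqr_incr_0_var; unfold Rsqr; [rewrite Cmod_sqr|generalize (Rabs_pos (Re c)) (Rabs_pos (Im c)); lra].
generalize (Rabs_pos (Re c)) (Rabs_pos (Im c)) (Rsqr_abs (Re c)) (Rsqr_abs (Im c)); unfold Rsqr; nra.
Qed.

Lemma Cmod_lt_1_sqr (z : C) : Cmod z < 1 -> Re z * Re z + Im z * Im z < 1.
Proof. rewrite <- Cmod_sqr; generalize (Cmod_ge_0 z); nra. Qed.

Lemma Cminus_diag (a : C) : (a - a)%C = 0%C.
Proof. ring. Qed.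

Lemma Cmod_diag (a : C) : Cmod (a - a)%C = 0.
Proof. rewrite Cminus_diag; apply Cmod_0. Qed.

Lemma Cminus_neq_0 (a b : C) : a <> b -> (a - b)%C <> 0%C.
Proof.
intros H K; apply H; replace a with ((a - b) + b)%C by ring; rewrite K; ring.
Qed.

(** * Continuity and complex derivatives *)

Definition ccont (f : C -> C) (a : C) : Prop :=
  forall eps : R, 0 < eps -> exists d : R, 0 < d /\
    forall z : C, Cmod (z - a)%C < d -> Cmod (f z - f a)%C < eps.

Definition cdiff (f : C -> C) (a l : C) : Prop :=
  forall eps : R, 0 < eps -> exists d : R, 0 < d /\
    forall z : C, Cmod (z - a)%C < d ->
      Cmod (f z - f a - l * (z - a))%C <= eps * Cmod (z - a)%C.

(** Completing the quotient by [l] at [a] turns differentiability into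
    continuity, after Caratheodory.  Such quotients are the functions with an
    exceptional point to which the maximum principle is applied. *)
Definition dquot (f : C -> C) (a l z : C) : C :=
  if Ceq_dec z a then l else ((f z - f a) / (z - a))%C.

Lemma dquot_at f a l : dquot f a l a = l.
Proof. unfold dquot; destruct (Ceq_dec a a); congruence. Qed.

Lemma dquot_spec f a l z : f z = (f a + dquot f a l z * (z - a))%C.
Proof.
unfold dquot; destruct (Ceq_dec z a) as [->|n]; [ring|].
field; now apply Cminus_neq_0.
Qed.

Lemma cdiff_of_factor (f q : C -> C) (a : C) :
  (forall z, f z = f a + q z * (z - a))%C -> ccont q a -> cdiff f a (q a).
Proof.
intros E Q eps He; destruct (Q eps He) as [d [Hd K]]; exists d; split; [easy|].
intros z Hz; rewrite (E z).
replace (f a + q z * (z - a) - f a - q a * (z - a))%C with ((q z - q a) * (z - a))%C by ring.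
rewrite Cmod_mult; apply Rmult_le_compat_r; [apply Cmod_ge_0|]; left; auto.
Qed.

Lemma ccont_dquot f a l : cdiff f a l -> ccont (dquot f a l) a.
Proof.
intros D eps He; destruct (D (eps / 2)) as [d [Hd K]]; [lra|].
exists d; split; [easy|]; intros z Hz; rewrite dquot_at; unfold dquot.
destruct (Ceq_dec z a) as [->|n].
- rewrite Cmod_diag; lra.
- assert (N := Cminus_neq_0 _ _ n).
  replace ((f z - f a) / (z - a) - l)%C with ((f z - f a - l * (z - a)) / (z - a))%C by (field; easy).
  rewrite Cmod_div by easy; assert (P : 0 < Cmod (z - a)%C) by now apply Cmod_gt_0.
  apply Rle_lt_trans with (eps / 2); [|lra].
  apply Rle_div_l; [lra|]; auto.
Qed.

Lemma ccont_const (c a : C) : ccont (fun _ => c) a.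
Proof.
intros eps He; exists 1; split; [lra|]; intros; rewrite Cmod_diag; lra.
Qed.

Lemma ccont_id a : ccont (fun z => z) a.
Proof. intros eps He; exists eps; auto. Qed.

Lemma ccont_plus f g a : ccont f a -> ccont g a -> ccont (fun z => f z + g z)%C a.
Proof.
intros F G eps He; destruct (F (eps / 2)) as [d [Hd K]]; [lra|]; destruct (G (eps / 2)) as [d' [Hd' K']]; [lra|].
exists (Rmin d d'); split; [now apply Rmin_pos|]; intros z Hz.
replace (f z + g z - (f a + g a))%C with ((f z - f a) + (g z - g a))%C by ring.
eapply Rle_lt_trans; [apply Cmod_triangle|].
generalize (K z) (K' z) (Rmin_l d d') (Rmin_r d d'); intros; lra.
Qed.

Lemma ccont_comp f g a : ccont f a -> ccont g (f a) -> ccont (fun z => g (f z)) a.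
Proof.
intros F G eps He; destruct (G eps He) as [d [Hd K]]; destruct (F d Hd) as [d' [Hd' K']].
exists d'; auto.
Qed.

Lemma ccont_scal (c a : C) : ccont (fun z => c * z)%C a.
Proof.
intros eps He; exists (eps / (Cmod c + 1)); assert (0 <= Cmod c) by apply Cmod_ge_0.
split; [apply Rdiv_lt_0_compat; lra|]; intros z Hz.
replace (c * z - c * a)%C with (c * (z - a))%C by ring; rewrite Cmod_mult.
apply Rlt_div_r in Hz; [|lra]; generalize (Cmod_ge_0 (z - a)%C); nra.
Qed.

Lemma ccont_opp f a : ccont f a -> ccont (fun z => - f z)%C a.
Proof.
intros F eps He; destruct (F eps He) as [d [Hd K]]; exists d; split; [easy|]; intros z Hz.
replace (- f z - - f a)%C with (- (f z - f a))%C by ring; rewrite Cmod_opp; auto.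
Qed.

Lemma ccont_minus f g a : ccont f a -> ccont g a -> ccont (fun z => f z - g z)%C a.
Proof. intros; apply ccont_plus; [easy|now apply ccont_opp]. Qed.

Lemma ccont_mult f g a : ccont f a -> ccont g a -> ccont (fun z => f z * g z)%C a.
Proof.
intros F G eps He.
set (e := Rmin 1 (eps / (Cmod (f a) + Cmod (g a) + 2))).
assert (P1 := Cmod_ge_0 (f a)); assert (P2 := Cmod_ge_0 (g a)).
assert (E : 0 < e) by (apply Rmin_pos; [lra|apply Rdiv_lt_0_compat; lra]).
assert (E1 : e <= 1) by apply Rmin_l.
assert (E2 : e * (Cmod (f a) + Cmod (g a) + 2) <= eps) by (apply Rle_div_r; [lra|apply Rmin_r]).
destruct (F e E) as [d [Hd K]]; destruct (G e E) as [d' [Hd' K']].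
exists (Rmin d d'); split; [now apply Rmin_pos|]; intros z Hz.
replace (f z * g z - f a * g a)%C
  with ((f z - f a) * (g z - g a) + (f z - f a) * g a + f a * (g z - g a))%C by ring.
assert (A := K z ltac:(generalize (Rmin_l d d'); lra)).
assert (B := K' z ltac:(generalize (Rmin_r d d'); lra)).
eapply Rle_lt_trans; [apply Cmod_triangle|]; rewrite Cmod_mult.
eapply Rle_lt_trans; [apply Rplus_le_compat_r, Cmod_triangle|]; rewrite !Cmod_mult.
generalize (Cmod_ge_0 (f z - f a)%C) (Cmod_ge_0 (g z - g a)%C); nra.
Qed.

Lemma ccont_inv_id (a : C) : a <> 0%C -> ccont Cinv a.
Proof.
intros N eps He; assert (P : 0 < Cmod a) by now apply Cmod_gt_0.
set (d := Rmin (Cmod a / 2) (eps * (Cmod a * Cmod a) / 4)).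
assert (D : 0 < d) by (apply Rmin_pos; [lra|]; apply Rdiv_lt_0_compat; [repeat apply Rmult_lt_0_compat; lra|lra]).
assert (D1 : d <= Cmod a / 2) by apply Rmin_l.
assert (D2 : d <= eps * (Cmod a * Cmod a) / 4) by apply Rmin_r.
exists d; split; [easy|]; intros z Hz.
assert (L : Cmod a / 2 < Cmod z).
{ generalize (Cmod_triangle_inv a z); rewrite Cmod_minus_sym in Hz; lra. }
assert (Z : z <> 0%C) by (apply Cmod_gt_0; lra).
replace (/ z - / a)%C with ((a - z) / (z * a))%C by (field; auto).
rewrite Cmod_div, Cmod_mult by (now apply Cmult_neq_0); rewrite Cmod_minus_sym.
apply Rlt_div_l; [nra|].
assert (0 < eps * Cmod a) by nra.
nra.
Qed.

Lemma ccont_inv f a : ccont f a -> f a <> 0%C -> ccont (fun z => / f z)%C a.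
Proof. intros F N; apply (ccont_comp f Cinv); [easy|now apply ccont_inv_id]. Qed.

Lemma ccont_div f g a : ccont f a -> ccont g a -> g a <> 0%C -> ccont (fun z => f z / g z)%C a.
Proof. intros; apply ccont_mult; [easy|now apply ccont_inv]. Qed.

Lemma cdiff_ccont f a l : cdiff f a l -> ccont f a.
Proof.
intros D; apply ccont_dquot in D.
intros eps He.
destruct (ccont_plus (fun _ => f a) (fun z => dquot f a l z * (z - a))%C a) with (eps := eps) as [d [Hd K]]; auto.
- apply ccont_const.
- apply ccont_mult; [easy|]; apply ccont_minus; [apply ccont_id|apply ccont_const].
- exists d; split; [easy|]; intros z Hz; generalize (K z Hz); rewrite <- !dquot_spec; auto.
Qed.

Lemma cdiff_ext_loc f g a l r : 0 < r -> (forall z, Cmod (z - a)%C < r -> f z = g z) ->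
  cdiff f a l -> cdiff g a l.
Proof.
intros Hr E D eps He; destruct (D eps He) as [d [Hd K]]; exists (Rmin d r); split; [now apply Rmin_pos|].
intros z Hz; generalize (Rmin_l d r) (Rmin_r d r); intros.
rewrite <- !E; [apply K; lra| |lra].
rewrite Cmod_diag; easy.
Qed.

Lemma cdiff_const (c a : C) : cdiff (fun _ => c) a 0%C.
Proof. apply (cdiff_of_factor _ (fun _ => 0%C)); [intros; ring|apply ccont_const]. Qed.

Lemma cdiff_id a : cdiff (fun z => z) a 1%C.
Proof. apply (cdiff_of_factor _ (fun _ => 1%C)); [intros; ring|apply ccont_const]. Qed.

Lemma cdiff_eq f a l l' : cdiff f a l -> l = l' -> cdiff f a l'.
Proof. now intros ? <-. Qed.

Lemma cdiff_plus f g a l m : cdiff f a l -> cdiff g a m -> cdiff (fun z => f z + g z)%C a (l + m)%C.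
Proof.
intros F G; eapply cdiff_eq.
- apply (cdiff_of_factor _ (fun z => dquot f a l z + dquot g a m z)%C).
  + intros z; rewrite (dquot_spec f a l z) at 1; rewrite (dquot_spec g a m z) at 1; ring.
  + apply ccont_plus; now apply ccont_dquot.
- now rewrite !dquot_at.
Qed.

Lemma cdiff_mult f g a l m : cdiff f a l -> cdiff g a m ->
  cdiff (fun z => f z * g z)%C a (l * g a + f a * m)%C.
Proof.
intros F G; eapply cdiff_eq.
- apply (cdiff_of_factor _ (fun z => dquot f a l z * g z + f a * dquot g a m z)%C).
  + intros z; rewrite (dquot_spec f a l z) at 1; rewrite (dquot_spec g a m z); ring.
  + apply ccont_plus; apply ccont_mult; try (now apply ccont_dquot).
    * eapply cdiff_ccont; eauto.
    * apply ccont_const.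
- now rewrite !dquot_at.
Qed.

Lemma cdiff_comp f g a l m : cdiff f a l -> cdiff g (f a) m -> cdiff (fun z => g (f z)) a (m * l)%C.
Proof.
intros F G; eapply cdiff_eq.
- apply (cdiff_of_factor _ (fun z => dquot g (f a) m (f z) * dquot f a l z)%C).
  + intros z; rewrite (dquot_spec g (f a) m (f z)) at 1.
    rewrite (dquot_spec f a l z) at 2; ring.
  + apply ccont_mult; [|now apply ccont_dquot].
    apply (ccont_comp f (dquot g (f a) m)); [eapply cdiff_ccont; eauto|now apply ccont_dquot].
- now rewrite !dquot_at.
Qed.

Lemma cdiff_inv_id (a : C) : a <> 0%C -> cdiff Cinv a (- / (a * a))%C.
Proof.
intros N; eapply cdiff_eq.
- assert (P : 0 < Cmod a) by now apply Cmod_gt_0.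
  eapply (cdiff_ext_loc (fun z => / a + (- / (z * a)) * (z - a))%C _ a _ (Cmod a) P).
  + intros z Hz; assert (z <> 0%C).
    { intros ->; replace (0 - a)%C with (- a)%C in Hz by ring; rewrite Cmod_opp in Hz; lra. }
    field; auto.
  + apply (cdiff_of_factor _ (fun z => - / (z * a))%C).
    * intros z; ring.
    * apply ccont_opp, ccont_inv; [|now apply Cmult_neq_0].
      apply ccont_mult; [apply ccont_id|apply ccont_const].
- reflexivity.
Qed.

Lemma cdiff_inv f a l : cdiff f a l -> f a <> 0%C ->
  cdiff (fun z => / f z)%C a (- / (f a * f a) * l)%C.
Proof. intros F N; apply (cdiff_comp f Cinv); [easy|now apply cdiff_inv_id]. Qed.

Lemma cdiff_opp f a l : cdiff f a l -> cdiff (fun z => - f z)%C a (- l)%C.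
Proof.
intros F eps He; destruct (F eps He) as [d [Hd K]]; exists d; split; [easy|]; intros z Hz.
replace (- f z - - f a - - l * (z - a))%C with (- (f z - f a - l * (z - a)))%C by ring.
rewrite Cmod_opp; auto.
Qed.

Lemma cdiff_minus f g a l m : cdiff f a l -> cdiff g a m -> cdiff (fun z => f z - g z)%C a (l - m)%C.
Proof. intros; apply cdiff_plus; [easy|now apply cdiff_opp]. Qed.

Lemma cdiff_ex_derive (h : C -> C) (z : C) : ex_derive h z -> cdiff h z (C_derive h z).
Proof.
intros D; apply C_derive_correct in D; [|exact 0%C].
destruct D as [_ D]; intros eps He.
assert (D' := D z (fun P H => H) (mkposreal eps He)).
apply (proj2 (locally_C _ _)) in D'.
destruct D' as [d K]; exists d; split; [apply cond_pos|].
intros y Hy.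
assert (Y : @ball C_UniformSpace z d y) by now apply C_NormedModule_mixin_compat1.
generalize (K y Y).
change (Cmod ((h y - h z) - (y - z) * C_derive h z)%C <= eps * Cmod (y - z)%C -> Cmod (h y - h z - C_derive h z * (y - z))%C <= eps * Cmod (y - z)%C).
now rewrite (Cmult_comm (C_derive h z)).
Qed.

Definition hol_at (f : C -> C) (a : C) : Prop := exists l, cdiff f a l.

Lemma hol_ccont f a : hol_at f a -> ccont f a.
Proof. intros [l H]; eapply cdiff_ccont; eauto. Qed.
Lemma hol_const c a : hol_at (fun _ => c) a.
Proof. eexists; apply cdiff_const. Qed.
Lemma hol_id a : hol_at (fun z => z) a.
Proof. eexists; apply cdiff_id. Qed.
Lemma hol_plus f g a : hol_at f a -> hol_at g a -> hol_at (fun z => f z + g z)%C a.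
Proof. intros [l H] [m K]; eexists; apply cdiff_plus; eauto. Qed.
Lemma hol_minus f g a : hol_at f a -> hol_at g a -> hol_at (fun z => f z - g z)%C a.
Proof. intros [l H] [m K]; eexists; apply cdiff_minus; eauto. Qed.
Lemma hol_mult f g a : hol_at f a -> hol_at g a -> hol_at (fun z => f z * g z)%C a.
Proof. intros [l H] [m K]; eexists; apply cdiff_mult; eauto. Qed.
Lemma hol_inv f a : hol_at f a -> f a <> 0%C -> hol_at (fun z => / f z)%C a.
Proof. intros [l H] N; eexists; apply cdiff_inv; eauto. Qed.
Lemma hol_div f g a : hol_at f a -> hol_at g a -> g a <> 0%C -> hol_at (fun z => f z / g z)%C a.
Proof. intros; apply hol_mult; [easy|now apply hol_inv]. Qed.
Lemma hol_comp f g a : hol_at f a -> hol_at g (f a) -> hol_at (fun z => g (f z)) a.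
Proof. intros [l H] [m K]; eexists; apply (cdiff_comp f g); eauto. Qed.

Lemma hol_dquot (f : C -> C) (a l z : C) : z <> a -> hol_at f z -> hol_at (dquot f a l) z.
Proof.
intros N [m D].
assert (H : hol_at (fun z => (f z - f a) / (z - a))%C z).
{ apply hol_div; [apply hol_minus; [now exists m|apply hol_const]|apply hol_minus; [apply hol_id|apply hol_const]|].
  now apply Cminus_neq_0. }
destruct H as [k H]; exists k.
assert (P : 0 < Cmod (z - a)%C) by (apply Cmod_gt_0; now apply Cminus_neq_0).
apply (cdiff_ext_loc (fun z => (f z - f a) / (z - a))%C (dquot f a l) z k _ P); [|exact H].
intros y Hy; unfold dquot; destruct (Ceq_dec y a) as [->|]; [|easy].
exfalso; rewrite Cmod_minus_sym in Hy; lra.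
Qed.

Lemma ccont_dquot_all f a l z : cdiff f a l -> hol_at f z -> ccont (dquot f a l) z.
Proof.
intros D Hz; destruct (Ceq_dec z a) as [->|N]; [now apply ccont_dquot|].
now apply hol_ccont, hol_dquot.
Qed.

(** * The exponential and curves in the plane *)

Definition cis (t : R) : C := (cos t, sin t).

Definition cexp (z : C) : C := (RtoC (exp (Re z)) * cis (Im z))%C.

Lemma cis_plus (s t : R) : cis (s + t) = (cis s * cis t)%C.
Proof. apply C_ext; unfold cis; simpl; [rewrite cos_plus|rewrite sin_plus]; ring. Qed.

Lemma Cmod_cis (t : R) : Cmod (cis t) = 1.
Proof.
unfold Cmod, cis; simpl; rewrite !Rmult_1_r.
replace (cos t * cos t + sin t * sin t) with (Rsqr (sin t) + Rsqr (cos t)) by (unfold Rsqr; ring).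
now rewrite sin2_cos2, sqrt_1.
Qed.

Lemma cexp_plus (a b : C) : cexp (a + b)%C = (cexp a * cexp b)%C.
Proof.
unfold cexp; rewrite re_plus; change (Im (a + b)%C) with (Im a + Im b).
rewrite cis_plus, exp_plus, RtoC_mult; ring.
Qed.

Lemma Cmod_cexp (z : C) : Cmod (cexp z) = exp (Re z).
Proof.
unfold cexp; rewrite Cmod_mult, Cmod_cis, Cmod_R, Rabs_pos_eq; [ring|left; apply exp_pos].
Qed.

Lemma cexp_neq_0 (z : C) : cexp z <> 0%C.
Proof. apply Cmod_gt_0; rewrite Cmod_cexp; apply exp_pos. Qed.

Lemma is_derive_eps (f : R -> R) (x l : R) :
  is_derive f x l <-> forall eps, 0 < eps -> exists d, 0 < d /\
    forall y, Rabs (y - x) < d -> Rabs (f y - f x - (y - x) * l) <= eps * Rabs (y - x).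
Proof.
rewrite is_derive_Reals; split.
- intros H eps He; destruct (H eps He) as [[d Hd] K]; exists d; split; [easy|]; simpl in K.
  intros y Hy; destruct (Req_dec (y - x) 0) as [E|N].
  { replace y with x by lra; replace (f x - f x - (x - x) * l) with 0 by ring.
    replace (x - x) with 0 by ring; rewrite Rabs_R0; lra. }
  generalize (K (y - x) N Hy); replace (x + (y - x)) with y by ring; intros L.
  replace (f y - f x - (y - x) * l) with (((f y - f x) / (y - x) - l) * (y - x)) by (field; easy).
  rewrite Rabs_mult; apply Rmult_le_compat_r; [apply Rabs_pos|lra].
- intros H eps He; destruct (H (eps / 2)) as [d [Hd K]]; [lra|]; exists (mkposreal d Hd); simpl.
  intros h N Hh; generalize (K (x + h)); replace (x + h - x) with h by ring; intros L; specialize (L Hh).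
  replace ((f (x + h) - f x) / h - l) with ((f (x + h) - f x - h * l) / h) by (field; easy).
  rewrite Rabs_div by easy; assert (0 < Rabs h) by now apply Rabs_pos_lt.
  apply Rle_lt_trans with (eps / 2); [|lra]; apply Rle_div_l; lra.
Qed.

Definition curve_diff (g : R -> C) (t : R) (v : C) : Prop :=
  forall eps, 0 < eps -> exists d, 0 < d /\ forall s, Rabs (s - t) < d ->
    Cmod (g s - g t - RtoC (s - t) * v)%C <= eps * Rabs (s - t).

Lemma curve_diff_parts (g : R -> C) (t : R) (v : C) :
  is_derive (fun t => Re (g t)) t (Re v) -> is_derive (fun t => Im (g t)) t (Im v) -> curve_diff g t v.
Proof.
intros A B eps He; rewrite is_derive_eps in A, B.
destruct (A (eps / 2)) as [d [Hd K]]; [lra|]; destruct (B (eps / 2)) as [d' [Hd' K']]; [lra|].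
exists (Rmin d d'); split; [now apply Rmin_pos|]; intros s Hs.
eapply Rle_trans; [apply Cmod_le_re_im|].
rewrite !re_minus, !im_minus, re_scal_l, im_scal_l.
generalize (K s) (K' s) (Rmin_l d d') (Rmin_r d d'); lra.
Qed.

Lemma curve_diff_re (g : R -> C) (t : R) (v : C) :
  curve_diff g t v -> is_derive (fun t => Re (g t)) t (Re v).
Proof.
intros A; apply is_derive_eps; intros eps He; destruct (A eps He) as [d [Hd K]]; exists d; split; [easy|].
intros y Hy; eapply Rle_trans; [|apply (K y Hy)].
eapply Rle_trans; [|apply re_le_Cmod]; rewrite !re_minus, re_scal_l; lra.
Qed.

Lemma curve_diff_im (g : R -> C) (t : R) (v : C) :
  curve_diff g t v -> is_derive (fun t => Im (g t)) t (Im v).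
Proof.
intros A; apply is_derive_eps; intros eps He; destruct (A eps He) as [d [Hd K]]; exists d; split; [easy|].
intros y Hy; eapply Rle_trans; [|apply (K y Hy)].
eapply Rle_trans; [|apply im_le_Cmod]; rewrite !im_minus, im_scal_l; lra.
Qed.

Lemma curve_diff_comp (g : R -> C) (f : C -> C) (t : R) (v l : C) :
  curve_diff g t v -> cdiff f (g t) l -> curve_diff (fun t => f (g t)) t (l * v)%C.
Proof.
intros A B eps He.
set (e1 := Rmin 1 (eps / (2 * (Cmod l + 1)))).
assert (P := Cmod_ge_0 l); assert (P' := Cmod_ge_0 v).
assert (E1 : 0 < e1) by (apply Rmin_pos; [lra|apply Rdiv_lt_0_compat; lra]).
assert (E1' : e1 * (2 * (Cmod l + 1)) <= eps) by (apply Rle_div_r; [lra|apply Rmin_r]).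
assert (E1'' : e1 <= 1) by apply Rmin_l.
set (e2 := eps / (2 * (Cmod v + 1))).
assert (E2 : 0 < e2) by (apply Rdiv_lt_0_compat; lra).
assert (E2' : e2 * (2 * (Cmod v + 1)) = eps) by (unfold e2; field; lra).
destruct (A e1 E1) as [d [Hd K]]; destruct (B e2 E2) as [d' [Hd' K']].
assert (S : 0 < d' / (Cmod v + 1)) by (apply Rdiv_lt_0_compat; lra).
exists (Rmin d (d' / (Cmod v + 1))); split; [now apply Rmin_pos|]; intros s Hs.
assert (H1 : Rabs (s - t) < d) by (generalize (Rmin_l d (d' / (Cmod v + 1))); lra).
assert (H2 : Rabs (s - t) * (Cmod v + 1) < d').
{ apply Rlt_div_r; [lra|]; generalize (Rmin_r d (d' / (Cmod v + 1))); lra. }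
specialize (K s H1); assert (Q := Rabs_pos (s - t)).
assert (L : Cmod (g s - g t)%C <= Rabs (s - t) * (Cmod v + 1)).
{ replace (g s - g t)%C with ((g s - g t - RtoC (s - t) * v) + RtoC (s - t) * v)%C by ring.
  eapply Rle_trans; [apply Cmod_triangle|]; rewrite Cmod_mult, Cmod_R; nra. }
assert (L' := K' (g s) ltac:(lra)).
replace (f (g s) - f (g t) - RtoC (s - t) * (l * v))%C
 with ((f (g s) - f (g t) - l * (g s - g t)) + l * (g s - g t - RtoC (s - t) * v))%C by ring.
eapply Rle_trans; [apply Cmod_triangle|]; rewrite Cmod_mult.
assert (M1 : Cmod l * Cmod (g s - g t - RtoC (s - t) * v) <= Cmod l * (e1 * Rabs (s - t))) by (apply Rmult_le_compat_l; easy).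
assert (M2 : e2 * Cmod (g s - g t) <= e2 * (Rabs (s - t) * (Cmod v + 1))) by (apply Rmult_le_compat_l; lra).
replace (e2 * (Rabs (s - t) * (Cmod v + 1))) with (eps / 2 * Rabs (s - t)) in M2 by (rewrite <- E2'; field).
assert (M3 : e1 * Cmod l * Rabs (s - t) <= eps / 2 * Rabs (s - t)) by (apply Rmult_le_compat_r; [lra|nra]).
lra.
Qed.

Lemma curve_diff_eq g t v v' : curve_diff g t v -> v = v' -> curve_diff g t v'.
Proof. now intros ? <-. Qed.

Lemma cexp_cdiff_0 : cdiff cexp 0%C 1%C.
Proof.
intros eps He.
assert (X : is_derive exp 0 1) by (auto_derive; [easy|rewrite exp_0; ring]).
assert (Y : is_derive cos 0 0) by (auto_derive; [easy|rewrite sin_0; ring]).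
assert (Z : is_derive sin 0 1) by (auto_derive; [easy|rewrite cos_0; ring]).
rewrite is_derive_eps in X, Y, Z.
set (e := Rmin 1 (eps / 20)).
assert (E : 0 < e) by (apply Rmin_pos; lra).
assert (E1 : e <= 1) by apply Rmin_l.
assert (E2 : e <= eps / 20) by apply Rmin_r.
destruct (X e E) as [d1 [H1 K1]]; destruct (Y e E) as [d2 [H2 K2]]; destruct (Z e E) as [d3 [H3 K3]].
set (d := Rmin e (Rmin d1 (Rmin d2 d3))).
assert (D : 0 < d) by (repeat apply Rmin_pos; lra).
assert (D0 : d <= e) by apply Rmin_l.
assert (D' : d <= Rmin d1 (Rmin d2 d3)) by apply Rmin_r.
assert (D1 : d <= d1) by (generalize (Rmin_l d1 (Rmin d2 d3)); lra).
assert (D'' : d <= Rmin d2 d3) by (generalize (Rmin_r d1 (Rmin d2 d3)); lra).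
assert (D2 : d <= d2) by (generalize (Rmin_l d2 d3); lra).
assert (D3 : d <= d3) by (generalize (Rmin_r d2 d3); lra).
exists d; split; [easy|]; intros z Hz.
replace (z - 0)%C with z in Hz by ring; replace (z - 0)%C with z by ring.
assert (A := re_le_Cmod z); assert (B := im_le_Cmod z).
set (x := Re z) in *; set (y := Im z) in *; set (m := Cmod z) in *.
specialize (K1 x); specialize (K2 y); specialize (K3 y).
rewrite exp_0 in K1; rewrite cos_0 in K2; rewrite sin_0 in K3; rewrite !Rminus_0_r, ?Rmult_1_r, ?Rmult_0_r in *.
specialize (K1 ltac:(lra)); specialize (K2 ltac:(lra)); specialize (K3 ltac:(lra)).
assert (C0 : cexp 0%C = 1%C).
{ apply C_ext; unfold cexp, cis; simpl; rewrite exp_0, cos_0, sin_0; ring. }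
rewrite C0; eapply Rle_trans; [apply Cmod_le_re_im|].
rewrite !re_minus, !im_minus.
replace (Re (1 * z)%C) with x by (now rewrite Cmult_1_l).
replace (Im (1 * z)%C) with y by (now rewrite Cmult_1_l).
replace (Re (cexp z)) with (exp x * cos y) by (unfold cexp, cis, x, y, Re, Im; simpl; ring).
replace (Im (cexp z)) with (exp x * sin y) by (unfold cexp, cis, x, y, Re, Im; simpl; ring).
change (Re 1%C) with 1; change (Im 1%C) with 0.
set (u := exp x - 1 - x) in *; set (v := cos y - 1) in *; set (w := sin y - y) in *.
rewrite Rminus_0_r in K2.
replace (exp x * cos y - 1 - x) with (u + v + v * (x + u)) by (unfold u, v; ring).
replace (exp x * sin y - 0 - y) with (w + (x + u) * (y + w)) by (unfold u, w; ring).
assert (M : 0 <= m) by apply Cmod_ge_0.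
assert (U : Rabs u <= e * m) by nra.
assert (V : Rabs v <= e * m) by nra.
assert (W : Rabs w <= e * m) by nra.
assert (XU : Rabs (x + u) <= 2 * m) by (eapply Rle_trans; [apply Rabs_triang|nra]).
assert (YW : Rabs (y + w) <= 2 * m) by (eapply Rle_trans; [apply Rabs_triang|nra]).
assert (Q1 : Rabs (v * (x + u)) <= 2 * e * m).
{ rewrite Rabs_mult; replace (2 * e * m) with ((e * m) * 2) by ring.
  apply Rmult_le_compat; try apply Rabs_pos; nra. }
assert (Q2 : Rabs ((x + u) * (y + w)) <= 4 * e * m).
{ rewrite Rabs_mult; apply Rle_trans with ((2 * m) * (2 * m)).
  - apply Rmult_le_compat; try apply Rabs_pos; easy.
  - nra. }
assert (T1 := Rabs_triang (u + v) (v * (x + u))); assert (T2 := Rabs_triang u v); assert (T3 := Rabs_triang w ((x + u) * (y + w))).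
nra.
Qed.

Lemma cexp_cdiff (z : C) : cdiff cexp z (cexp z).
Proof.
assert (H : cdiff (fun w => cexp z * cexp (w - z))%C z (cexp z)).
{ eapply cdiff_eq.
  - apply cdiff_mult; [apply cdiff_const|].
    apply (cdiff_comp (fun w => w - z)%C cexp).
    + apply cdiff_minus; [apply cdiff_id|apply cdiff_const].
    + rewrite Cminus_diag; apply cexp_cdiff_0.
  - cbv beta; ring. }
apply (cdiff_ext_loc _ cexp _ _ 1 Rlt_0_1) in H; [exact H|].
intros w _; rewrite <- cexp_plus; f_equal; ring.
Qed.

Lemma curve_diff_cis (t : R) : curve_diff cis t (Ci * cis t)%C.
Proof.
apply curve_diff_parts; unfold cis; simpl; auto_derive; try easy; ring.
Qed.

Lemma is_derive_Cmod2 (g : R -> C) (t : R) (v : C) : curve_diff g t v ->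
  is_derive (fun t => Cmod (g t) * Cmod (g t)) t (2 * Re (Cconj (g t) * v)%C).
Proof.
intros D; assert (A := curve_diff_re _ _ _ D); assert (B := curve_diff_im _ _ _ D).
apply (is_derive_ext (fun t => Re (g t) * Re (g t) + Im (g t) * Im (g t))).
{ intros s; now rewrite Cmod_sqr. }
replace (2 * Re (Cconj (g t) * v)%C) with
 ((Re v * Re (g t) + Re (g t) * Re v) + (Im v * Im (g t) + Im (g t) * Im v))
 by (rewrite re_mult, re_conj, im_conj; ring).
apply @is_derive_plus; apply @is_derive_mult; try easy; intros; apply Rmult_comm.
Qed.

Lemma increasing_of_derive (f df : R -> R) (a b : R) : a <= b ->
  (forall x, a <= x <= b -> is_derive f x (df x)) ->
  (forall x, a <= x <= b -> 0 <= df x) -> f a <= f b.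
Proof.
intros L D P.
destruct (MVT_gen f a b df) as [c [Hc E]].
- intros x; rewrite Rmin_left, Rmax_right by easy; intros; apply D; lra.
- intros x; rewrite Rmin_left, Rmax_right by easy; intros.
  apply continuity_pt_filterlim, (ex_derive_continuous f); eexists; now apply D.
- rewrite Rmin_left, Rmax_right in Hc by easy; generalize (P c Hc); nra.
Qed.

Lemma continuous_eps (f : R -> R) (x : R) :
  continuous f x <-> forall eps, 0 < eps -> exists d, 0 < d /\
    forall y, Rabs (y - x) < d -> Rabs (f y - f x) < eps.
Proof.
split.
- intros H eps He; destruct (proj1 (filterlim_locally f (f x)) H (mkposreal eps He)) as [d K].
  exists d; split; [apply cond_pos|]; intros y Hy; exact (K y Hy).
- intros H; apply filterlim_locally; intros [eps He]; destruct (H eps He) as [d [Hd K]].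
  exists (mkposreal d Hd); intros y Hy; exact (K y Hy).
Qed.

Definition curve_cont (g : R -> C) (t : R) : Prop :=
  forall eps, 0 < eps -> exists d, 0 < d /\ forall s, Rabs (s - t) < d -> Cmod (g s - g t)%C < eps.

Lemma curve_cont_comp (g : R -> C) (f : C -> C) t : curve_cont g t -> ccont f (g t) -> curve_cont (fun t => f (g t)) t.
Proof.
intros A B eps He; destruct (B eps He) as [d [Hd K]]; destruct (A d Hd) as [d' [Hd' K']]; exists d'; auto.
Qed.

Lemma curve_cont_re (g : R -> C) t : curve_cont g t -> continuous (fun t => Re (g t)) t.
Proof.
intros A; apply continuous_eps; intros eps He; destruct (A eps He) as [d [Hd K]]; exists d; split; [easy|].
intros y Hy; eapply Rle_lt_trans; [|apply (K y Hy)]; rewrite <- re_minus; apply re_le_Cmod.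
Qed.

Lemma curve_cont_im (g : R -> C) t : curve_cont g t -> continuous (fun t => Im (g t)) t.
Proof.
intros A; apply continuous_eps; intros eps He; destruct (A eps He) as [d [Hd K]]; exists d; split; [easy|].
intros y Hy; eapply Rle_lt_trans; [|apply (K y Hy)]; rewrite <- im_minus; apply im_le_Cmod.
Qed.

Lemma curve_diff_cont g t v : curve_diff g t v -> curve_cont g t.
Proof.
intros A eps He; destruct (A 1 Rlt_0_1) as [d [Hd K]].
assert (P := Cmod_ge_0 v).
exists (Rmin d (eps / (Cmod v + 1))); split; [apply Rmin_pos; [easy|apply Rdiv_lt_0_compat; lra]|]; intros s Hs.
assert (H1 : Rabs (s - t) < d) by (generalize (Rmin_l d (eps / (Cmod v + 1))); lra).
assert (H2 : Rabs (s - t) * (Cmod v + 1) < eps).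
{ apply Rlt_div_r; [lra|]; generalize (Rmin_r d (eps / (Cmod v + 1))); lra. }
replace (g s - g t)%C with ((g s - g t - RtoC (s - t) * v) + RtoC (s - t) * v)%C by ring.
eapply Rle_lt_trans; [apply Cmod_triangle|]; rewrite Cmod_mult, Cmod_R; generalize (K s H1); lra.
Qed.

(** * Bisection and compactness *)

Lemma pow2_small (K eps : R) : 0 < eps -> exists n, K / 2 ^ n < eps.
Proof.
intros He; destruct (Pow_x_infinity 2 ltac:(rewrite Rabs_pos_eq; lra) (Rabs K / eps + 1)) as [n Hn].
exists n; specialize (Hn n (le_n n)).
assert (0 < 2 ^ n) by (apply pow_lt; lra); rewrite Rabs_pos_eq in Hn by lra.
apply Rlt_div_l; [lra|]; apply Rle_lt_trans with (Rabs K); [apply Rle_abs|].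
assert (Rabs K / eps < 2 ^ n) by lra; apply Rlt_div_l in H0; lra.
Qed.

Section Bisection.

Variable P : R -> R -> R -> R -> Prop.
Hypothesis P_quarter : forall x y a b, P x y a b ->
  P x y (a / 2) (b / 2) \/ P (x + a / 2) y (a / 2) (b / 2) \/
  P x (y + b / 2) (a / 2) (b / 2) \/ P (x + a / 2) (y + b / 2) (a / 2) (b / 2).

Let next (p : R * R) (a b : R) : R * R :=
  let (x, y) := p in
  if excluded_middle_informative (P x y (a / 2) (b / 2)) then (x, y) else
  if excluded_middle_informative (P (x + a / 2) y (a / 2) (b / 2)) then (x + a / 2, y) else
  if excluded_middle_informative (P x (y + b / 2) (a / 2) (b / 2)) then (x, y + b / 2) else
  (x + a / 2, y + b / 2).

(** Always moving to a quarter that still satisfies [P] produces nested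
    rectangles, which have a common point.  Both compactness and Goursat's
    theorem come from this. *)
Lemma nested_quarters (x0 y0 a b : R) : 0 < a -> 0 < b -> P x0 y0 a b ->
  exists u v : R, forall n : nat, exists x y : R, P x y (a / 2 ^ n) (b / 2 ^ n) /\
    x <= u <= x + a / 2 ^ n /\ y <= v <= y + b / 2 ^ n.
Proof.
intros Ha Hb H0.
set (s := fix s n := match n with O => (x0, y0) | S n => next (s n) (a / 2 ^ n) (b / 2 ^ n) end).
assert (A : forall n, 0 < a / 2 ^ n) by (intros; apply Rdiv_lt_0_compat; [easy|apply pow_lt; lra]).
assert (B : forall n, 0 < b / 2 ^ n) by (intros; apply Rdiv_lt_0_compat; [easy|apply pow_lt; lra]).
assert (A2 : forall n, a / 2 ^ S n = a / 2 ^ n / 2) by (intros; simpl; field; apply pow_nonzero; lra).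
assert (B2 : forall n, b / 2 ^ S n = b / 2 ^ n / 2) by (intros; simpl; field; apply pow_nonzero; lra).
assert (I : forall n, P (fst (s n)) (snd (s n)) (a / 2 ^ n) (b / 2 ^ n)).
{ induction n as [|n IH]; [simpl; now rewrite !Rdiv_1_r|].
  rewrite A2, B2; simpl; destruct (s n) as [x y]; simpl in *.
  repeat destruct excluded_middle_informative; simpl; try easy.
  destruct (P_quarter _ _ _ _ IH) as [|[|[|]]]; easy. }
assert (N : forall n, (fst (s n) <= fst (s (S n)) /\ fst (s (S n)) + a / 2 ^ S n <= fst (s n) + a / 2 ^ n) /\
   (snd (s n) <= snd (s (S n)) /\ snd (s (S n)) + b / 2 ^ S n <= snd (s n) + b / 2 ^ n)).
{ intros n; rewrite A2, B2; specialize (A n); specialize (B n).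
  change (s (S n)) with (next (s n) (a / 2 ^ n) (b / 2 ^ n)); destruct (s n) as [x y]; unfold next.
  repeat destruct excluded_middle_informative; simpl; lra. }
assert (L : forall (f c : nat -> R), (forall n, 0 < c n) -> (forall n, f n <= f (S n) /\ f (S n) + c (S n) <= f n + c n) ->
   exists u, forall n, f n <= u <= f n + c n).
{ intros f c C M.
  assert (M1 : forall n k, f n <= f (n + k)%nat /\ f (n + k)%nat + c (n + k)%nat <= f n + c n).
  { induction k as [|k IH]; [rewrite Nat.add_0_r; lra|].
    rewrite Nat.add_succ_r; specialize (M (n + k)%nat); lra. }
  assert (M2 : forall n m, f m <= f n + c n).
  { intros n m; destruct (Nat.le_ge_cases n m) as [l|l].
    - replace m with (n + (m - n))%nat by lia; destruct (M1 n (m - n)%nat); specialize (C (n + (m - n))%nat); lra.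
    - replace n with (m + (n - m))%nat by lia; destruct (M1 m (n - m)%nat); specialize (C (m + (n - m))%nat); lra. }
  destruct (completeness (fun x => exists n, x = f n)) as [u [U1 U2]].
  - exists (f 0%nat + c 0%nat); intros x [n ->]; apply M2.
  - now exists (f 0%nat), 0%nat.
  - exists u; intros n; split; [apply U1; now exists n|].
    apply U2; intros x [m ->]; apply M2. }
destruct (L (fun n => fst (s n)) (fun n => a / 2 ^ n) A (fun n => proj1 (N n))) as [u Hu].
destruct (L (fun n => snd (s n)) (fun n => b / 2 ^ n) B (fun n => proj2 (N n))) as [v Hv].
exists u, v; intros n; exists (fst (s n)), (snd (s n)); auto.
Qed.

End Bisection.

Definition in_rect (x y a b : R) (z : C) : Prop := x <= Re z <= x + a /\ y <= Im z <= y + b.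

Lemma in_rect_dist x y a b z w : in_rect x y a b z -> in_rect x y a b w -> Cmod (z - w)%C <= a + b.
Proof.
intros [Z1 Z2] [W1 W2]; eapply Rle_trans; [apply Cmod_le_re_im|]; rewrite re_minus, im_minus.
apply Rplus_le_compat; apply Rabs_le; lra.
Qed.

Lemma in_rect_quarter x y a b z : in_rect x y a b z ->
  in_rect x y (a / 2) (b / 2) z \/ in_rect (x + a / 2) y (a / 2) (b / 2) z \/
  in_rect x (y + b / 2) (a / 2) (b / 2) z \/ in_rect (x + a / 2) (y + b / 2) (a / 2) (b / 2) z.
Proof.
unfold in_rect; intros H.
destruct (Rle_lt_dec (Re z) (x + a / 2)); destruct (Rle_lt_dec (Im z) (y + b / 2)).
- left; lra.
- right; right; left; lra.
- right; left; lra.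
- right; right; right; lra.
Qed.

Lemma Cmod_le_in_rect (M : R) (z : C) : Cmod z <= M -> in_rect (- M) (- M) (2 * M) (2 * M) z.
Proof.
intros H; generalize (re_le_Cmod z) (im_le_Cmod z); intros A B.
apply Rabs_le_between in A, B; unfold in_rect; lra.
Qed.

Lemma Cmod_le_closed (M : R) (q : C) :
  (forall eps, 0 < eps -> exists p, Cmod p <= M /\ Cmod (p - q)%C < eps) -> Cmod q <= M.
Proof.
intros H; apply Rnot_lt_le; intros L; destruct (H (Cmod q - M)) as [p [P1 P2]]; [lra|].
generalize (Cmod_triangle_inv q p); rewrite Cmod_minus_sym; lra.
Qed.

(** Compactness of the closed disk of radius [M], for the filter generated by
    the sets [B s].  Directedness is what makes a single quarter meet all of
    them. *)
Lemma filter_cluster_point (S : Type) (A : S -> Prop) (B : S -> C -> Prop) (M : R) : 0 < M ->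
  (forall s t, A s -> A t -> exists u, A u /\ forall w, B u w -> B s w /\ B t w) ->
  (forall s, A s -> exists w, Cmod w <= M /\ B s w) ->
  exists q, forall s eps, A s -> 0 < eps ->
    exists w, Cmod w <= M /\ Cmod (w - q)%C < eps /\ B s w.
Proof.
intros HM Dir H.
destruct (nested_quarters (fun x y a b => forall s, A s ->
   exists w, Cmod w <= M /\ in_rect x y a b w /\ B s w))
  with (x0 := - M) (y0 := - M) (a := 2 * M) (b := 2 * M) as [u [v K]]; try lra.
- intros x y a b Q; apply NNPP; intros N.
  apply not_or_and in N; destruct N as [N1 N]; apply not_or_and in N; destruct N as [N2 N].
  apply not_or_and in N; destruct N as [N3 N4].
  apply not_all_ex_not in N1, N2, N3, N4.
  destruct N1 as [s1 N1], N2 as [s2 N2], N3 as [s3 N3], N4 as [s4 N4].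
  apply imply_to_and in N1, N2, N3, N4.
  destruct N1 as [S1 N1], N2 as [S2 N2], N3 as [S3 N3], N4 as [S4 N4].
  destruct (Dir s1 s2 S1 S2) as [s5 [S5 B5]]; destruct (Dir s3 s4 S3 S4) as [s6 [S6 B6]].
  destruct (Dir s5 s6 S5 S6) as [s [Ss Bs]]; destruct (Q s Ss) as [w [W1 [W2 W3]]].
  destruct (Bs w W3) as [W5 W6]; destruct (B5 w W5), (B6 w W6).
  destruct (in_rect_quarter _ _ _ _ _ W2) as [R|[R|[R|R]]];
   [apply N1|apply N2|apply N3|apply N4]; now exists w.
- intros s Hs; destruct (H s Hs) as [w [W1 W2]]; exists w; split; [easy|split; [now apply Cmod_le_in_rect|easy]].
- exists (u, v); intros s eps Hs He; destruct (pow2_small (4 * M) eps He) as [n Hn].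
  destruct (K n) as [x [y [K1 K2]]]; destruct (K1 s Hs) as [w [W1 [W2 W3]]].
  exists w; split; [easy|split; [|easy]].
  eapply Rle_lt_trans; [apply (in_rect_dist _ _ _ _ _ (u, v) W2 K2)|].
  replace (2 * M / 2 ^ n + 2 * M / 2 ^ n) with (4 * M / 2 ^ n) by (field; apply pow_nonzero; lra); easy.
Qed.

Lemma cluster_point (S : R -> C -> Prop) (M : R) : 0 < M ->
  (forall t0, 0 < t0 -> exists t p, 0 < t < t0 /\ Cmod p <= M /\ S t p) ->
  exists q, Cmod q <= M /\ forall eps t0, 0 < eps -> 0 < t0 ->
    exists t p, 0 < t < t0 /\ Cmod p <= M /\ Cmod (p - q)%C < eps /\ S t p.
Proof.
intros HM H.
destruct (filter_cluster_point R (fun t0 => 0 < t0) (fun t0 p => exists t, 0 < t < t0 /\ S t p) M HM) as [q Q].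
- intros s t Hs Ht; exists (Rmin s t); split; [now apply Rmin_pos|]; intros w [x [Hx Sx]].
  generalize (Rmin_l s t) (Rmin_r s t); intros; split; exists x; split; try easy; lra.
- intros t0 Ht0; destruct (H t0 Ht0) as [t [p [T1 [T2 T3]]]]; exists p; split; [easy|now exists t].
- exists q; split.
  + apply Cmod_le_closed; intros eps He; destruct (Q 1 eps Rlt_0_1 He) as [p [P1 [P2 _]]]; now exists p.
  + intros eps t0 He Ht0; destruct (Q t0 eps Ht0 He) as [p [P1 [P2 [t [T1 T2]]]]]; now exists t, p.
Qed.

Definition cclosed (K : C -> Prop) : Prop :=
  forall q, (forall eps, 0 < eps -> exists p, K p /\ Cmod (p - q)%C < eps) -> K q.

Lemma compact_max (K : C -> Prop) (M : R) (k0 : C) (f : C -> R) : 0 < M ->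
  K k0 -> (forall z, K z -> Cmod z <= M) -> cclosed K ->
  (forall z, K z -> forall eps, 0 < eps -> exists d, 0 < d /\
     forall w, Cmod (w - z)%C < d -> Rabs (f w - f z) < eps) ->
  exists m, K m /\ forall z, K z -> f z <= f m.
Proof.
intros HM K0 KM KC F.
destruct (filter_cluster_point C K (fun z w => K w /\ f z <= f w) M HM) as [m Q].
- intros s t Hs Ht; destruct (Rle_lt_dec (f s) (f t)); [exists t|exists s];
   (split; [easy|]; intros w [W1 W2]; repeat split; try easy; lra).
- intros s Hs; exists s; repeat split; auto; lra.
- assert (Hm : K m).
  { apply KC; intros eps He; destruct (Q k0 eps K0 He) as [w [_ [W1 [W2 _]]]]; now exists w. }
  exists m; split; [easy|]; intros z Hz.
  apply Rnot_lt_le; intros L; destruct (F m Hm (f z - f m)) as [d [Hd D]]; [lra|].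
  destruct (Q z d Hz Hd) as [w [_ [W1 [_ W2]]]]; generalize (D w W1); intros G; apply Rabs_def2 in G; lra.
Qed.

Lemma cclosed_disk (c : C) (r : R) : cclosed (fun z => Cmod (z - c)%C <= r).
Proof.
intros q H; apply Cmod_le_closed; intros eps He; destruct (H eps He) as [p [P1 P2]].
exists (p - c)%C; split; [easy|]; replace (p - c - (q - c))%C with (p - q)%C by ring; easy.
Qed.

Lemma cclosed_circle (c : C) (r : R) : cclosed (fun z => Cmod (z - c)%C = r).
Proof.
intros q H; apply Rle_antisym.
- apply cclosed_disk; intros eps He; destruct (H eps He) as [p [P1 P2]]; exists p; split; [lra|easy].
- apply Rnot_lt_le; intros L; destruct (H (r - Cmod (q - c)%C)) as [p [P1 P2]]; [lra|].
  generalize (Cmod_triangle_3 p q c); lra.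
Qed.

Lemma Cmod_le_of_disk (c z : C) (r : R) : Cmod (z - c)%C <= r -> Cmod z <= r + Cmod c.
Proof. intros H; generalize (Cmod_triangle_inv z c); lra. Qed.

Lemma disk_max (f : C -> R) (c : C) (r : R) : 0 < r ->
  (forall z, Cmod (z - c)%C <= r -> forall eps, 0 < eps -> exists d, 0 < d /\
     forall w, Cmod (w - z)%C < d -> Rabs (f w - f z) < eps) ->
  exists m, Cmod (m - c)%C <= r /\ forall z, Cmod (z - c)%C <= r -> f z <= f m.
Proof.
intros Hr F.
apply (compact_max _ (r + Cmod c) c); auto using cclosed_disk, Cmod_le_of_disk.
- generalize (Cmod_ge_0 c); lra.
- rewrite Cmod_diag; lra.
Qed.

Lemma Cmod_continuous (f : C -> C) (z : C) : ccont f z -> forall eps, 0 < eps ->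
  exists d, 0 < d /\ forall w, Cmod (w - z)%C < d -> Rabs (Cmod (f w) - Cmod (f z)) < eps.
Proof.
intros F eps He; destruct (F eps He) as [d [Hd D]]; exists d; split; [easy|]; intros w Hw.
generalize (Cmod_triangle_inv (f w) (f z)) (Cmod_triangle_inv (f z) (f w)) (D w Hw).
rewrite (Cmod_minus_sym (f z)); intros; apply Rabs_def1; lra.
Qed.

Lemma circle_lower_bound (f : C -> C) (c : C) (r : R) : 0 < r ->
  (forall z, Cmod (z - c)%C = r -> ccont f z) -> (forall z, Cmod (z - c)%C = r -> f z <> 0%C) ->
  exists m, 0 < m /\ forall z, Cmod (z - c)%C = r -> m <= Cmod (f z).
Proof.
intros Hr F N.
destruct (compact_max (fun z => Cmod (z - c)%C = r) (r + Cmod c) (c + RtoC r)%C (fun z => - Cmod (f z))) as [m [M1 M2]].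
- generalize (Cmod_ge_0 c); lra.
- replace (c + RtoC r - c)%C with (RtoC r) by ring; rewrite Cmod_R, Rabs_pos_eq; lra.
- intros z Hz; apply Cmod_le_of_disk; lra.
- apply cclosed_circle.
- intros z Hz eps He; destruct (Cmod_continuous f z (F z Hz) eps He) as [d [Hd D]].
  exists d; split; [easy|]; intros w Hw; rewrite <- Rabs_Ropp.
  replace (- (- Cmod (f w) - - Cmod (f z))) with (Cmod (f w) - Cmod (f z)) by ring; auto.
- exists (Cmod (f m)); split; [now apply Cmod_gt_0, N|]; intros z Hz; generalize (M2 z Hz); lra.
Qed.

(** * Goursat's theorem and the maximum principle *)

Lemma curve_cont_horizontal (y x : R) : curve_cont (fun s => (s, y) : C) x.
Proof.
intros eps He; exists eps; split; [easy|]; intros s Hs.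
eapply Rle_lt_trans; [apply Cmod_le_re_im|]; rewrite re_minus, im_minus; simpl.
rewrite Rminus_diag, Rabs_R0; lra.
Qed.

Lemma curve_cont_vertical (x y : R) : curve_cont (fun s => (x, s) : C) y.
Proof.
intros eps He; exists eps; split; [easy|]; intros s Hs.
eapply Rle_lt_trans; [apply Cmod_le_re_im|]; rewrite re_minus, im_minus; simpl.
rewrite Rminus_diag, Rabs_R0; lra.
Qed.

Lemma RInt_close (f : R -> R) (a b k e : R) : a <= b -> ex_RInt f a b ->
  (forall x, a <= x <= b -> Rabs (f x - k) <= e) -> Rabs (RInt f a b - k * (b - a)) <= e * (b - a).
Proof.
intros L I H.
assert (A := RInt_le (fun _ => k - e) f a b L (ex_RInt_const _ _ _) I).
assert (B := RInt_le f (fun _ => k + e) a b L I (ex_RInt_const _ _ _)).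
rewrite RInt_const in A, B; unfold scal in A, B; simpl in A, B; unfold mult in A, B; simpl in A, B.
apply Rabs_le.
assert (A' := A ltac:(intros x Hx; specialize (H x ltac:(lra)); apply Rabs_le_between in H; lra)).
assert (B' := B ltac:(intros x Hx; specialize (H x ltac:(lra)); apply Rabs_le_between in H; lra)).
lra.
Qed.

Section Goursat.

Variable F : C -> C.

(** The imaginary part of the contour integral of [F] is enough: its vertical
    sides compare integrals of the real part of [F], which are circular means
    once [F z = g (a + exp z)]. *)
Definition bd_int (x y a b : R) : R :=
  RInt (fun s => Im (F (s, y)) - Im (F (s, y + b))) x (x + a) +
  RInt (fun t => Re (F (x + a, t)) - Re (F (x, t))) y (y + b).

Variables x0 y0 A B : R.
Hypothesis HA : 0 < A.
Hypothesis HB : 0 < B.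
Hypothesis F_hol : forall z, in_rect x0 y0 A B z -> hol_at F z.

Lemma rect_ccont z : in_rect x0 y0 A B z -> ccont F z.
Proof. intros H; now apply hol_ccont, F_hol. Qed.

Definition sub_rect (x y a b : R) := 0 < a /\ 0 < b /\ x0 <= x /\ x + a <= x0 + A /\ y0 <= y /\ y + b <= y0 + B.

Lemma ex_im_horizontal x y a : x0 <= x -> 0 <= a -> x + a <= x0 + A -> y0 <= y <= y0 + B ->
  ex_RInt (fun s => Im (F (s, y))) x (x + a).
Proof.
intros; apply (ex_RInt_continuous (V := R_CompleteNormedModule)); intros s; rewrite Rmin_left, Rmax_right by lra; intros Hs.
apply (curve_cont_im (fun s => F (s, y))), (curve_cont_comp (fun s => (s, y)) F); [apply curve_cont_horizontal|].
apply rect_ccont; split; simpl; lra.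
Qed.

Lemma ex_re_vertical x y b : y0 <= y -> 0 <= b -> y + b <= y0 + B -> x0 <= x <= x0 + A ->
  ex_RInt (fun s => Re (F (x, s))) y (y + b).
Proof.
intros; apply (ex_RInt_continuous (V := R_CompleteNormedModule)); intros s; rewrite Rmin_left, Rmax_right by lra; intros Hs.
apply (curve_cont_re (fun s => F (x, s))), (curve_cont_comp (fun s => (x, s)) F); [apply curve_cont_vertical|].
apply rect_ccont; split; simpl; lra.
Qed.

Lemma bd_int_split x y a b : sub_rect x y a b ->
  bd_int x y a b = RInt (fun s => Im (F (s, y))) x (x + a) - RInt (fun s => Im (F (s, y + b))) x (x + a)
   + (RInt (fun t => Re (F (x + a, t))) y (y + b) - RInt (fun t => Re (F (x, t))) y (y + b)).
Proof.
intros [H1 [H2 [H3 [H4 [H5 H6]]]]]; unfold bd_int; f_equal.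
- apply (RInt_minus (V := R_CompleteNormedModule)); apply ex_im_horizontal; lra.
- apply (RInt_minus (V := R_CompleteNormedModule)); apply ex_re_vertical; lra.
Qed.

Lemma RInt_halves f x a : ex_RInt f x (x + a / 2) -> ex_RInt f (x + a / 2) (x + a / 2 + a / 2) ->
  RInt f x (x + a) = RInt f x (x + a / 2) + RInt f (x + a / 2) (x + a / 2 + a / 2).
Proof.
intros; replace (x + a) with (x + a / 2 + a / 2) by field.
symmetry; now apply (RInt_Chasles (V := R_CompleteNormedModule)).
Qed.

Lemma bd_int_quarters x y a b : sub_rect x y a b ->
  bd_int x y a b = bd_int x y (a / 2) (b / 2) + bd_int (x + a / 2) y (a / 2) (b / 2)
   + bd_int x (y + b / 2) (a / 2) (b / 2) + bd_int (x + a / 2) (y + b / 2) (a / 2) (b / 2).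
Proof.
intros H; assert (H' := H); destruct H' as [H1 [H2 [H3 [H4 [H5 H6]]]]].
rewrite !bd_int_split; try easy; try (unfold sub_rect; lra).
assert (Q1 := RInt_halves (fun s => Im (F (s, y))) x a ltac:(apply ex_im_horizontal; lra) ltac:(apply ex_im_horizontal; lra)).
assert (Q2 := RInt_halves (fun s => Im (F (s, y + b))) x a ltac:(apply ex_im_horizontal; lra) ltac:(apply ex_im_horizontal; lra)).
assert (Q3 := RInt_halves (fun t => Re (F (x, t))) y b ltac:(apply ex_re_vertical; lra) ltac:(apply ex_re_vertical; lra)).
assert (Q4 := RInt_halves (fun t => Re (F (x + a, t))) y b ltac:(apply ex_re_vertical; lra) ltac:(apply ex_re_vertical; lra)).
rewrite Q1, Q2, Q3, Q4.
replace (x + a / 2 + a / 2) with (x + a) by field.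
replace (y + b / 2 + b / 2) with (y + b) by field.
ring.
Qed.

(** The affine part of [F] contributes [- a b Re l] on the horizontal sides
    and [a b Re l] on the vertical ones. *)
Lemma bd_int_near x y a b (w l : C) (e : R) : sub_rect x y a b -> 0 <= e ->
  (forall z, in_rect x y a b z -> Cmod (F z - F w - l * (z - w))%C <= e) ->
  Rabs (bd_int x y a b) <= 2 * e * (a + b).
Proof.
intros [H1 [H2 [H3 [H4 [H5 H6]]]]] He H.
assert (D : forall z z', in_rect x y a b z -> in_rect x y a b z' -> Cmod ((F z - F z') - l * (z - z'))%C <= 2 * e).
{ intros z z' Hz Hz'.
  replace ((F z - F z') - l * (z - z'))%C with ((F z - F w - l * (z - w)) - (F z' - F w - l * (z' - w)))%C by ring.
  eapply Rle_trans; [apply Cmod_triangle|]; rewrite Cmod_opp; generalize (H z Hz) (H z' Hz'); lra. }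
assert (I1 := RInt_close (fun s => Im (F (s, y)) - Im (F (s, y + b))) x (x + a) (- b * Re l) (2 * e) ltac:(lra)).
assert (I2 := RInt_close (fun t => Re (F (x + a, t)) - Re (F (x, t))) y (y + b) (a * Re l) (2 * e) ltac:(lra)).
assert (I1' := I1 ltac:(apply (ex_RInt_minus (V := R_NormedModule)); apply ex_im_horizontal; lra)).
assert (I2' := I2 ltac:(apply (ex_RInt_minus (V := R_NormedModule)); apply ex_re_vertical; lra)).
clear I1 I2.
assert (I1 : Rabs (RInt (fun s => Im (F (s, y)) - Im (F (s, y + b))) x (x + a) - - b * Re l * (x + a - x)) <= 2 * e * (x + a - x)).
{ apply I1'; intros s Hs.
  eapply Rle_trans; [|apply (D (s, y) (s, y + b)); split; simpl; lra].
  eapply Rle_trans; [|apply im_le_Cmod]; right; f_equal.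
  rewrite !im_minus, im_mult; simpl; ring. }
assert (I2 : Rabs (RInt (fun t => Re (F (x + a, t)) - Re (F (x, t))) y (y + b) - a * Re l * (y + b - y)) <= 2 * e * (y + b - y)).
{ apply I2'; intros s Hs.
  eapply Rle_trans; [|apply (D (x + a, s) (x, s)); split; simpl; lra].
  eapply Rle_trans; [|apply re_le_Cmod]; right; f_equal.
  rewrite !re_minus, re_mult; simpl; ring. }
unfold bd_int; apply Rabs_le; apply Rabs_le_between in I1, I2; nra.
Qed.

(** Relative to area, some quarter has an integral at least as large as the
    whole rectangle; near the point where such quarters accumulate,
    differentiability makes this ratio arbitrarily small. *)
Lemma goursat : bd_int x0 y0 A B = 0.
Proof.
apply NNPP; intros N.
assert (P : 0 < Rabs (bd_int x0 y0 A B)) by now apply Rabs_pos_lt.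
set (k := Rabs (bd_int x0 y0 A B) / (A * B)).
assert (AB : 0 < A * B) by nra.
assert (K : 0 < k) by now apply Rdiv_lt_0_compat.
destruct (nested_quarters (fun x y a b => sub_rect x y a b /\ k * (a * b) <= Rabs (bd_int x y a b))) with (x0 := x0) (y0 := y0) (a := A) (b := B) as [u [v Q]]; try easy.
- intros x y a b [S L].
  assert (S1 : sub_rect x y (a / 2) (b / 2)) by (unfold sub_rect in *; lra).
  assert (S2 : sub_rect (x + a / 2) y (a / 2) (b / 2)) by (unfold sub_rect in *; lra).
  assert (S3 : sub_rect x (y + b / 2) (a / 2) (b / 2)) by (unfold sub_rect in *; lra).
  assert (S4 : sub_rect (x + a / 2) (y + b / 2) (a / 2) (b / 2)) by (unfold sub_rect in *; lra).
  rewrite (bd_int_quarters x y a b S) in L.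
  replace (k * (a / 2 * (b / 2))) with (k * (a * b) / 4) by field.
  destruct (Rle_lt_dec (k * (a * b) / 4) (Rabs (bd_int x y (a / 2) (b / 2)))); [auto|].
  destruct (Rle_lt_dec (k * (a * b) / 4) (Rabs (bd_int (x + a / 2) y (a / 2) (b / 2)))); [auto|].
  destruct (Rle_lt_dec (k * (a * b) / 4) (Rabs (bd_int x (y + b / 2) (a / 2) (b / 2)))); [auto|].
  destruct (Rle_lt_dec (k * (a * b) / 4) (Rabs (bd_int (x + a / 2) (y + b / 2) (a / 2) (b / 2)))); [auto|].
  exfalso; apply Rabs_def2 in r, r0, r1, r2.
  apply Rle_not_lt in L; apply L, Rabs_def1; lra.
- split; [unfold sub_rect; lra|]; right; unfold k; field; lra.
- assert (Hw : in_rect x0 y0 A B (u, v)).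
  { destruct (Q 0%nat) as [x [y [[S _] [Q1 Q2]]]]; unfold sub_rect in S; simpl in *.
    rewrite Rdiv_1_r in *; split; simpl; lra. }
  destruct (F_hol _ Hw) as [l D].
  set (e := k * (A * B) / (4 * ((A + B) * (A + B)))).
  assert (E : 0 < e) by (apply Rdiv_lt_0_compat; nra).
  destruct (D e E) as [d [Hd D']].
  destruct (pow2_small (A + B) d Hd) as [n Hn].
  destruct (Q n) as [x [y [[S L] Q12]]].
  assert (W : 0 < 2 ^ n) by (apply pow_lt; lra).
  assert (N1 : forall z, in_rect x y (A / 2 ^ n) (B / 2 ^ n) z -> Cmod (z - (u, v))%C <= (A + B) / 2 ^ n).
  { intros z Hz; eapply Rle_trans; [apply (in_rect_dist _ _ _ _ _ (u, v) Hz Q12)|]; right; field; lra. }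
  assert (C := bd_int_near x y _ _ (u, v) l (e * ((A + B) / 2 ^ n)) S).
  assert (T : 0 < (A + B) / 2 ^ n) by (apply Rdiv_lt_0_compat; lra).
  assert (C' := C ltac:(nra)).
  assert (G : Rabs (bd_int x y (A / 2 ^ n) (B / 2 ^ n)) <= 2 * (e * ((A + B) / 2 ^ n)) * (A / 2 ^ n + B / 2 ^ n)).
  { apply C'; intros z Hz; specialize (N1 z Hz); eapply Rle_trans; [apply D'; lra|].
    apply Rmult_le_compat_l; lra. }
  replace (2 * (e * ((A + B) / 2 ^ n)) * (A / 2 ^ n + B / 2 ^ n)) with (k * (A / 2 ^ n * (B / 2 ^ n)) / 2) in G
    by (unfold e; field; lra).
  assert (0 < A / 2 ^ n) by (apply Rdiv_lt_0_compat; lra).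
  assert (0 < B / 2 ^ n) by (apply Rdiv_lt_0_compat; lra).
  assert (0 < k * (A / 2 ^ n * (B / 2 ^ n))) by (apply Rmult_lt_0_compat; nra).
  lra.
Qed.

End Goursat.

Lemma cexp_2PI (s : R) : cexp (s, 2 * PI) = cexp (s, 0).
Proof.
unfold cexp, cis; simpl; now rewrite cos_2PI, sin_2PI, cos_0, sin_0.
Qed.

Lemma cexp_polar (s t : R) : cexp (s, t) = (RtoC (exp s) * cis t)%C.
Proof. reflexivity. Qed.

(** In the coordinate [log (z - a)] the circles about [a] become vertical
    segments of length [2 PI] and the horizontal sides cancel by periodicity, so
    the mean of [Re g] does not depend on the radius.  Small radii give
    [Re g a] by continuity alone, which is why the centre may be an exceptional
    point. *)
Lemma mean_value_le (g : C -> C) (a : C) (R s m : R) : 0 < s < R ->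
  ccont g a -> (forall z, Cmod (z - a)%C < R -> z <> a -> hol_at g z) ->
  (forall t, Re (g (a + RtoC s * cis t)%C) <= m) -> Re (g a) <= m.
Proof.
intros [Hs HR] Ca Hg Hm.
apply Rnot_lt_le; intros L.
destruct (Ca (Re (g a) - m)) as [d [Hd K]]; [lra|].
set (F := fun z => g (a + cexp z)%C).
set (b := ln s).
(* [c] is so far to the left that [|g - g a| < Re (g a) - m] on the circle of radius [exp c]. *)
set (c := Rmin (ln (d / 2)) (b - 1)).
assert (Hc : c < b) by (generalize (Rmin_r (ln (d / 2)) (b - 1)); unfold c; lra).
assert (Ec : exp c < d).
{ apply Rle_lt_trans with (exp (ln (d / 2))); [|rewrite exp_ln; lra].
  destruct (Rmin_l (ln (d / 2)) (b - 1)) as [l|e]; [left; now apply exp_increasing|right; unfold c; now rewrite e]. }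
assert (PP := PI_RGT_0).
assert (F_hol : forall z, in_rect c 0 (b - c) (2 * PI) z -> hol_at F z).
{ intros z [Z _]; apply (hol_comp (fun z => a + cexp z)%C g).
  - apply hol_plus; [apply hol_const|eexists; apply cexp_cdiff].
  - assert (E : (a + cexp z - a)%C = cexp z) by ring.
    apply Hg.
    + rewrite E, Cmod_cexp; apply Rle_lt_trans with s; [|easy].
      rewrite <- (exp_ln s) by easy; fold b.
      assert (Rz : Re z <= b) by lra.
      destruct Rz as [l|e]; [left; now apply exp_increasing|right; now rewrite e].
    + intros E'; apply (cexp_neq_0 z); rewrite <- E, E'; ring. }
assert (G := goursat F c 0 (b - c) (2 * PI) ltac:(lra) ltac:(lra) F_hol).
rewrite (bd_int_split F c 0 (b - c) (2 * PI) F_hol) in G by (unfold sub_rect; lra).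
replace (c + (b - c)) with b in * by ring; rewrite Rplus_0_l in *.
rewrite (RInt_ext (fun s => Im (F (s, 2 * PI))) (fun s => Im (F (s, 0)))) in G
 by (intros; unfold F; now rewrite cexp_2PI).
assert (I1 := RInt_le (fun t => Re (F (b, t))) (fun _ => m) 0 (2 * PI) ltac:(lra)).
rewrite RInt_const in I1; unfold scal in I1; simpl in I1; unfold mult in I1; simpl in I1.
assert (X : forall x, c <= x <= b -> ex_RInt (fun t => Re (F (x, t))) 0 (2 * PI)).
{ intros x Hx.
  assert (X := ex_re_vertical F c 0 (b - c) (2 * PI) F_hol x 0 (2 * PI) ltac:(lra) ltac:(lra) ltac:(lra) ltac:(lra)).
  now rewrite Rplus_0_l in X. }
assert (I1' := I1 (X b ltac:(lra)) (ex_RInt_const _ _ _)); clear I1.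
assert (I1 : RInt (fun t => Re (F (b, t))) 0 (2 * PI) <= (2 * PI - 0) * m).
{ apply I1'; intros t _; unfold F; rewrite cexp_polar; unfold b; rewrite exp_ln by easy; apply Hm. }
assert (I2 : RInt (fun _ => m) 0 (2 * PI) < RInt (fun t => Re (F (c, t))) 0 (2 * PI)).
{ apply RInt_lt; [lra| | |].
  - intros t Ht. apply (curve_cont_re (fun t => F (c, t))), (curve_cont_comp (fun s => (c, s)) F); [apply curve_cont_vertical|].
    apply hol_ccont, F_hol; split; simpl; lra.
  - intros; apply continuous_const.
  - intros t Ht; unfold F.
    assert (Q := K (a + cexp (c, t))%C).
    replace (a + cexp (c, t) - a)%C with (cexp (c, t)) in Q by ring.
    rewrite Cmod_cexp in Q; specialize (Q Ec).
    generalize (re_le_Cmod (g (a + cexp (c, t)) - g a)%C); rewrite re_minus; intros Q'.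
    apply Rabs_le_between in Q'; lra. }
rewrite RInt_const in I2; unfold scal in I2; simpl in I2; unfold mult in I2; simpl in I2.
lra.
Qed.

Lemma exists_phase (z : C) : exists c : C, Cmod c = 1 /\ (c * z)%C = RtoC (Cmod z).
Proof.
destruct (Ceq_dec z 0%C) as [->|N].
- exists 1%C; split; [apply Cmod_1|]; rewrite Cmod_0; ring.
- assert (P : 0 < Cmod z) by now apply Cmod_gt_0.
  assert (M : RtoC (Cmod z) <> 0%C) by (intros E; apply RtoC_inj in E; lra).
  exists (RtoC (Cmod z) / z)%C; split.
  + rewrite Cmod_div, Cmod_R, Rabs_pos_eq by (easy || lra); field; lra.
  + field; easy.
Qed.

Lemma Cmod_sqr_plus_eps (w : C) (s t : R) :
  Cmod (w + RtoC s * cis t)%C * Cmod (w + RtoC s * cis t)%C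
   = Cmod w * Cmod w + 2 * Re (Cconj w * (RtoC s * cis t))%C + s * s.
Proof.
assert (E := Cmod_cis t); assert (E2 := Cmod_sqr (cis t)); rewrite E in E2.
rewrite !Cmod_sqr, !re_plus, !im_plus, !re_mult, !im_mult, re_conj, im_conj, re_RtoC, im_RtoC.
replace (s * s) with (s * s * (Re (cis t) * Re (cis t) + Im (cis t) * Im (cis t))) by (rewrite <- E2; ring); ring.
Qed.

(** Adding [e |z - c|^2] makes [|f|] strictly subharmonic; an interior maximum
    then contradicts the mean value inequality, even at the exceptional
    point [p]. *)
Lemma max_principle (f : C -> C) (c p : C) (r M : R) : 0 < r ->
  (forall z, Cmod (z - c)%C <= r -> ccont f z) ->
  (forall z, Cmod (z - c)%C < r -> z <> p -> hol_at f z) ->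
  (forall z, Cmod (z - c)%C = r -> Cmod (f z) <= M) ->
  forall z, Cmod (z - c)%C <= r -> Cmod (f z) <= M.
Proof.
intros Hr Fc Fh Fb z0 Hz0.
apply Rnot_lt_le; intros L.
set (e := (Cmod (f z0) - M) / (2 * (r * r))).
assert (E : 0 < e) by (apply Rdiv_lt_0_compat; nra).
assert (E' : e * (r * r) = (Cmod (f z0) - M) / 2) by (unfold e; field; lra).
set (V := fun z => Cmod (f z) + e * (Cmod (z - c)%C * Cmod (z - c)%C)).
destruct (disk_max V c r Hr) as [m [Hm Vm]].
{ intros z Hz eps He.
  assert (Cz := Fc z Hz).
  assert (Cq : ccont (fun w => (w - c) * (w - c))%C z).
  { apply ccont_mult; apply ccont_minus; try apply ccont_id; apply ccont_const. }
  destruct (Cz (eps / 2)) as [d [Hd K]]; [lra|].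
  destruct (Cq (eps / (2 * e))) as [d' [Hd' K']]; [apply Rdiv_lt_0_compat; lra|].
  exists (Rmin d d'); split; [now apply Rmin_pos|]; intros w Hw.
  assert (K1 := K w ltac:(generalize (Rmin_l d d'); lra)).
  assert (K2 := K' w ltac:(generalize (Rmin_r d d'); lra)); cbv beta in K2.
  unfold V; rewrite <- !Cmod_mult.
  assert (A1 := Cmod_triangle_inv (f w) (f z)); assert (A2 := Cmod_triangle_inv (f z) (f w)).
  assert (B1 := Cmod_triangle_inv ((w - c) * (w - c))%C ((z - c) * (z - c))%C).
  assert (B2 := Cmod_triangle_inv ((z - c) * (z - c))%C ((w - c) * (w - c))%C).
  rewrite Cmod_minus_sym in A2, B2.
  set (p1 := Cmod ((w - c) * (w - c))%C) in *; set (p2 := Cmod ((z - c) * (z - c))%C) in *.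
  set (p3 := Cmod ((w - c) * (w - c) - (z - c) * (z - c))%C) in *.
  apply Rlt_div_r in K2; [|lra].
  apply Rabs_def1; nra. }
destruct Hm as [Hm|Hm].
- assert (S : exists s, 0 < s /\ Cmod (m - c)%C + 2 * s < r /\ forall z, Cmod (z - m)%C < 2 * s -> z <> m -> hol_at f z).
  { set (s1 := (r - Cmod (m - c)%C) / 4); assert (S1 : 0 < s1) by (unfold s1; lra).
    assert (S2 : Cmod (m - c)%C + 2 * s1 < r) by (unfold s1; lra).
    assert (S3 : forall z, Cmod (z - m)%C < 2 * s1 -> Cmod (z - c)%C < r).
    { intros z Hz; generalize (Cmod_triangle_3 z m c); lra. }
    destruct (Ceq_dec m p) as [->|N].
    - exists s1; split; [easy|split; [easy|]]; intros z Hz Nz; apply Fh; auto.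
    - assert (Q : 0 < Cmod (p - m)%C) by (apply Cmod_gt_0, Cminus_neq_0; auto).
      exists (Rmin s1 (Cmod (p - m)%C / 2)).
      assert (M1 := Rmin_l s1 (Cmod (p - m)%C / 2)); assert (M2 := Rmin_r s1 (Cmod (p - m)%C / 2)).
      split; [apply Rmin_pos; lra|split; [lra|]]; intros z Hz Nz; apply Fh; [apply S3; lra|].
      intros ->; lra. }
  destruct S as [s [S1 [S2 S3]]].
  destruct (exists_phase (f m)) as [k [Hk1 Hk2]].
  (* On the circle of radius [s] about [m], [Re g] equals
     [Re (k f) + e (|z - c|^2 - |m - c|^2 - s^2)], hence it is at most
     [|f m| - e s^2], while [g m = |f m|]. *)
  set (g := fun z => (k * f z + RtoC (2 * e) * Cconj (m - c) * (z - m))%C).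
  assert (G := mean_value_le g m (2 * s) s (Cmod (f m) - e * (s * s)) ltac:(lra)).
  assert (Gm : Re (g m) = Cmod (f m)).
  { unfold g; rewrite Hk2; replace (RtoC (Cmod (f m)) + RtoC (2 * e) * Cconj (m - c) * (m - m))%C with (RtoC (Cmod (f m))) by ring; apply re_RtoC. }
  rewrite Gm in G.
  assert (G' : Cmod (f m) <= Cmod (f m) - e * (s * s)).
  { apply G.
    - apply ccont_plus.
      + apply ccont_mult; [apply ccont_const|apply Fc; lra].
      + apply ccont_mult; [apply ccont_const|apply ccont_minus; [apply ccont_id|apply ccont_const]].
    - intros z Hz Nz; apply hol_plus.
      + apply hol_mult; [apply hol_const|auto].
      + apply hol_mult; [apply hol_const|apply hol_minus; [apply hol_id|apply hol_const]].
    - intros t; unfold g.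
      replace (m + RtoC s * cis t - m)%C with (RtoC s * cis t)%C by ring.
      rewrite re_plus, <- Cmult_assoc, re_scal_l.
      assert (W := Vm (m + RtoC s * cis t)%C); unfold V in W.
      assert (D : Cmod (RtoC s * cis t) = s) by (rewrite Cmod_mult, Cmod_R, Cmod_cis, Rabs_pos_eq; lra).
      replace (m + RtoC s * cis t - c)%C with ((m - c) + RtoC s * cis t)%C in W by ring.
      specialize (W ltac:(eapply Rle_trans; [apply Cmod_triangle|]; lra)).
      rewrite Cmod_sqr_plus_eps in W.
      assert (T := re_le_Cmod (k * f (m + RtoC s * cis t))%C); rewrite Cmod_mult, Hk1 in T.
      apply Rabs_le_between in T.
      lra. }
  assert (0 < e * (s * s)) by (apply Rmult_lt_0_compat; nra); lra.
- assert (W := Vm z0 Hz0); unfold V in W; rewrite Hm in W; assert (B := Fb m Hm).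
  assert (0 <= Cmod (z0 - c)%C * Cmod (z0 - c)%C) by (generalize (Cmod_ge_0 (z0 - c)%C); nra).
  nra.
Qed.

(** * Injective holomorphic functions *)

Lemma Cinv_neq_0 (z : C) : z <> 0%C -> (/ z)%C <> 0%C.
Proof. intros N; apply Cmod_gt_0; rewrite Cmod_inv by easy; apply Rinv_0_lt_compat; now apply Cmod_gt_0. Qed.

Lemma min_principle (f : C -> C) (c p : C) (r m : R) : 0 < r -> 0 < m ->
  (forall z, Cmod (z - c)%C <= r -> ccont f z) ->
  (forall z, Cmod (z - c)%C < r -> z <> p -> hol_at f z) ->
  (forall z, Cmod (z - c)%C <= r -> f z <> 0%C) ->
  (forall z, Cmod (z - c)%C = r -> m <= Cmod (f z)) ->
  forall z, Cmod (z - c)%C <= r -> m <= Cmod (f z).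
Proof.
intros Hr Hm Fc Fh Fn Fb z Hz.
assert (P : 0 < Cmod (f z)) by (apply Cmod_gt_0; auto).
assert (H : Cmod (/ f z)%C <= / m).
{ apply (max_principle (fun z => / f z)%C c p r); auto.
  - intros w Hw; apply ccont_inv; auto.
  - intros w Hw Nw; apply hol_inv; [auto|apply Fn; lra].
  - intros w Hw; rewrite Cmod_inv by (apply Fn; lra); apply Rinv_le_contravar; auto. }
rewrite Cmod_inv in H by auto.
apply Rinv_le_contravar in H; [|now apply Rinv_0_lt_compat].
now rewrite !Rinv_inv in H.
Qed.

(** An omitted value [w] would contradict the minimum principle for [f - w]. *)
Lemma value_attained (f : C -> C) (c w : C) (r m : R) : 0 < r ->
  (forall z, Cmod (z - c)%C <= r -> hol_at f z) ->
  (forall z, Cmod (z - c)%C = r -> m <= Cmod (f z - w)%C) ->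
  Cmod (f c - w)%C < m -> exists z, Cmod (z - c)%C <= r /\ f z = w.
Proof.
intros Hr Fh Fb L; apply NNPP; intros N.
assert (H : m <= Cmod (f c - w)%C).
{ apply (min_principle (fun z => f z - w)%C c c r m); auto.
  - generalize (Cmod_ge_0 (f c - w)%C); lra.
  - intros z Hz; apply ccont_minus; [now apply hol_ccont, Fh|apply ccont_const].
  - intros z Hz _; apply hol_minus; [apply Fh; lra|apply hol_const].
  - intros z Hz; apply Cminus_neq_0; intros E; apply N; now exists z.
  - rewrite Cmod_diag; lra. }
lra.
Qed.

Lemma cdiff_inverse (f g : C -> C) (b l : C) (r : R) : 0 < r ->
  (forall w, Cmod (w - b)%C < r -> f (g w) = w) -> ccont g b ->
  cdiff f (g b) l -> l <> 0%C -> cdiff g b (/ l)%C.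
Proof.
intros Hr FG Cg D N.
set (q := fun w => dquot f (g b) l (g w)).
assert (Cq : ccont q b) by (apply (ccont_comp g (dquot f (g b) l)); [easy|now apply ccont_dquot]).
assert (Qb : q b = l) by apply dquot_at.
assert (P : 0 < Cmod l) by now apply Cmod_gt_0.
destruct (Cq (Cmod l) P) as [d [Hd K]].
assert (Hrd : 0 < Rmin r d) by now apply Rmin_pos.
eapply cdiff_eq; [|now rewrite <- Qb].
eapply (cdiff_ext_loc (fun w => g b + / q w * (w - b))%C g b _ (Rmin r d) Hrd).
- intros w Hw; generalize (Rmin_l r d) (Rmin_r r d); intros.
  assert (Nq : q w <> 0%C).
  { intros E; specialize (K w ltac:(lra)); rewrite E, Qb in K.
    replace (0 - l)%C with (- l)%C in K by ring; rewrite Cmod_opp in K; lra. }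
  assert (E := dquot_spec f (g b) l (g w)); fold (q w) in E.
  rewrite (FG w) in E by lra; rewrite (FG b) in E by (rewrite Cmod_diag; lra).
  assert (E2 := f_equal (fun x => x - b)%C E); cbv beta in E2; rewrite E2; field; easy.
- apply (cdiff_of_factor _ (fun w => / q w)%C).
  + intros w; ring.
  + apply ccont_inv; [easy|now rewrite Qb].
Qed.

Lemma curve_diff_segment (a v : C) (t : R) : curve_diff (fun s => a + RtoC s * v)%C t v.
Proof.
intros eps He; exists 1; split; [lra|]; intros s _.
replace (a + RtoC s * v - (a + RtoC t * v) - RtoC (s - t) * v)%C with (RtoC 0) by (rewrite RtoC_minus; ring).
rewrite Cmod_0; generalize (Rabs_pos (s - t)); nra.
Qed.

Lemma constant_of_derive (f : C -> C) (a z : C) :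
  (forall s, 0 <= s <= 1 -> cdiff f (a + RtoC s * (z - a))%C 0%C) -> f z = f a.
Proof.
intros D.
assert (D' : forall s, 0 <= s <= 1 -> curve_diff (fun s => f (a + RtoC s * (z - a))%C) s 0%C).
{ intros s Hs; eapply curve_diff_eq; [apply curve_diff_comp; [apply curve_diff_segment|now apply D]|ring]. }
assert (E1 : (a + RtoC 1 * (z - a))%C = z) by ring.
assert (E0 : (a + RtoC 0 * (z - a))%C = a) by ring.
assert (I : forall g : R -> R, (forall s, 0 <= s <= 1 -> is_derive g s 0) -> g 1 = g 0).
{ intros g Hg; apply Rle_antisym.
  - cut (- g 0 <= - g 1); [lra|].
    apply (increasing_of_derive (fun s => - g s) (fun _ => 0) 0 1); [lra| |intros; lra].
    intros x Hx; replace 0 with (- 0) by ring; now apply (is_derive_opp g), Hg.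
  - apply (increasing_of_derive g (fun _ => 0) 0 1); [lra|easy|intros; lra]. }
apply C_ext.
- assert (Q := I (fun s => Re (f (a + RtoC s * (z - a))%C)) (fun s Hs => curve_diff_re _ _ _ (D' s Hs))); cbv beta in Q.
  now rewrite E1, E0 in Q.
- assert (Q := I (fun s => Im (f (a + RtoC s * (z - a))%C)) (fun s Hs => curve_diff_im _ _ _ (D' s Hs))); cbv beta in Q.
  now rewrite E1, E0 in Q.
Qed.

Lemma disk_nbhd (a : C) : Cmod a < 1 -> exists r, 0 < r /\ forall z, Cmod (z - a)%C <= r -> Cmod z < 1.
Proof.
intros Ha; exists ((1 - Cmod a) / 2); split; [lra|]; intros z Hz.
generalize (Cmod_triangle_inv z a); lra.
Qed.

Section Injective.

Variables H dH : C -> C.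
Hypothesis H_diff : forall z, Cmod z < 1 -> cdiff H z (dH z).
Hypothesis H_inj : forall z w, Cmod z < 1 -> Cmod w < 1 -> H z = H w -> z = w.

Lemma injective_hol z : Cmod z < 1 -> hol_at H z.
Proof. intros; eexists; now apply H_diff. Qed.

Lemma injective_circle_gap (a : C) (r : R) : 0 < r -> (forall z, Cmod (z - a)%C <= r -> Cmod z < 1) ->
  exists m, 0 < m /\ forall z, Cmod (z - a)%C = r -> m <= Cmod (H z - H a)%C.
Proof.
intros Hr U.
assert (Ua : Cmod a < 1) by (apply U; rewrite Cmod_diag; lra).
apply (circle_lower_bound (fun z => H z - H a)%C a r Hr).
- intros z Hz; apply ccont_minus; [apply hol_ccont, injective_hol, U; lra|apply ccont_const].
- intros z Hz; apply Cminus_neq_0; intros E; apply H_inj in E; [|apply U; lra|easy].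
  rewrite E, Cmod_diag in Hz; lra.
Qed.

(** Openness of [H] and continuity of its inverse at once. *)
Lemma injective_open (a : C) (eps : R) : Cmod a < 1 -> 0 < eps -> exists d, 0 < d /\
  forall w, Cmod (w - H a)%C < d -> exists z, Cmod z < 1 /\ Cmod (z - a)%C < eps /\ H z = w.
Proof.
intros Ha He; destruct (disk_nbhd a Ha) as [r0 [Hr0 U0]].
set (r := Rmin r0 (eps / 2)).
assert (Hr : 0 < r) by (apply Rmin_pos; lra).
assert (R1 : r <= r0) by apply Rmin_l; assert (R2 : r <= eps / 2) by apply Rmin_r.
assert (U : forall z, Cmod (z - a)%C <= r -> Cmod z < 1) by (intros z Hz; apply U0; lra).
destruct (injective_circle_gap a r Hr U) as [m [Hm G]].
exists (m / 2); split; [lra|]; intros w Hw.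
destruct (value_attained H a w r (m / 2) Hr) as [z [Z1 Z2]].
- intros z Hz; now apply injective_hol, U.
- intros z Hz; specialize (G z Hz); generalize (Cmod_triangle_3 (H z) w (H a)); lra.
- now rewrite Cmod_minus_sym.
- exists z; repeat split; auto; lra.
Qed.

(** An argument of Hurwitz type.  If [dH a = 0], let [z] be near [a] with
    [dH z <> 0].  The difference quotient of [H] at [z] has no zero on a fixed
    disk about [a], so it is bounded below there by its values on the boundary
    circle, uniformly in [z]; but at [a] it is close to [dH a = 0].  So [dH]
    vanishes near [a], and [H] is constant there. *)
Lemma injective_derivative_neq_0 (a : C) : Cmod a < 1 -> dH a <> 0%C.
Proof.
intros Ha E; destruct (disk_nbhd a Ha) as [r [Hr U]].
destruct (injective_circle_gap a r Hr U) as [m [Hm G]].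
set (k := m / (4 * r)).
assert (K : 0 < k) by (apply Rdiv_lt_0_compat; lra).
assert (Km : k * (4 * r) = m) by (unfold k; field; lra); clearbody k.
assert (Ca := cdiff_ccont _ _ _ (H_diff a Ha)).
destruct (Ca (m / 2)) as [d1 [Hd1 D1]]; [lra|].
assert (Da := H_diff a Ha); rewrite E in Da.
destruct (Da (k / 2)) as [d2 [Hd2 D2]]; [lra|].
set (d := Rmin r (Rmin d1 d2)).
assert (Hd : 0 < d) by (repeat apply Rmin_pos; lra).
assert (L1 : d <= r) by apply Rmin_l.
assert (L2 : d <= d1) by (eapply Rle_trans; [apply Rmin_r|apply Rmin_l]).
assert (L3 : d <= d2) by (eapply Rle_trans; [apply Rmin_r|apply Rmin_r]).
assert (Z : forall z, Cmod (z - a)%C < d -> dH z = 0%C).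
{ intros z Hz; destruct (Ceq_dec z a) as [->|Nz]; [easy|].
  apply NNPP; intros N.
  assert (Uz : Cmod z < 1) by (apply U; lra).
  assert (Q : k <= Cmod (dquot H z (dH z) a)).
  { apply (min_principle (dquot H z (dH z)) a z r k Hr K).
    - intros w Hw; apply ccont_dquot_all; [now apply H_diff|now apply injective_hol, U].
    - intros w Hw Nw; apply hol_dquot; [easy|apply injective_hol, U; lra].
    - intros w Hw; unfold dquot; destruct (Ceq_dec w z) as [->|Nw]; [easy|].
      apply Cmult_neq_0; [|apply Cinv_neq_0; now apply Cminus_neq_0].
      apply Cminus_neq_0; intros E'; apply Nw, H_inj; auto.
    - intros w Hw; unfold dquot; destruct (Ceq_dec w z) as [->|Nw]; [lra|].
      assert (Nw' := Cminus_neq_0 _ _ Nw); assert (P := proj1 (Cmod_gt_0 _) Nw').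
      rewrite Cmod_div by auto; apply Rle_div_r; [lra|].
      assert (Cmod (w - z)%C <= 2 * r).
      { generalize (Cmod_triangle_3 w a z); rewrite (Cmod_minus_sym a z); lra. }
      assert (m / 2 <= Cmod (H w - H z)%C).
      { generalize (Cmod_triangle_3 (H w) (H z) (H a)) (G w Hw) (D1 z ltac:(lra)); lra. }
      apply Rle_trans with (k * (2 * r)); [apply Rmult_le_compat_l; lra|].
      replace (k * (2 * r)) with (m / 2) by lra; easy.
    - rewrite Cmod_diag; lra. }
  unfold dquot in Q; destruct (Ceq_dec a z) as [->|Na]; [easy|].
  assert (Na' := Cminus_neq_0 _ _ Na); assert (P := proj1 (Cmod_gt_0 _) Na').
  rewrite Cmod_div in Q by easy; apply Rle_div_r in Q; [|lra].
  assert (T := D2 z ltac:(lra)).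
  replace (H z - H a - 0 * (z - a))%C with (H z - H a)%C in T by ring.
  rewrite (Cmod_minus_sym (H z)), (Cmod_minus_sym z) in T; nra. }
set (b := (a + RtoC (d / 2))%C).
assert (B : Cmod (b - a)%C = d / 2).
{ unfold b; replace (a + RtoC (d / 2) - a)%C with (RtoC (d / 2)) by ring; rewrite Cmod_R, Rabs_pos_eq; lra. }
assert (Eb : H b = H a).
{ apply constant_of_derive; intros s Hs.
  assert (Q : Cmod ((a + RtoC s * (b - a)) - a)%C < d).
  { replace ((a + RtoC s * (b - a)) - a)%C with (RtoC s * (b - a))%C by ring.
    rewrite Cmod_mult, Cmod_R, B, Rabs_pos_eq by lra; nra. }
  rewrite <- (Z _ Q); apply H_diff, U; lra. }
apply H_inj in Eb; [rewrite Eb, Cmod_diag in B; lra|apply U; lra|easy].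
Qed.

Definition disk_inverse (w : C) : C := epsilon (inhabits (RtoC 0)) (fun z : C => Cmod z < 1 /\ H z = w).

Lemma disk_inverse_spec w : disk_image H w -> Cmod (disk_inverse w) < 1 /\ H (disk_inverse w) = w.
Proof. exact (epsilon_spec (inhabits (RtoC 0)) (fun z : C => Cmod z < 1 /\ H z = w)). Qed.

Lemma disk_inverse_of_image z : Cmod z < 1 -> disk_inverse (H z) = z.
Proof.
intros Hz; destruct (disk_inverse_spec (H z)) as [A B]; [now exists z|]; now apply H_inj.
Qed.

Lemma disk_inverse_cdiff z : Cmod z < 1 -> cdiff disk_inverse (H z) (/ dH z)%C.
Proof.
intros Hz; destruct (injective_open z 1 Hz Rlt_0_1) as [r [Hr K]].
apply (cdiff_inverse H disk_inverse (H z) (dH z) r Hr).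
- intros w Hw; apply disk_inverse_spec; destruct (K w Hw) as [y [Y1 [Y2 Y3]]]; now exists y.
- intros eps He; destruct (injective_open z eps Hz He) as [d [Hd D]]; exists d; split; [easy|]; intros w Hw.
  destruct (D w Hw) as [y [Y1 [Y2 Y3]]]; rewrite <- Y3, !disk_inverse_of_image; auto.
- rewrite disk_inverse_of_image by easy; now apply H_diff.
- now apply injective_derivative_neq_0.
Qed.

Lemma disk_inverse_hol w : disk_image H w -> hol_at disk_inverse w.
Proof. intros [z [Hz <-]]; eexists; now apply disk_inverse_cdiff. Qed.

End Injective.

(** * The Schwarz-Pick inequality *)

Lemma ccont_conj (f : C -> C) (a : C) : ccont f a -> ccont (fun z => Cconj (f z)) a.
Proof.
intros F eps He; destruct (F eps He) as [d [Hd D]]; exists d; split; [easy|]; intros z Hz.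
rewrite <- Cminus_conj, Cmod_conj; auto.
Qed.

Lemma one_minus_conj_neq_0 (w z : C) : Cmod w < 1 -> Cmod z <= 1 -> (1 - Cconj w * z)%C <> 0%C.
Proof.
intros Hw Hz E; assert (T := Cmod_triangle_inv 1%C (Cconj w * z)%C).
rewrite E, Cmod_1, Cmod_0, Cmod_mult, Cmod_conj in T.
generalize (Cmod_ge_0 w) (Cmod_ge_0 z); nra.
Qed.

Lemma pseudo_hyperbolic_identity (w z : C) :
  Cmod (1 - Cconj w * z)%C * Cmod (1 - Cconj w * z)%C - Cmod (z - w)%C * Cmod (z - w)%C =
  (1 - Cmod z * Cmod z) * (1 - Cmod w * Cmod w).
Proof.
rewrite !Cmod_sqr, !re_minus, !im_minus, re_mult, im_mult, re_conj, im_conj, re_RtoC, im_RtoC; ring.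
Qed.

Lemma pseudo_hyperbolic_le_1 (w z : C) : Cmod w < 1 -> Cmod z < 1 -> Cmod (z - w)%C <= Cmod (1 - Cconj w * z)%C.
Proof.
intros Hw Hz; assert (I := pseudo_hyperbolic_identity w z).
generalize (Cmod_ge_0 w) (Cmod_ge_0 z) (Cmod_ge_0 (z - w)%C) (Cmod_ge_0 (1 - Cconj w * z)%C); intros.
assert (0 <= (1 - Cmod z * Cmod z) * (1 - Cmod w * Cmod w)) by (apply Rmult_le_pos; nra).
apply Rsqr_incr_0_var; unfold Rsqr; lra.
Qed.

Lemma Rle_of_near (a b : R) : (forall eps, 0 < eps -> a <= b + eps) -> a <= b.
Proof. intros H; apply Rnot_lt_le; intros L; specialize (H ((a - b) / 2)); lra. Qed.

(** The quotient of the two sides, without moduli, is holomorphic off [w] and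
    continuous at [w]; on a circle of radius close to 1 its modulus is at most
    [1 + eps]. *)
Lemma schwarz_pick (G : C -> C) : (forall z, Cmod z < 1 -> hol_at G z) ->
  (forall z, Cmod z < 1 -> Cmod (G z) < 1) -> forall z w, Cmod z < 1 -> Cmod w < 1 ->
  Cmod (G z - G w)%C * Cmod (1 - Cconj w * z)%C <= Cmod (z - w)%C * Cmod (1 - Cconj (G w) * G z)%C.
Proof.
intros Gh GU z0 w Hz0 Hw.
destruct (Gh w Hw) as [l Dl].
set (q := fun z => (dquot G w l z * ((1 - Cconj w * z) / (1 - Cconj (G w) * G z)))%C).
assert (Q : Cmod (q z0) <= 1).
{ apply Rle_of_near; intros eps He.
  set (b := Rmax (Cmod w) (Cmod z0)).
  assert (B0 : 0 <= b) by (apply Rle_trans with (Cmod w); [apply Cmod_ge_0|apply Rmax_l]).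
  assert (B1 : b < 1) by now apply Rmax_lub_lt.
  assert (Bw : Cmod w <= b) by apply Rmax_l.
  assert (Bz : Cmod z0 <= b) by apply Rmax_r.
  set (e := Rmin ((1 - b) / 2) (eps * ((1 - b) * (1 - b)) / 8)).
  assert (E0 : 0 < e).
  { apply Rmin_pos; [lra|]; apply Rdiv_lt_0_compat; [|lra]; apply Rmult_lt_0_compat; [easy|nra]. }
  assert (E1 : e <= (1 - b) / 2) by apply Rmin_l.
  assert (E2 : e <= eps * ((1 - b) * (1 - b)) / 8) by apply Rmin_r.
  clearbody e; set (s := 1 - e).
  apply (max_principle q 0%C w s); try (unfold s; lra).
  - intros z; replace (z - 0)%C with z by ring; intros Hz; assert (Uz : Cmod z < 1) by (unfold s in Hz; lra).
    apply ccont_mult; [apply ccont_dquot_all; auto|].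
    apply ccont_div.
    + apply ccont_minus; [apply ccont_const|apply ccont_scal].
    + apply ccont_minus; [apply ccont_const|]; apply ccont_mult; [apply ccont_const|now apply hol_ccont, Gh].
    + apply one_minus_conj_neq_0; [now apply GU|left; now apply GU].
  - intros z; replace (z - 0)%C with z by ring; intros Hz Nz; assert (Uz : Cmod z < 1) by (unfold s in Hz; lra).
    apply hol_mult; [apply hol_dquot; auto|].
    apply hol_div.
    + apply hol_minus; [apply hol_const|apply hol_mult; [apply hol_const|apply hol_id]].
    + apply hol_minus; [apply hol_const|]; apply hol_mult; [apply hol_const|now apply Gh].
    + apply one_minus_conj_neq_0; [now apply GU|left; now apply GU].
  - intros z; replace (z - 0)%C with z by ring; intros Hz; assert (Uz : Cmod z < 1) by (unfold s in Hz; lra).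
    assert (Nz : z <> w) by (intros ->; unfold s in Hz; lra).
    assert (Nz' := Cminus_neq_0 _ _ Nz); assert (P := proj1 (Cmod_gt_0 _) Nz').
    assert (Ng := one_minus_conj_neq_0 (G w) (G z) (GU w Hw) (Rlt_le _ _ (GU z Uz))).
    assert (Pg := proj1 (Cmod_gt_0 _) Ng).
    unfold q, dquot; destruct (Ceq_dec z w) as [|_]; [easy|].
    replace ((G z - G w) / (z - w) * ((1 - Cconj w * z) / (1 - Cconj (G w) * G z)))%C
      with (((G z - G w) / (1 - Cconj (G w) * G z)) * ((1 - Cconj w * z) / (z - w)))%C by (field; auto).
    rewrite Cmod_mult, !Cmod_div by easy.
    assert (A := pseudo_hyperbolic_le_1 (G w) (G z) (GU w Hw) (GU z Uz)).
    assert (A' : Cmod (G z - G w) / Cmod (1 - Cconj (G w) * G z) <= 1) by (apply Rle_div_l; lra).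
    assert (I := pseudo_hyperbolic_identity w z).
    assert (L : (1 - b) / 2 <= Cmod (z - w)%C).
    { generalize (Cmod_triangle_inv z w); unfold s in Hz; lra. }
    assert (X : Cmod (1 - Cconj w * z) <= (1 + eps) * Cmod (z - w)%C).
    { assert (W0 := Cmod_ge_0 w).
      apply Rsqr_incr_0_var; unfold Rsqr; [|nra].
      assert (Y : (1 - Cmod z * Cmod z) * (1 - Cmod w * Cmod w) <= 2 * e).
      { rewrite Hz; unfold s; replace (1 - (1 - e) * (1 - e)) with (2 * e - e * e) by ring.
        assert (0 <= Cmod w * Cmod w) by nra.
        assert (0 <= 1 - Cmod w * Cmod w) by nra. nra. }
      assert (Y2 : (1 - b) / 2 * ((1 - b) / 2) <= Cmod (z - w)%C * Cmod (z - w)%C) by (apply Rmult_le_compat; lra).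
      assert (Y3 : 2 * e <= eps * ((1 - b) / 2 * ((1 - b) / 2))) by lra.
      assert (Y4 : eps * ((1 - b) / 2 * ((1 - b) / 2)) <= eps * (Cmod (z - w)%C * Cmod (z - w)%C)) by (apply Rmult_le_compat_l; lra).
      assert (0 <= eps * (eps * (Cmod (z - w)%C * Cmod (z - w)%C))) by (apply Rmult_le_pos; [lra|apply Rmult_le_pos; nra]).
      nra. }
    assert (X' : Cmod (1 - Cconj w * z) / Cmod (z - w) <= 1 + eps) by (apply Rle_div_l; lra).
    replace (1 + eps) with (1 * (1 + eps)) by ring.
    apply Rmult_le_compat; try easy; apply Rdiv_le_0_compat; try easy; apply Cmod_ge_0.
  - replace (z0 - 0)%C with z0 by ring; unfold s; lra. }
assert (Ng := one_minus_conj_neq_0 (G w) (G z0) (GU w Hw) (Rlt_le _ _ (GU z0 Hz0))).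
assert (Pg := proj1 (Cmod_gt_0 _) Ng).
assert (E : ((G z0 - G w) * (1 - Cconj w * z0))%C = (q z0 * ((z0 - w) * (1 - Cconj (G w) * G z0)))%C).
{ rewrite (dquot_spec G w l z0) at 1; unfold q; field; easy. }
rewrite <- !Cmod_mult, E, Cmod_mult.
generalize (Cmod_ge_0 ((z0 - w) * (1 - Cconj (G w) * G z0))%C); nra.
Qed.

(** Multiplication by [r] strictly decreases the pseudo-hyperbolic distance
    [|a - b| / |1 - conj b a|]. *)
Lemma contraction_strict (a b : C) (r : R) : 0 < r < 1 -> Cmod a < 1 -> Cmod b < 1 ->
  r * Cmod (1 - Cconj b * a)%C < Cmod (1 - Cconj (RtoC r * b) * (RtoC r * a))%C.
Proof.
intros Hr Ha Hb.
set (c := (Cconj b * a)%C).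
assert (Hc : Cmod c < 1).
{ unfold c; rewrite Cmod_mult, Cmod_conj; generalize (Cmod_ge_0 a) (Cmod_ge_0 b); nra. }
replace (Cconj (RtoC r * b) * (RtoC r * a))%C with (RtoC (r * r) * c)%C
 by (unfold c; rewrite Cmult_conj, RtoC_mult; replace (Cconj (RtoC r)) with (RtoC r); [ring|apply C_ext; simpl; ring]).
clearbody c; apply Cmod_lt_1_sqr in Hc.
apply Rsqr_incrst_0; [unfold Rsqr| |apply Cmod_ge_0].
- replace (r * Cmod (1 - c) * (r * Cmod (1 - c))) with (r * r * (Cmod (1 - c) * Cmod (1 - c))) by ring.
  rewrite !Cmod_sqr, !re_minus, !im_minus, re_mult, im_mult, !re_RtoC, !im_RtoC.
  set (x := Re c) in *; set (y := Im c) in *.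
  assert (0 < (1 - r * r) * (1 - r * r * (x * x + y * y))).
  { assert (0 < r * r < 1) by nra. apply Rmult_lt_0_compat; [lra|].
    assert (0 <= x * x + y * y) by nra. nra. }
  nra.
- apply Rmult_le_pos; [lra|apply Cmod_ge_0].
Qed.

(** A point that [r G] moves least, for the pseudo-hyperbolic distance, is
    fixed: its image would be moved strictly less. *)
Lemma fixed_point (G : C -> C) (r : R) : 0 < r < 1 -> (forall z, Cmod z < 1 -> hol_at G z) ->
  (forall z, Cmod z < 1 -> Cmod (G z) < 1) -> exists p, Cmod p < 1 /\ (RtoC r * G p)%C = p.
Proof.
intros Hr Gh GU.
set (T := fun z => (RtoC r * G z)%C).
assert (TU : forall z, Cmod z < 1 -> Cmod (T z) <= r).
{ intros z Hz; unfold T; rewrite Cmod_mult, Cmod_R, Rabs_pos_eq by lra; generalize (GU z Hz); nra. }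
set (V := fun z => ((z - T z) / (1 - Cconj (T z) * z))%C).
assert (TN : forall z, Cmod z < 1 -> (1 - Cconj (T z) * z)%C <> 0%C).
{ intros z Hz; apply one_minus_conj_neq_0; [generalize (TU z Hz); lra|lra]. }
assert (Tc : forall z, Cmod z < 1 -> ccont T z).
{ intros z Hz; apply ccont_mult; [apply ccont_const|now apply hol_ccont, Gh]. }
destruct (disk_max (fun z => - Cmod (V z)) 0%C r ltac:(lra)) as [m [Hm M]].
{ intros z; replace (z - 0)%C with z by ring; intros Hz eps He.
  assert (Uz : Cmod z < 1) by lra.
  destruct (Cmod_continuous V z) with (eps := eps) as [d [Hd D]]; auto.
  - apply ccont_div; [apply ccont_minus; [apply ccont_id|auto]| |auto].
    apply ccont_minus; [apply ccont_const|apply ccont_mult; [apply ccont_conj; auto|apply ccont_id]].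
  - exists d; split; [easy|]; intros w Hw; rewrite <- Rabs_Ropp.
    replace (- (- Cmod (V w) - - Cmod (V z))) with (Cmod (V w) - Cmod (V z)) by ring; auto. }
replace (m - 0)%C with m in Hm by ring.
assert (Um : Cmod m < 1) by lra.
exists m; split; [easy|].
apply NNPP; intros N; change (T m <> m) in N.
assert (Hm' := TU m Um).
specialize (M (T m)); replace (T m - 0)%C with (T m) in M by ring; specialize (M Hm').
assert (Um' : Cmod (T m) < 1) by lra.
assert (P0 : 0 < Cmod (V m)).
{ unfold V; rewrite Cmod_div by auto; apply Rdiv_lt_0_compat; apply Cmod_gt_0; auto.
  apply Cminus_neq_0; auto. }
assert (L : Cmod (V (T m)) < Cmod (V m)).
{ assert (X := contraction_strict (G m) (G (T m)) r Hr (GU m Um) (GU _ Um')).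
  assert (Y := schwarz_pick G Gh GU m (T m) Um Um').
  fold (T m) in X; fold (T (T m)) in X.
  assert (Q1 := proj1 (Cmod_gt_0 _) (TN m Um)); assert (Q2 := proj1 (Cmod_gt_0 _) (TN (T m) Um')).
  unfold V at 1; rewrite Cmod_div by auto; apply Rlt_div_l; [easy|].
  assert (E : (T m - T (T m))%C = (RtoC r * (G m - G (T m)))%C) by (unfold T; ring).
  rewrite E, Cmod_mult, Cmod_R, Rabs_pos_eq by lra.
  assert (Z : Cmod (m - T m)%C = Cmod (V m) * Cmod (1 - Cconj (T m) * m)%C).
  { unfold V; rewrite Cmod_div by auto; field; lra. }
  rewrite Z in Y.
  assert (Y' : Cmod (G m - G (T m))%C <= Cmod (V m) * Cmod (1 - Cconj (G (T m)) * G m)%C).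
  { apply Rmult_le_reg_r with (Cmod (1 - Cconj (T m) * m)%C); [easy|]; lra. }
  assert (0 <= Cmod (1 - Cconj (G (T m)) * G m)%C) by apply Cmod_ge_0.
  nra. }
lra.
Qed.

(** By hypothesis [w] is not farther from [p] than [z] in pseudo-hyperbolic
    distance, that is,
    [(1 - |w|^2) / |1 - conj p w|^2 >= (1 - |z|^2) / |1 - conj p z|^2].  The
    factor [1 - |p|^2] has cancelled, so the conclusion survives the passage
    of [p] to the unit circle. *)
Lemma fixed_direction (p z w : C) : Cmod p < 1 -> Cmod z < 1 ->
  Cmod (w - p)%C * Cmod (1 - Cconj p * z)%C <= Cmod (z - p)%C * Cmod (1 - Cconj p * w)%C ->
  0 <= Re ((w - z) * (Cconj (1 - Cconj p * z) * (Cconj p - Cconj z)))%C.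
Proof.
intros Hp Hz L.
apply Cmod_lt_1_sqr in Hp; apply Cmod_lt_1_sqr in Hz.
assert (S : (Cmod (w - p) * Cmod (w - p)) * (Cmod (1 - Cconj p * z) * Cmod (1 - Cconj p * z)) <=
  (Cmod (z - p) * Cmod (z - p)) * (Cmod (1 - Cconj p * w) * Cmod (1 - Cconj p * w))).
{ replace (Cmod (w - p) * Cmod (w - p) * (Cmod (1 - Cconj p * z) * Cmod (1 - Cconj p * z)))
    with ((Cmod (w - p) * Cmod (1 - Cconj p * z)) * (Cmod (w - p) * Cmod (1 - Cconj p * z))) by ring.
  replace (Cmod (z - p) * Cmod (z - p) * (Cmod (1 - Cconj p * w) * Cmod (1 - Cconj p * w)))
    with ((Cmod (z - p) * Cmod (1 - Cconj p * w)) * (Cmod (z - p) * Cmod (1 - Cconj p * w))) by ring.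
  apply Rmult_le_compat; try easy; apply Rmult_le_pos; apply Cmod_ge_0. }
rewrite !Cmod_sqr, !re_minus, !im_minus, !re_mult, !im_mult, !re_conj, !im_conj, !re_RtoC, !im_RtoC in S.
rewrite !re_mult, !im_mult, !re_conj, !im_conj, !re_minus, !im_minus, !re_mult, !im_mult, !re_conj, !im_conj, !re_RtoC, !im_RtoC.
destruct p as [a b], z as [x y], w as [u v]; simpl in *.
set (A := (1 - (a * x - - b * y)) * (1 - (a * x - - b * y)) + (0 - (a * y + - b * x)) * (0 - (a * y + - b * x))) in *.
set (Q := ((u - x) * (u - x) + (v - y) * (v - y)) * (A + (1 - (x * x + y * y)) * (a * a + b * b))).
(* [1 - |p|^2] factors out of the difference of the two squared sides. *)
match goal with |- 0 <= ?g => assert (I : (1 - (a * a + b * b)) * (2 * g - Q) =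
   ((x - a) * (x - a) + (y - b) * (y - b)) * ((1 - (a * u - - b * v)) * (1 - (a * u - - b * v)) + (0 - (a * v + - b * u)) * (0 - (a * v + - b * u))) -
  ((u - a) * (u - a) + (v - b) * (v - b)) * A) by (unfold Q, A; ring); set (G := g) in * end.
assert (sq : forall r, 0 <= r * r) by (intros; nra).
assert (HA : 0 <= A) by (unfold A; apply Rplus_le_le_0_compat; apply sq).
assert (HQ : 0 <= Q).
{ generalize (sq a) (sq b); intros.
  apply Rmult_le_pos; [apply Rplus_le_le_0_compat; apply sq|].
  assert (0 <= (1 - (x * x + y * y)) * (a * a + b * b)) by (apply Rmult_le_pos; lra); lra. }
assert (J : 0 <= (1 - (a * a + b * b)) * (2 * G - Q)) by lra.
assert (0 <= 2 * G - Q) by (apply Rmult_le_reg_l with (1 - (a * a + b * b)); lra).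
lra.
Qed.

(** * The Berkson-Porta inequality *)

Section BerksonPorta.

Variables H dH : C -> C.
Hypothesis H_diff : forall z, Cmod z < 1 -> cdiff H z (dH z).
Hypothesis H_inj : forall z w, Cmod z < 1 -> Cmod w < 1 -> H z = H w -> z = w.
Hypothesis H_star : forall z s, Cmod z < 1 -> 0 < s <= 1 -> disk_image H (RtoC s * H z)%C.

Let F (s : R) (z : C) : C := disk_inverse H (RtoC s * H z)%C.

Lemma scaled_inverse_disk s z : 0 < s <= 1 -> Cmod z < 1 -> Cmod (F s z) < 1.
Proof. intros Hs Hz; now apply (disk_inverse_spec H), H_star. Qed.

Lemma scaled_inverse_hol s z : 0 < s <= 1 -> Cmod z < 1 -> hol_at (F s) z.
Proof.
intros Hs Hz; apply (hol_comp (fun z => RtoC s * H z)%C (disk_inverse H)).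
- apply hol_mult; [apply hol_const|eexists; now apply H_diff].
- now apply (disk_inverse_hol H dH H_diff H_inj), H_star.
Qed.

(** The factor [1 - t^2] produces a fixed point in the open disk without
    changing the velocity at [t = 0]. *)
Let G (t : R) (z : C) : C := (RtoC (1 - t * t) * F (exp (- t)) z)%C.

Lemma perturbed_flow_curve z : Cmod z < 1 -> curve_diff (fun t => G t z) 0 (- (H z / dH z))%C.
Proof.
intros Hz.
assert (D1 : curve_diff (fun t => RtoC (exp (- t)) * H z)%C 0 (- H z)%C).
{ apply curve_diff_parts.
  - apply (is_derive_ext (fun t => exp (- t) * Re (H z))); [intros t; now rewrite re_scal_l|].
    auto_derive; [easy|]; rewrite Ropp_0, exp_0, re_opp; ring.
  - apply (is_derive_ext (fun t => exp (- t) * Im (H z))); [intros t; now rewrite im_scal_l|].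
    auto_derive; [easy|]; rewrite Ropp_0, exp_0, im_opp; ring. }
assert (E0 : (RtoC (exp (- 0)) * H z)%C = H z) by (rewrite Ropp_0, exp_0; ring).
assert (D2 : curve_diff (fun t => F (exp (- t)) z) 0 (- (H z / dH z))%C).
{ eapply curve_diff_eq.
  - apply (curve_diff_comp (fun t => RtoC (exp (- t)) * H z)%C (disk_inverse H) 0 _ (/ dH z)%C D1).
    rewrite E0; now apply disk_inverse_cdiff.
  - unfold Cdiv; ring. }
assert (A := curve_diff_re _ _ _ D2); assert (B := curve_diff_im _ _ _ D2).
assert (F0 : F (exp (- 0)) z = z) by (unfold F; rewrite E0; now apply (disk_inverse_of_image H H_inj)).
apply curve_diff_parts.
- apply (is_derive_ext (fun t => (1 - t * t) * Re (F (exp (- t)) z))); [intros t; unfold G; now rewrite re_scal_l|].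
  replace (Re (- (H z / dH z))%C) with (0 * Re (F (exp (- 0)) z) + (1 - 0 * 0) * Re (- (H z / dH z))%C) by ring.
  apply (is_derive_mult (fun t => 1 - t * t) (fun t => Re (F (exp (- t)) z))); [|easy|intros; apply Rmult_comm].
  auto_derive; [easy|ring].
- apply (is_derive_ext (fun t => (1 - t * t) * Im (F (exp (- t)) z))); [intros t; unfold G; now rewrite im_scal_l|].
  replace (Im (- (H z / dH z))%C) with (0 * Im (F (exp (- 0)) z) + (1 - 0 * 0) * Im (- (H z / dH z))%C) by ring.
  apply (is_derive_mult (fun t => 1 - t * t) (fun t => Im (F (exp (- t)) z))); [|easy|intros; apply Rmult_comm].
  auto_derive; [easy|ring].
Qed.

Lemma perturbed_flow_0 z : Cmod z < 1 -> G 0 z = z.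
Proof.
intros Hz; unfold G, F; rewrite Ropp_0, exp_0, Cmult_1_l, (disk_inverse_of_image H H_inj) by easy.
replace (1 - 0 * 0) with 1 by ring; ring.
Qed.

Lemma perturbed_flow_fixed t : 0 < t < 1 -> exists p, Cmod p < 1 /\ forall z, Cmod z < 1 ->
  0 <= Re ((G t z - z) * (Cconj (1 - Cconj p * z) * (Cconj p - Cconj z)))%C.
Proof.
intros Ht.
assert (Hs : 0 < exp (- t) <= 1).
{ split; [apply exp_pos|]; rewrite <- exp_0; left; apply exp_increasing; lra. }
assert (Hr : 0 < 1 - t * t < 1) by nra.
destruct (fixed_point (F (exp (- t))) (1 - t * t) Hr) as [p [Hp Ep]].
- intros z Hz; now apply scaled_inverse_hol.
- intros z Hz; now apply scaled_inverse_disk.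
- exists p; split; [easy|]; intros z Hz; apply fixed_direction; try easy.
  change (G t p = p) in Ep.
  rewrite <- Ep at 1; rewrite <- Ep at 4.
  apply (schwarz_pick (G t)); try easy.
  + intros y Hy; apply hol_mult; [apply hol_const|now apply scaled_inverse_hol].
  + intros y Hy; unfold G; rewrite Cmod_mult, Cmod_R, Rabs_pos_eq by lra.
    generalize (scaled_inverse_disk _ y Hs Hy) (Cmod_ge_0 (F (exp (- t)) y)); nra.
Qed.

(** The flow [t -> H^-1 (e^-t H z)] has velocity [- H / dH] at [t = 0], and the
    inequality says that it does not move away from [p].  The point [p] is a
    cluster point of the fixed points of the perturbed flow, as in Wolff's
    theorem. *)
Lemma berkson_porta : exists p, Cmod p <= 1 /\ forall z, Cmod z < 1 ->
  Re (H z / dH z * (Cconj (1 - Cconj p * z) * (Cconj p - Cconj z)))%C <= 0.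
Proof.
destruct (cluster_point (fun t p => Cmod p < 1 /\ forall z, Cmod z < 1 ->
  0 <= Re ((G t z - z) * (Cconj (1 - Cconj p * z) * (Cconj p - Cconj z)))%C) 1 Rlt_0_1) as [p [Hp K]].
{ intros t0 Ht0; set (t := Rmin (t0 / 2) (1 / 2)).
  assert (T : 0 < t) by (apply Rmin_pos; lra).
  assert (T1 : t <= t0 / 2) by apply Rmin_l; assert (T2 : t <= 1 / 2) by apply Rmin_r.
  destruct (perturbed_flow_fixed t) as [q [Q1 Q2]]; [lra|].
  exists t, q; repeat split; auto; lra. }
exists p; split; [easy|]; intros z Hz.
set (A := fun q => (Cconj (1 - Cconj q * z) * (Cconj q - Cconj z))%C).
set (v := (- (H z / dH z))%C).
cut (0 <= Re (v * A p)%C).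
{ unfold v; replace (- (H z / dH z) * A p)%C with (- (H z / dH z * A p))%C by ring; rewrite re_opp; unfold A; lra. }
assert (CA : ccont A p).
{ apply ccont_mult.
  - apply ccont_conj, ccont_minus; [apply ccont_const|apply ccont_mult; [apply ccont_conj, ccont_id|apply ccont_const]].
  - apply ccont_minus; [apply ccont_conj, ccont_id|apply ccont_const]. }
apply Rnot_lt_le; intros N.
set (e := - Re (v * A p)%C); assert (E : 0 < e) by (unfold e; lra).
set (M := Cmod v + Cmod (A p) + 2).
assert (M1 := Cmod_ge_0 v); assert (M2 := Cmod_ge_0 (A p)).
set (e1 := Rmin 1 (e / (2 * M))).
assert (E1 : 0 < e1) by (apply Rmin_pos; [lra|apply Rdiv_lt_0_compat; unfold M; lra]).
assert (E2 : e1 <= 1) by apply Rmin_l.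
assert (E3 : e1 * (2 * M) <= e) by (apply Rle_div_r; [unfold M; lra|apply Rmin_r]).
destruct (CA e1 E1) as [d [Hd D]].
destruct (perturbed_flow_curve z Hz e1 E1) as [d' [Hd' D']].
destruct (K d d' Hd Hd') as [t [q [Ht [Hq [Hqp [Hq' Q]]]]]].
specialize (Q z Hz); specialize (D q Hqp); fold (A q) in Q.
assert (L := D' t ltac:(rewrite Rminus_0_r, Rabs_pos_eq; lra)).
rewrite perturbed_flow_0, Rminus_0_r, (Rabs_pos_eq t) in L by (easy || lra); fold v in L.
assert (X : ((G t z - z) * A q)%C = ((G t z - z - RtoC t * v) * A q + RtoC t * (v * (A q - A p) + v * A p))%C) by ring.
rewrite X, re_plus, re_scal_l, re_plus in Q.
assert (B1 := re_le_Cmod ((G t z - z - RtoC t * v) * A q)%C); rewrite Cmod_mult in B1; apply Rabs_le_between in B1.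
assert (B2 := re_le_Cmod (v * (A q - A p))%C); rewrite Cmod_mult in B2; apply Rabs_le_between in B2.
assert (B3 := Cmod_triangle_inv (A q) (A p)).
assert (B4 : Cmod (G t z - z - RtoC t * v) * Cmod (A q) <= (e1 * t) * (Cmod (A p) + 1)).
{ apply Rmult_le_compat; try apply Cmod_ge_0; lra. }
assert (B5 : Cmod v * Cmod (A q - A p) <= Cmod v * e1) by (apply Rmult_le_compat_l; lra).
assert (B6 : t * Re (v * (A q - A p))%C <= t * (Cmod v * e1)) by (apply Rmult_le_compat_l; lra).
fold e in N; assert (Ee : Re (v * A p)%C = - e) by (unfold e; ring); rewrite Ee in Q.
assert (B7 : 0 <= t * (e1 * (Cmod (A p) + 1) + Cmod v * e1 - e)) by lra.
assert (B8 : e1 * (Cmod (A p) + 1) + Cmod v * e1 - e < 0) by (unfold M in E3; nra).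
nra.
Qed.

End BerksonPorta.

(** * The limit [nu] is real and negative *)

(** The point at distance [t] from 1, seen from 1 at the angle [phi] with the
    inner normal of the circle. *)
Definition ray (t phi : R) : C := (1 - RtoC t * cis phi)%C.

Lemma ray_minus_1 (t phi : R) : 0 <= t -> Cmod (ray t phi - 1)%C = t.
Proof.
intros Ht; unfold ray; replace (1 - RtoC t * cis phi - 1)%C with (- (RtoC t * cis phi))%C by ring.
rewrite Cmod_opp, Cmod_mult, Cmod_R, Cmod_cis, Rabs_pos_eq; lra.
Qed.

Lemma cos2_sin2 (x : R) : cos x * cos x + sin x * sin x = 1.
Proof. generalize (sin2_cos2 x); unfold Rsqr; lra. Qed.

Lemma ray_Cmod (c t phi : R) : 0 < c <= cos phi -> 0 < t < c -> Cmod (ray t phi) < 1 - t * c / 2.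
Proof.
intros Hc Ht.
assert (C1 := COS_bound phi).
apply Rsqr_incrst_0; [unfold Rsqr; rewrite Cmod_sqr| apply Cmod_ge_0|nra].
unfold ray, cis; rewrite re_minus, im_minus, re_scal_l, im_scal_l; simpl.
generalize (cos2_sin2 phi); intros S.
replace ((1 - t * cos phi) * (1 - t * cos phi) + (0 - t * sin phi) * (0 - t * sin phi))
 with (1 - 2 * t * cos phi + t * t * (cos phi * cos phi + sin phi * sin phi)) by ring.
rewrite S; assert (t * c <= t * cos phi) by (apply Rmult_le_compat_l; lra); nra.
Qed.

Lemma ray_in_disk (c t phi : R) : 0 < c <= cos phi -> 0 < t < c -> Cmod (ray t phi) < 1.
Proof. intros Hc Ht; generalize (ray_Cmod c t phi Hc Ht); nra. Qed.

Lemma ray_stolz (c t phi : R) : 0 < c <= cos phi -> 0 < t < c ->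
  Cmod (ray t phi - 1)%C < 2 / c * (1 - Cmod (ray t phi)).
Proof.
intros Hc Ht; rewrite ray_minus_1 by lra; generalize (ray_Cmod c t phi Hc Ht); intros L.
apply Rmult_lt_reg_r with (c / 2); [lra|].
replace (2 / c * (1 - Cmod (ray t phi)) * (c / 2)) with (1 - Cmod (ray t phi)) by (field; lra); lra.
Qed.

Lemma Cmult_conj_Cmod (z : C) : (z * Cconj z)%C = RtoC (Cmod z * Cmod z).
Proof.
apply C_ext; rewrite ?re_RtoC, ?im_RtoC, ?Cmod_sqr, ?re_mult, ?im_mult, ?re_conj, ?im_conj; ring.
Qed.

Lemma re_cayley (s : C) : (1 - s)%C <> 0%C ->
  Re ((1 + s) / (1 - s))%C * (Cmod (1 - s) * Cmod (1 - s)) = 1 - Cmod s * Cmod s.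
Proof.
intros N; rewrite <- re_scal_r, <- Cmult_conj_Cmod.
replace ((1 + s) / (1 - s) * ((1 - s) * Cconj (1 - s)))%C with ((1 + s) * Cconj (1 - s))%C by (field; easy).
rewrite !Cmod_sqr, re_mult, re_conj, im_conj, re_plus, im_plus, re_minus, im_minus, re_RtoC, im_RtoC; ring.
Qed.

Section Negative.

Variables H dH : C -> C.
Variable nu : C.
Hypothesis H_diff : forall z, Cmod z < 1 -> cdiff H z (dH z).
Hypothesis H_inj : forall z w, Cmod z < 1 -> Cmod w < 1 -> H z = H w -> z = w.
Hypothesis H_star : forall z s, Cmod z < 1 -> 0 < s <= 1 -> disk_image H (RtoC s * H z)%C.
Hypothesis nu_neq_0 : nu <> 0%C.
Hypothesis H_Q : forall M eps, 1 < M -> 0 < eps -> exists d, 0 < d /\ forall z,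
  Cmod (z - 1)%C < d -> Cmod (z - 1)%C < M * (1 - Cmod z) ->
  Cmod ((z - 1) * dH z / H z - nu)%C < eps.

(** All rays with [cos phi >= c] lie in one Stolz region, so the angular limit
    is uniform in [phi]. *)
Lemma Q_ray (c eps : R) : 0 < c -> 0 < eps -> exists t0, 0 < t0 /\ forall t phi,
  0 < t < t0 -> c <= cos phi -> Cmod (ray t phi) < 1 /\ H (ray t phi) <> 0%C /\
  Cmod ((ray t phi - 1) * dH (ray t phi) / H (ray t phi) - nu)%C < eps.
Proof.
intros Hc He; destruct (Rle_lt_dec c 1) as [Hc1|Hc1].
2:{ exists 1; split; [lra|]; intros t phi _ L; generalize (COS_bound phi); lra. }
assert (P : 0 < Cmod nu) by now apply Cmod_gt_0.
destruct (H_Q (2 / c) (Rmin eps (Cmod nu))) as [d [Hd D]].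
{ apply Rlt_div_r; lra. }
{ now apply Rmin_pos. }
exists (Rmin d c); split; [now apply Rmin_pos|]; intros t phi Ht L.
assert (t < d) by (generalize (Rmin_l d c); lra).
assert (t < c) by (generalize (Rmin_r d c); lra).
assert (U : Cmod (ray t phi) < 1) by (apply (ray_in_disk c); lra).
assert (D1 : Cmod (ray t phi - 1)%C < d) by (rewrite ray_minus_1; lra).
specialize (D (ray t phi) D1 (ray_stolz c t phi ltac:(lra) ltac:(lra))).
split; [easy|split].
- intros E; rewrite E in D.
  replace ((ray t phi - 1) * dH (ray t phi) / 0 - nu)%C with (- nu)%C in D.
  + rewrite Cmod_opp in D; generalize (Rmin_r eps (Cmod nu)); lra.
  + unfold Cdiv; replace (/ 0)%C with (RtoC 0); [ring|unfold Cinv; apply C_ext; simpl; unfold Rdiv; ring].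
- generalize (Rmin_l eps (Cmod nu)); lra.
Qed.

(** On the ray, [H / dH] is close to [- t cis phi / nu], while the other factor
    of the Berkson-Porta inequality tends to [- |1 - p|^2]. *)
Lemma direction_bound (p : C) (phi : R) : p <> 1%C -> 0 < cos phi ->
  (forall z, Cmod z < 1 -> Re (H z / dH z * (Cconj (1 - Cconj p * z) * (Cconj p - Cconj z)))%C <= 0) ->
  Re (cis phi / nu)%C <= 0.
Proof.
intros Np Hphi BP; apply Rnot_lt_le; intros L.
set (A := fun z => (Cconj (1 - Cconj p * z) * (Cconj p - Cconj z))%C).
set (K := fun q => (cis phi / q)%C).
set (k := Cmod (1 - p)%C * Cmod (1 - p)%C).
assert (N1 : (1 - p)%C <> 0%C) by (apply Cminus_neq_0; auto).
assert (P1 := proj1 (Cmod_gt_0 _) N1).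
assert (K0 : 0 < k) by (unfold k; nra).
assert (A1 : A 1%C = RtoC (- k)).
{ unfold A, k; apply C_ext; rewrite ?re_RtoC, ?im_RtoC, ?Cmod_sqr;
  rewrite ?re_mult, ?im_mult, ?re_conj, ?im_conj, ?re_minus, ?im_minus, ?re_mult, ?im_mult, ?re_conj, ?im_conj, ?re_RtoC, ?im_RtoC; ring. }
assert (CA : ccont A 1%C).
{ apply ccont_mult.
  - apply ccont_conj, ccont_minus; [apply ccont_const|apply ccont_scal].
  - apply ccont_minus; [apply ccont_const|apply ccont_conj, ccont_id]. }
assert (CK : ccont K nu) by (apply ccont_div; [apply ccont_const|apply ccont_id|easy]).
set (r := Re (cis phi / nu)%C * k); assert (Rp : 0 < r) by (unfold r; nra).
set (M := Cmod (A 1%C) + Cmod (K nu) + 2).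
assert (M1 := Cmod_ge_0 (A 1%C)); assert (M2 := Cmod_ge_0 (K nu)).
set (e := Rmin 1 (r / (2 * M))).
assert (E1 : 0 < e) by (apply Rmin_pos; [lra|apply Rdiv_lt_0_compat; unfold M; lra]).
assert (E2 : e <= 1) by apply Rmin_l.
assert (E3 : e * (2 * M) <= r) by (apply Rle_div_r; [unfold M; lra|apply Rmin_r]).
destruct (CA e E1) as [d1 [Hd1 D1]]; destruct (CK e E1) as [d2 [Hd2 D2]].
destruct (Q_ray (cos phi) d2 Hphi Hd2) as [t0 [Ht0 T]].
set (t := Rmin (d1 / 2) (t0 / 2)).
assert (T1 : 0 < t) by (apply Rmin_pos; lra).
assert (T2 : t <= d1 / 2) by apply Rmin_l; assert (T3 : t <= t0 / 2) by apply Rmin_r.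
destruct (T t phi) as [U [HN Q]]; [lra|lra|].
set (z := ray t phi) in *.
specialize (D1 z); unfold z in D1 at 1; rewrite ray_minus_1 in D1 by lra; specialize (D1 ltac:(lra)).
specialize (D2 _ Q).
specialize (BP z U); fold (A z) in BP.
assert (DN := injective_derivative_neq_0 H dH H_diff H_inj z U).
assert (Zt : (z - 1)%C = (- (RtoC t * cis phi))%C) by (unfold z, ray; ring).
assert (Z1 : (z - 1)%C <> 0%C) by (apply Cmod_gt_0; unfold z; rewrite ray_minus_1; lra).
set (q := ((z - 1) * dH z / H z)%C) in *.
assert (E : (H z / dH z * A z)%C = (- (RtoC t * (K q * A z)))%C).
{ replace (- (RtoC t * (K q * A z)))%C with ((- (RtoC t * cis phi)) / q * A z)%C by (unfold K, Cdiv; ring).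
  rewrite <- Zt; unfold q; field; auto. }
rewrite E, re_opp, re_scal_l in BP.
assert (B0 : 0 <= Re (K q * A z)%C) by nra.
replace (K q * A z)%C with ((K q - K nu) * (A z - A 1%C) + (K q - K nu) * A 1%C + K nu * (A z - A 1%C) + K nu * A 1%C)%C in B0 by ring.
rewrite !re_plus in B0.
assert (B4 : Re (K nu * A 1%C)%C = - r).
{ rewrite A1, re_scal_r; unfold r, K; ring. }
assert (B1 := re_le_Cmod ((K q - K nu) * (A z - A 1%C))%C); rewrite Cmod_mult in B1; apply Rabs_le_between in B1.
assert (B2 := re_le_Cmod ((K q - K nu) * A 1%C)%C); rewrite Cmod_mult in B2; apply Rabs_le_between in B2.
assert (B3 := re_le_Cmod (K nu * (A z - A 1%C))%C); rewrite Cmod_mult in B3; apply Rabs_le_between in B3.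
assert (C1 : Cmod (K q - K nu) * Cmod (A z - A 1%C) <= e * 1) by (apply Rmult_le_compat; try apply Cmod_ge_0; lra).
assert (C2 : Cmod (K q - K nu) * Cmod (A 1%C) <= e * Cmod (A 1%C)) by (apply Rmult_le_compat_r; lra).
assert (C3 : Cmod (K nu) * Cmod (A z - A 1%C) <= Cmod (K nu) * e) by (apply Rmult_le_compat_l; lra).
unfold M in E3; nra.
Qed.

(** The half-planes [Re (cis phi * w) <= 0] with [|phi| < PI / 2] meet only in
    the nonpositive real axis; the angles [atan k] suffice to see it. *)
Lemma nu_negative (p : C) : p <> 1%C ->
  (forall z, Cmod z < 1 -> Re (H z / dH z * (Cconj (1 - Cconj p * z) * (Cconj p - Cconj z)))%C <= 0) ->
  exists n, 0 < n /\ nu = RtoC (- n).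
Proof.
intros Np BP.
assert (D : forall phi, 0 < cos phi -> Re (cis phi / nu)%C <= 0) by (intros; now apply (direction_bound p)).
set (w := (/ nu)%C).
assert (D' : forall k, Re w - k * Im w <= 0).
{ intros k; assert (B := atan_bound k).
  assert (Ck : 0 < cos (atan k)) by (apply cos_gt_0; lra).
  assert (E := D (atan k) Ck); unfold Cdiv in E; fold w in E; rewrite re_mult in E.
  change (cos (atan k) * Re w - sin (atan k) * Im w <= 0) in E.
  assert (S : sin (atan k) = k * cos (atan k)).
  { rewrite <- (tan_atan k) at 2; unfold tan; field; lra. }
  rewrite S in E; apply Rmult_le_reg_l with (cos (atan k)); [easy|lra]. }
assert (I : Im w = 0).
{ destruct (Req_dec (Im w) 0) as [|N]; [easy|].
  specialize (D' ((Re w - 1) / Im w)); replace ((Re w - 1) / Im w * Im w) with (Re w - 1) in D' by (field; easy); lra. }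
assert (W : w = RtoC (Re w)) by (apply C_ext; [now rewrite re_RtoC|now rewrite im_RtoC]).
assert (Nw : w <> 0%C) by now apply Cinv_neq_0.
assert (Rw : Re w < 0).
{ specialize (D' 0); destruct (Req_dec (Re w) 0) as [E|N]; [rewrite E in W; easy|lra]. }
exists (- / Re w); split; [apply Ropp_0_gt_lt_contravar, Rinv_lt_0_compat; lra|].
replace nu with (/ w)%C by (unfold w; field; easy).
rewrite W at 1; rewrite Ropp_involutive, RtoC_inv by lra; easy.
Qed.

(** The map [(1 + z) / (1 - z)] takes the disk to the right half-plane; this
    is the curve corresponding to the horizontal half-line from [y0]. *)
Definition half_plane_line (y0 : C) (x : R) : C := ((y0 + RtoC x - 1) / (y0 + RtoC x + 1))%C.

Section Horizontal.

Variable y0 : C.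
Hypothesis y0_pos : 0 <= Re y0.

Lemma half_plane_line_den (x : R) : 0 <= x -> (y0 + RtoC x + 1)%C <> 0%C.
Proof.
intros Hx E; assert (F := f_equal Re E); rewrite !re_plus, !re_RtoC in F; lra.
Qed.

Lemma half_plane_line_Cmod (x : R) : 0 <= x -> 1 - Cmod (half_plane_line y0 x) * Cmod (half_plane_line y0 x) =
   4 * (Re y0 + x) / (Cmod (y0 + RtoC x + 1)%C * Cmod (y0 + RtoC x + 1)%C).
Proof.
intros Hx; assert (N := half_plane_line_den x Hx); assert (P := proj1 (Cmod_gt_0 _) N).
assert (E : Cmod (half_plane_line y0 x) = Cmod (y0 + RtoC x - 1) / Cmod (y0 + RtoC x + 1)) by (unfold half_plane_line; now rewrite Cmod_div).
rewrite E.
replace (1 - Cmod (y0 + RtoC x - 1) / Cmod (y0 + RtoC x + 1) * (Cmod (y0 + RtoC x - 1) / Cmod (y0 + RtoC x + 1)))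
 with ((Cmod (y0 + RtoC x + 1) * Cmod (y0 + RtoC x + 1) - Cmod (y0 + RtoC x - 1) * Cmod (y0 + RtoC x - 1)) / (Cmod (y0 + RtoC x + 1) * Cmod (y0 + RtoC x + 1))) by (field; lra).
f_equal; rewrite !Cmod_sqr, !re_minus, !im_minus, !re_plus, !im_plus, !re_RtoC, !im_RtoC; ring.
Qed.

Lemma half_plane_line_disk (x : R) : 0 < x -> Cmod (half_plane_line y0 x) < 1.
Proof.
intros Hx; assert (E := half_plane_line_Cmod x ltac:(lra)).
assert (P := proj1 (Cmod_gt_0 _) (half_plane_line_den x ltac:(lra))).
assert (0 < 4 * (Re y0 + x) / (Cmod (y0 + RtoC x + 1)%C * Cmod (y0 + RtoC x + 1)%C)).
{ apply Rdiv_lt_0_compat; [lra|nra]. }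
generalize (Cmod_ge_0 (half_plane_line y0 x)); nra.
Qed.

Lemma half_plane_line_minus (x : R) : 0 <= x -> (half_plane_line y0 x - half_plane_line y0 0)%C = (RtoC (2 * x) / ((y0 + RtoC x + 1) * (y0 + RtoC 0 + 1)))%C.
Proof.
intros Hx; assert (N := half_plane_line_den x Hx); assert (N0 := half_plane_line_den 0 (Rle_refl 0)).
unfold half_plane_line; rewrite RtoC_mult; field; rewrite Cplus_0_r in N0; auto.
Qed.

Lemma half_plane_line_curve (x : R) : 0 <= x -> curve_diff (half_plane_line y0) x ((1 - half_plane_line y0 x) * (1 - half_plane_line y0 x) / 2)%C.
Proof.
intros Hx; assert (N := half_plane_line_den x Hx).
assert (D : curve_diff (fun s => y0 + RtoC s * 1)%C x 1%C) by apply curve_diff_segment.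
set (m := fun y : C => ((y - 1) / (y + 1))%C).
assert (E : forall s, half_plane_line y0 s = m (y0 + RtoC s * 1)%C) by (intros s; unfold half_plane_line, m; now rewrite Cmult_1_r).
assert (Dm : cdiff m (y0 + RtoC x * 1)%C (2 / ((y0 + RtoC x + 1) * (y0 + RtoC x + 1)))%C).
{ eapply cdiff_eq.
  - apply cdiff_mult.
    + apply cdiff_minus; [apply cdiff_id|apply cdiff_const].
    + apply cdiff_inv; [apply cdiff_plus; [apply cdiff_id|apply cdiff_const]|now rewrite Cmult_1_r].
  - cbv beta; rewrite Cmult_1_r; field; easy. }
assert (Dc := curve_diff_comp _ _ _ _ _ D Dm).
intros eps He; destruct (Dc eps He) as [d [Hd K]]; exists d; split; [easy|]; intros s Hs.
rewrite !E; eapply Rle_trans; [|apply (K s Hs)]; right; f_equal.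
rewrite <- (E x); unfold half_plane_line; rewrite <- !E; field; easy.
Qed.

(** For [p = 1] the Berkson-Porta inequality says that [|H|] decreases along
    these curves, so [H] would vanish on the whole curve. *)
Lemma no_limit_zero :
  (forall z, Cmod z < 1 -> Re (H z / dH z * (Cconj (1 - Cconj 1 * z) * (Cconj 1 - Cconj z)))%C <= 0) ->
  (forall eps, 0 < eps -> exists x0, 0 < x0 /\ forall x, 0 < x < x0 -> Cmod (H (half_plane_line y0 x)) < eps) -> False.
Proof.
intros BP L.
assert (Mono : forall a b, 0 < a <= b -> Cmod (H (half_plane_line y0 b)) * Cmod (H (half_plane_line y0 b)) <= Cmod (H (half_plane_line y0 a)) * Cmod (H (half_plane_line y0 a))).
{ intros a b Hab.
  set (v := fun x => (dH (half_plane_line y0 x) * ((1 - half_plane_line y0 x) * (1 - half_plane_line y0 x) / 2))%C).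
  cut (- (Cmod (H (half_plane_line y0 a)) * Cmod (H (half_plane_line y0 a))) <= - (Cmod (H (half_plane_line y0 b)) * Cmod (H (half_plane_line y0 b)))); [lra|].
  apply (increasing_of_derive (fun x => - (Cmod (H (half_plane_line y0 x)) * Cmod (H (half_plane_line y0 x)))) (fun x => - (2 * Re (Cconj (H (half_plane_line y0 x)) * v x)%C))); [lra| |].
  - intros x Hx; apply (is_derive_opp (fun x => Cmod (H (half_plane_line y0 x)) * Cmod (H (half_plane_line y0 x)))).
    apply (is_derive_Cmod2 (fun x => H (half_plane_line y0 x))), (curve_diff_comp (half_plane_line y0) H); [apply half_plane_line_curve; lra|].
    apply H_diff, half_plane_line_disk; lra.
  - intros x Hx; set (z := half_plane_line y0 x); assert (U : Cmod z < 1) by (apply half_plane_line_disk; lra).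
    assert (B := BP z U); assert (N := injective_derivative_neq_0 H dH H_diff H_inj z U).
    assert (P : 0 < Cmod (dH z) * Cmod (dH z)) by (apply Rmult_lt_0_compat; now apply Cmod_gt_0).
    unfold v; fold z.
    replace (2 * Re (Cconj (H z) * (dH z * ((1 - z) * (1 - z) / 2)))%C)
      with ((Cmod (dH z) * Cmod (dH z)) * Re (H z / dH z * (Cconj (1 - Cconj 1 * z) * (Cconj 1 - Cconj z)))%C); [nra|].
    rewrite <- re_scal_l.
    replace (RtoC (Cmod (dH z) * Cmod (dH z))) with (dH z * Cconj (dH z))%C.
    2:{ apply C_ext; rewrite ?re_RtoC, ?im_RtoC, ?Cmod_sqr, ?re_mult, ?im_mult, ?re_conj, ?im_conj; ring. }
    replace (dH z * Cconj (dH z) * (H z / dH z * (Cconj (1 - Cconj 1 * z) * (Cconj 1 - Cconj z))))%C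
     with (Cconj (dH z) * H z * (Cconj (1 - Cconj 1 * z) * (Cconj 1 - Cconj z)))%C by (field; easy).
    replace (Cconj (RtoC 1)) with (RtoC 1) by (apply C_ext; simpl; ring).
    replace (Cconj (H z) * (dH z * ((1 - z) * (1 - z) / 2)))%C with (RtoC (/ 2) * (Cconj (H z) * dH z * ((1 - z) * (1 - z))))%C
     by (rewrite RtoC_inv by lra; field; intros E; apply RtoC_inj in E; lra).
    rewrite re_scal_l, !re_mult, !im_mult, !re_conj, !im_conj, !re_minus, !im_minus, !re_mult, !im_mult, !re_RtoC, !im_RtoC, !re_conj, !im_conj; field. }
assert (Z : forall b, 0 < b -> H (half_plane_line y0 b) = 0%C).
{ intros b Hb; apply Cmod_eq_0; apply NNPP; intros N.
  assert (P : 0 < Cmod (H (half_plane_line y0 b))) by (generalize (Cmod_ge_0 (H (half_plane_line y0 b))); lra).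
  destruct (L _ P) as [x0 [Hx0 K]].
  set (a := Rmin (x0 / 2) b); assert (A0 : 0 < a) by (apply Rmin_pos; lra).
  assert (A1 : a <= x0 / 2) by apply Rmin_l; assert (A2 : a <= b) by apply Rmin_r.
  assert (Q := Mono a b ltac:(lra)); specialize (K a ltac:(lra)); generalize (Cmod_ge_0 (H (half_plane_line y0 a))); nra. }
assert (E : half_plane_line y0 1 = half_plane_line y0 2).
{ apply H_inj; try (apply half_plane_line_disk; lra); rewrite !Z; auto; lra. }
assert (N1 := half_plane_line_den 1 ltac:(lra)); assert (N2 := half_plane_line_den 2 ltac:(lra)).
assert (F : (half_plane_line y0 2 - half_plane_line y0 1)%C = (2 / ((y0 + RtoC 1 + 1) * (y0 + RtoC 2 + 1)))%C) by (unfold half_plane_line; field; auto).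
rewrite E, Cminus_diag in F.
assert (G : (2 / ((y0 + RtoC 1 + 1) * (y0 + RtoC 2 + 1)))%C <> 0%C).
{ apply Cmult_neq_0; [intros X; apply RtoC_inj in X; lra|apply Cinv_neq_0, Cmult_neq_0; auto]. }
auto.
Qed.

End Horizontal.

Variable sigma : C.
Hypothesis sigma_le : Cmod sigma <= 1.
Hypothesis sigma_neq : sigma <> 1%C.
Hypothesis sigma_in : Cmod sigma < 1 -> H sigma = 0%C.
Hypothesis sigma_bd : Cmod sigma = 1 -> forall M eps, 1 < M -> 0 < eps -> exists d, 0 < d /\ forall z,
  Cmod (z - sigma)%C < d -> Cmod (z - sigma)%C < M * (1 - Cmod z) -> Cmod (H z) < eps.

(** The curve from [sigma] to 1 excludes that the Berkson-Porta point is 1. *)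
Lemma nu_real_negative : exists n, 0 < n /\ nu = RtoC (- n).
Proof.
destruct (berkson_porta H dH H_diff H_inj H_star) as [p [Hp BP]].
destruct (Ceq_dec p 1%C) as [->|Np]; [exfalso|now apply (nu_negative p)].
set (y0 := ((1 + sigma) / (1 - sigma))%C).
assert (N : (1 - sigma)%C <> 0%C) by (apply Cminus_neq_0; auto).
assert (P := proj1 (Cmod_gt_0 _) N).
assert (Y : 0 <= Re y0).
{ assert (E := re_cayley sigma N); fold y0 in E.
  assert (0 <= 1 - Cmod sigma * Cmod sigma) by (generalize (Cmod_ge_0 sigma); nra).
  apply Rnot_lt_le; intros L; assert (0 < Cmod (1 - sigma) * Cmod (1 - sigma)) by nra; nra. }
apply (no_limit_zero y0 Y BP).
assert (H0 : half_plane_line y0 0 = sigma).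
{ unfold half_plane_line, y0; field; split; [easy|]; intros E.
  assert (E' : (2 : C) = 0%C) by (rewrite <- E; ring); apply RtoC_inj in E'; lra. }
assert (Cont : forall d, 0 < d -> exists x0, 0 < x0 /\ forall x, 0 < x < x0 -> Cmod (half_plane_line y0 x - sigma)%C < d).
{ intros d Hd; destruct (curve_diff_cont _ _ _ (half_plane_line_curve y0 Y 0 (Rle_refl 0)) d Hd) as [x0 [Hx0 K]].
  exists x0; split; [easy|]; intros x Hx.
  assert (Q := K x ltac:(rewrite Rminus_0_r, Rabs_pos_eq; lra)); now rewrite H0 in Q. }
intros eps He; destruct (Rle_lt_or_eq_dec _ _ sigma_le) as [S|S].
- destruct (cdiff_ccont _ _ _ (H_diff sigma S) eps He) as [d [Hd D]].
  destruct (Cont d Hd) as [x0 [Hx0 K]]; exists x0; split; [easy|]; intros x Hx.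
  specialize (D (half_plane_line y0 x) (K x Hx)); rewrite (sigma_in S) in D.
  replace (H (half_plane_line y0 x) - 0)%C with (H (half_plane_line y0 x)) in D by ring; exact D.
- (* The curve leaves [sigma] orthogonally to the circle, hence inside a Stolz region. *)
  destruct (sigma_bd S 4 eps ltac:(lra) He) as [d [Hd D]].
  destruct (Cont d Hd) as [x0 [Hx0 K]]; exists (Rmin x0 1); split; [apply Rmin_pos; lra|]; intros x Hx.
  assert (X1 : x < x0) by (generalize (Rmin_l x0 1); lra).
  assert (X2 : x < 1) by (generalize (Rmin_r x0 1); lra).
  apply (D (half_plane_line y0 x)); [apply K; lra|].
  assert (E1 := half_plane_line_minus y0 Y x ltac:(lra)); rewrite H0 in E1.
  assert (N1 := half_plane_line_den y0 Y x ltac:(lra)); assert (N0 := half_plane_line_den y0 Y 0 ltac:(lra)).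
  assert (P1 := proj1 (Cmod_gt_0 _) N1); assert (P0 := proj1 (Cmod_gt_0 _) N0).
  assert (E2 := half_plane_line_Cmod y0 Y x ltac:(lra)).
  assert (U := half_plane_line_disk y0 Y x ltac:(lra)).
  rewrite E1, Cmod_div, Cmod_mult, Cmod_R, Rabs_pos_eq by (lra || now apply Cmult_neq_0).
  set (A := Cmod (y0 + RtoC x + 1)) in *; set (B := Cmod (y0 + RtoC 0 + 1)) in *.
  assert (AB : A < 2 * B).
  { assert (B1 : 1 <= B).
    { unfold B; eapply Rle_trans; [|apply re_le_Cmod]; rewrite !re_plus, !re_RtoC, Rabs_pos_eq; lra. }
    assert (A <= B + x); [|lra].
    unfold A, B; replace (y0 + RtoC x + 1)%C with ((y0 + RtoC 0 + 1) + RtoC x)%C by ring.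
    eapply Rle_trans; [apply Cmod_triangle|]; rewrite (Cmod_R x), Rabs_pos_eq; lra. }
  assert (G : 4 * x / (A * A) <= 1 - Cmod (half_plane_line y0 x) * Cmod (half_plane_line y0 x)).
  { rewrite E2; unfold Rdiv; apply Rmult_le_compat_r; [left; apply Rinv_0_lt_compat; nra|lra]. }
  assert (G2 : 2 * x / (A * A) <= 1 - Cmod (half_plane_line y0 x)).
  { replace (2 * x / (A * A)) with (4 * x / (A * A) / 2) by (field; lra); generalize (Cmod_ge_0 (half_plane_line y0 x)); nra. }
  apply Rlt_le_trans with (4 * (2 * x / (A * A))); [|lra].
  apply Rmult_lt_reg_r with (A * A * B); [repeat apply Rmult_lt_0_compat; lra|].
  replace (2 * x / (A * B) * (A * A * B)) with (2 * x * A) by (field; lra).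
  replace (4 * (2 * x / (A * A)) * (A * A * B)) with (2 * x * (4 * B)) by (field; lra).
  apply Rmult_lt_compat_l; lra.
Qed.

End Negative.

(** * Growth along the radius and the wedge *)

Lemma curve_diff_ext (f g : R -> C) t v : (forall s, f s = g s) -> curve_diff f t v -> curve_diff g t v.
Proof.
intros E D eps He; destruct (D eps He) as [d [Hd K]]; exists d; split; [easy|]; intros s Hs; rewrite <- !E; auto.
Qed.

Lemma curve_diff_mult (f g : R -> C) t v w : curve_diff f t v -> curve_diff g t w ->
  curve_diff (fun s => f s * g s)%C t (v * g t + f t * w)%C.
Proof.
intros F G.
assert (F1 := curve_diff_re _ _ _ F); assert (F2 := curve_diff_im _ _ _ F).
assert (G1 := curve_diff_re _ _ _ G); assert (G2 := curve_diff_im _ _ _ G).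
apply curve_diff_parts.
- apply (is_derive_ext (fun s => Re (f s) * Re (g s) - Im (f s) * Im (g s))); [intros; now rewrite re_mult|].
  replace (Re (v * g t + f t * w)%C) with ((Re v * Re (g t) + Re (f t) * Re w) - (Im v * Im (g t) + Im (f t) * Im w))
   by (rewrite re_plus, !re_mult; ring).
  apply (is_derive_minus (fun s => Re (f s) * Re (g s)) (fun s => Im (f s) * Im (g s))).
  + apply (is_derive_mult (fun s => Re (f s)) (fun s => Re (g s))); try easy; intros; apply Rmult_comm.
  + apply (is_derive_mult (fun s => Im (f s)) (fun s => Im (g s))); try easy; intros; apply Rmult_comm.
- apply (is_derive_ext (fun s => Re (f s) * Im (g s) + Im (f s) * Re (g s))); [intros; now rewrite im_mult|].
  replace (Im (v * g t + f t * w)%C) with ((Re v * Im (g t) + Re (f t) * Im w) + (Im v * Re (g t) + Im (f t) * Re w))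
   by (rewrite im_plus, !im_mult; ring).
  apply (is_derive_plus (fun s => Re (f s) * Im (g s)) (fun s => Im (f s) * Re (g s))).
  + apply (is_derive_mult (fun s => Re (f s)) (fun s => Im (g s))); try easy; intros; apply Rmult_comm.
  + apply (is_derive_mult (fun s => Im (f s)) (fun s => Re (g s))); try easy; intros; apply Rmult_comm.
Qed.

Lemma curve_diff_cis_scal (k t : R) : curve_diff (fun s => cis (k * s)) t (Ci * RtoC k * cis (k * t))%C.
Proof.
apply curve_diff_parts; unfold cis; simpl; auto_derive; try easy; ring.
Qed.

Lemma curve_diff_const (c : C) (t : R) : curve_diff (fun _ => c) t 0%C.
Proof.
intros eps He; exists 1; split; [lra|]; intros s _.
replace (c - c - RtoC (s - t) * 0)%C with (RtoC 0) by ring; rewrite Cmod_0; generalize (Rabs_pos (s - t)); nra.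
Qed.

Lemma cis_0 : cis 0 = 1%C.
Proof. unfold cis; now rewrite cos_0, sin_0. Qed.

(** Gronwall's argument: [|g| <= 2] on the whole interval, which bounds the
    derivative by [2 d]. *)
Lemma near_one_of_log_derivative (g k : R -> C) (d : R) : 0 <= d <= 1 / 2 -> g 0 = 1%C ->
  (forall s, 0 <= s <= 1 -> curve_diff g s (k s * g s)%C) ->
  (forall s, 0 <= s <= 1 -> Cmod (k s) <= d) -> Cmod (g 1 - 1)%C <= 2 * d.
Proof.
intros Hd G0 Gd Kd.
assert (B : forall s, 0 <= s <= 1 -> Cmod (g s) <= 2).
{ intros s Hs.
  assert (I : - (Cmod (g 0) * Cmod (g 0)) * exp (- (2 * d) * 0) <= - (Cmod (g s) * Cmod (g s)) * exp (- (2 * d) * s)).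
  { apply (increasing_of_derive (fun x => - (Cmod (g x) * Cmod (g x)) * exp (- (2 * d) * x))
     (fun x => - (2 * Re (Cconj (g x) * (k x * g x))%C) * exp (- (2 * d) * x) + - (Cmod (g x) * Cmod (g x)) * (- (2 * d) * exp (- (2 * d) * x)))); [lra| |].
    - intros x Hx; apply (is_derive_mult (fun x => - (Cmod (g x) * Cmod (g x))) (fun x => exp (- (2 * d) * x))); [| |intros; apply Rmult_comm].
      + apply (is_derive_opp (fun x => Cmod (g x) * Cmod (g x))), is_derive_Cmod2, Gd; lra.
      + auto_derive; [easy|ring].
    - intros x Hx.
      assert (T := re_le_Cmod (Cconj (g x) * (k x * g x))%C); rewrite !Cmod_mult, Cmod_conj in T; apply Rabs_le_between in T.
      assert (Kx := Kd x ltac:(lra)); assert (E := exp_pos (- (2 * d) * x)).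
      assert (S : Cmod (g x) * (Cmod (k x) * Cmod (g x)) <= d * (Cmod (g x) * Cmod (g x))).
      { replace (Cmod (g x) * (Cmod (k x) * Cmod (g x))) with (Cmod (k x) * (Cmod (g x) * Cmod (g x))) by ring.
        apply Rmult_le_compat_r; [|easy]; generalize (Cmod_ge_0 (g x)); nra. }
      nra. }
  rewrite G0, Cmod_1, Rmult_0_r, exp_0 in I.
  assert (E : exp (- (2 * d) * s) * 3 >= 1).
  { apply Rle_ge; rewrite <- exp_0; replace 0 with (- (2 * d) * s + (2 * d) * s) at 1 by ring; rewrite exp_plus.
    apply Rmult_le_compat_l; [left; apply exp_pos|]; apply Rle_trans with (exp 1); [|apply exp_le_3].
    destruct (Req_dec (2 * d * s) 1) as [->|N]; [lra|left; apply exp_increasing; nra]. }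
  assert (P := exp_pos (- (2 * d) * s)); set (e := exp (- (2 * d) * s)) in *.
  assert (M := Cmod_ge_0 (g s)); apply Rnot_lt_le; intros L.
  assert (4 < Cmod (g s) * Cmod (g s)) by nra.
  nra. }
destruct (exists_phase (g 1 - 1)%C) as [u [U1 U2]].
assert (I : 2 * d * 0 - Re (u * (g 0 - 1))%C <= 2 * d * 1 - Re (u * (g 1 - 1))%C).
{ apply (increasing_of_derive (fun s => 2 * d * s - Re (u * (g s - 1))%C) (fun s => 2 * d - Re (u * (k s * g s))%C)); [lra| |].
  - intros x Hx; apply (is_derive_minus (fun s => 2 * d * s) (fun s => Re (u * (g s - 1))%C)).
    + auto_derive; [easy|ring].
    + apply (curve_diff_re (fun s => (u * (g s - 1))%C)).
      apply (curve_diff_comp g (fun z => u * (z - 1))%C x (k x * g x)%C u); [now apply Gd|].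
      eapply cdiff_eq; [apply cdiff_mult; [apply cdiff_const|apply cdiff_minus; [apply cdiff_id|apply cdiff_const]]|cbv beta; ring].
  - intros x Hx; assert (T := re_le_Cmod (u * (k x * g x))%C); rewrite !Cmod_mult, U1 in T; apply Rabs_le_between in T.
    assert (Cmod (k x) * Cmod (g x) <= d * 2) by (apply Rmult_le_compat; try apply Cmod_ge_0; auto).
    lra. }
rewrite U2, re_RtoC, G0, Cminus_diag, Cmult_0_r, re_RtoC in I; lra.
Qed.

Lemma increasing_of_derive_ex (f : R -> R) (a b : R) : a <= b ->
  (forall x, a <= x <= b -> exists d, is_derive f x d /\ 0 <= d) -> f a <= f b.
Proof.
intros L D; apply (increasing_of_derive f (Derive f)); [easy| |]; intros x Hx; destruct (D x Hx) as [d [D1 D2]].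
- apply Derive_correct; now exists d.
- apply is_derive_unique in D1; rewrite D1; easy.
Qed.

Lemma cos_ge_of_abs (a x : R) : Rabs x <= a <= PI -> cos a <= cos x.
Proof.
intros Hx; replace (cos x) with (cos (Rabs x)).
- apply cos_decr_1; generalize (Rabs_pos x); lra.
- unfold Rabs; destruct Rcase_abs; [apply cos_neg|easy].
Qed.

Section Growth.

Variables H dH : C -> C.
Variable n : R.
Hypothesis n_pos : 0 < n.
Hypothesis H_diff : forall z, Cmod z < 1 -> cdiff H z (dH z).
Hypothesis H_star : forall z s, Cmod z < 1 -> 0 < s <= 1 -> disk_image H (RtoC s * H z)%C.
Hypothesis H_ray : forall c eps, 0 < c -> 0 < eps -> exists t0, 0 < t0 /\ forall t phi,
  0 < t < t0 -> c <= cos phi -> Cmod (ray t phi) < 1 /\ H (ray t phi) <> 0%C /\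
  Cmod ((ray t phi - 1) * dH (ray t phi) / H (ray t phi) - RtoC (- n))%C < eps.

Let Hr (t : R) : C := H (ray t 0).

(** Here [q] is the real part of [(z - 1) H' / H] at [ray t 0]. *)
Lemma log_derivative (d : R) : 0 < d -> exists t1, 0 < t1 /\ forall t, 0 < t < t1 ->
  Hr t <> 0%C /\ exists q, Rabs (q + n) < d /\ is_derive (fun t => ln (Cmod (Hr t) * Cmod (Hr t))) t (2 * q / t).
Proof.
intros Hd; destruct (H_ray 1 d Rlt_0_1 Hd) as [t1 [Ht1 K]]; exists t1; split; [easy|]; intros t Ht.
destruct (K t 0 Ht ltac:(rewrite cos_0; lra)) as [U [N Q]]; split; [easy|].
set (z := ray t 0) in *.
exists (Re ((z - 1) * dH z / H z)%C); split.
- eapply Rle_lt_trans; [|apply Q]; eapply Rle_trans; [|apply re_le_Cmod].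
  rewrite re_minus, re_RtoC; right; f_equal; ring.
- assert (P := proj1 (Cmod_gt_0 _) N).
  assert (D : curve_diff Hr t (dH z * - cis 0)%C).
  { apply (curve_diff_comp (fun t => ray t 0) H).
    - apply (curve_diff_ext (fun t => 1 + RtoC t * - cis 0)%C); [intros s; unfold ray; ring|apply curve_diff_segment].
    - now apply H_diff. }
  assert (D2 := is_derive_Cmod2 Hr t _ D).
  assert (P2 : 0 < Cmod (Hr t) * Cmod (Hr t)) by (unfold Hr; fold z; nra).
  assert (D3 := is_derive_comp ln (fun t => Cmod (Hr t) * Cmod (Hr t)) t _ _ (is_derive_ln _ P2) D2).
  evar_last; [exact D3|].
  change (2 * Re (Cconj (Hr t) * (dH z * - cis 0))%C * / (Cmod (Hr t) * Cmod (Hr t)) = 2 * Re ((z - 1) * dH z / H z)%C / t).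
  replace (Re ((z - 1) * dH z / H z)%C) with (t * Re (dH z * - cis 0 / H z)%C).
  2:{ rewrite <- re_scal_l; f_equal; unfold z at 3; unfold ray; unfold Cdiv; ring. }
  replace (dH z * - cis 0 / H z)%C with (RtoC (/ (Cmod (Hr t) * Cmod (Hr t))) * (Cconj (Hr t) * (dH z * - cis 0)))%C.
  + rewrite re_scal_l; field; split; [unfold Hr; fold z; lra|lra].
  + rewrite RtoC_inv by lra.
    replace (RtoC (Cmod (Hr t) * Cmod (Hr t))) with (Hr t * Cconj (Hr t))%C.
    * assert (Hr t = H z) by easy; assert (Cconj (H z) <> 0%C) by (apply Cmod_gt_0; now rewrite Cmod_conj).
      rewrite H0; field; auto.
    * apply C_ext; rewrite ?re_RtoC, ?im_RtoC, ?Cmod_sqr, ?re_mult, ?im_mult, ?re_conj, ?im_conj; ring.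
Qed.

(** [ln (|H|^2) + 2 (n + d) ln t] increases with [t], and
    [ln (|H|^2) + 2 (n - d) ln t] decreases. *)
Lemma radial_growth (d : R) : 0 < d -> exists t1 K, 0 < t1 /\ forall t, 0 < t < t1 -> Hr t <> 0%C /\
  - K - (n - d) * ln t <= ln (Cmod (Hr t)) <= K - (n + d) * ln t.
Proof.
intros Hd; destruct (log_derivative d Hd) as [t2 [Ht2 D]].
set (t1 := t2 / 2).
set (f := fun t => ln (Cmod (Hr t) * Cmod (Hr t))).
assert (Ef : forall t, 0 < t < t2 -> f t = 2 * ln (Cmod (Hr t))).
{ intros t Ht; destruct (D t Ht) as [N _]; apply Cmod_gt_0 in N; unfold f; rewrite ln_mult by easy; ring. }
set (K := Rabs (f t1 + 2 * (n + d) * ln t1) + Rabs (f t1 + 2 * (n - d) * ln t1)).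
exists t1, K; split; [unfold t1; lra|]; intros t Ht; split; [apply D; unfold t1 in *; lra|].
assert (A : f t + 2 * (n + d) * ln t <= f t1 + 2 * (n + d) * ln t1).
{ apply (increasing_of_derive_ex (fun t => f t + 2 * (n + d) * ln t)); [lra|]; intros x Hx.
  destruct (D x) as [_ [q [Q Dq]]]; [unfold t1 in *; lra|]; apply Rabs_def2 in Q.
  exists (2 * q / x + 2 * (n + d) * / x); split.
  - apply (is_derive_plus (V := R_NormedModule) f); [exact Dq|auto_derive; [lra|ring]].
  - replace (2 * q / x + 2 * (n + d) * / x) with (2 * (q + n + d) * / x) by (field; lra).
    apply Rmult_le_pos; [lra|left; apply Rinv_0_lt_compat; lra]. }
assert (B : f t1 + 2 * (n - d) * ln t1 <= f t + 2 * (n - d) * ln t).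
{ apply Ropp_le_cancel, (increasing_of_derive_ex (fun t => - (f t + 2 * (n - d) * ln t))); [lra|]; intros x Hx.
  destruct (D x) as [_ [q [Q Dq]]]; [unfold t1 in *; lra|]; apply Rabs_def2 in Q.
  exists (- (2 * q / x + 2 * (n - d) * / x)); split.
  - apply (is_derive_opp (V := R_NormedModule) (fun t => f t + 2 * (n - d) * ln t)).
    apply (is_derive_plus (V := R_NormedModule) f); [exact Dq|auto_derive; [lra|ring]].
  - replace (- (2 * q / x + 2 * (n - d) * / x)) with (2 * - (q + n - d) * / x) by (field; lra).
    apply Rmult_le_pos; [lra|left; apply Rinv_0_lt_compat; lra]. }
rewrite Ef in A at 1 by (unfold t1 in *; lra); rewrite (Ef t) in B by (unfold t1 in *; lra).
assert (T1 := Rle_abs (f t1 + 2 * (n + d) * ln t1)); assert (T2 := Rabs_pos (f t1 + 2 * (n + d) * ln t1)).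
assert (T3 := Rle_abs (- (f t1 + 2 * (n - d) * ln t1))); assert (T4 := Rabs_pos (f t1 + 2 * (n - d) * ln t1)).
rewrite Rabs_Ropp in T3; unfold K; lra.
Qed.

Lemma blow_up (B : R) : exists t1, 0 < t1 /\ forall t, 0 < t < t1 -> B <= Cmod (Hr t).
Proof.
destruct (radial_growth (n / 2)) as [t1 [K [Ht1 G]]]; [lra|].
set (b := - (2 / n) * (K + B)).
exists (Rmin t1 (exp b)); split; [apply Rmin_pos; [easy|apply exp_pos]|]; intros t Ht.
assert (H1 : t < t1) by (generalize (Rmin_l t1 (exp b)); lra).
assert (H2 : t < exp b) by (generalize (Rmin_r t1 (exp b)); lra).
destruct (G t) as [N [L _]]; [lra|].
apply Cmod_gt_0 in N.
assert (lt : ln t < b) by (rewrite <- (ln_exp b); apply ln_increasing; lra).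
assert (B <= ln (Cmod (Hr t))).
{ assert (n / 2 * ln t <= n / 2 * b) by (apply Rmult_le_compat_l; lra).
  replace (n / 2 * b) with (- (K + B)) in H0 by (unfold b; field; lra); lra. }
assert (E := exp_ineq1_le (ln (Cmod (Hr t)))); rewrite exp_ln in E by easy; lra.
Qed.

(** As a function of [phi], [H (ray t phi) cis (n phi)] has the logarithmic
    derivative [i ((z - 1) H' / H + n)], which is small. *)
Lemma values_on_arc (phi0 eps : R) : 0 <= phi0 < PI / 2 -> 0 < eps -> exists t0, 0 < t0 /\ forall t phi,
  0 < t < t0 -> Rabs phi <= phi0 -> Hr t <> 0%C /\ Cmod (ray t phi) < 1 /\
  Cmod (H (ray t phi) * cis (n * phi) / Hr t - 1)%C <= eps.
Proof.
intros Hp He.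
set (d := Rmin (1 / 2) (eps / 2)).
assert (D0 : 0 < d) by (apply Rmin_pos; lra).
assert (D1 : d <= 1 / 2) by apply Rmin_l; assert (D2 : d <= eps / 2) by apply Rmin_r; clearbody d.
assert (Hc : 0 < cos phi0) by (apply cos_gt_0; lra).
destruct (H_ray (cos phi0) (d / 2) Hc ltac:(lra)) as [t0 [Ht0 K]].
exists t0; split; [easy|]; intros t psi Ht Hpsi.
assert (PB := PI_4).
assert (C1 : forall s, 0 <= s <= 1 -> cos phi0 <= cos (psi * s)).
{ intros s Hs; apply cos_ge_of_abs; rewrite Rabs_mult, (Rabs_pos_eq s) by lra; generalize (Rabs_pos psi); nra. }
assert (N0 : Hr t <> 0%C) by (apply (K t 0 Ht); replace 0 with (psi * 0) by ring; apply C1; lra).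
split; [easy|split].
- apply (K t psi Ht); replace psi with (psi * 1) by ring; apply C1; lra.
- set (z := fun s => ray t (psi * s)).
  set (g := fun s => (H (z s) * cis (n * psi * s) * / Hr t)%C).
  set (k := fun s => (Ci * RtoC psi * ((z s - 1) * dH (z s) / H (z s) - RtoC (- n)))%C).
  apply Rle_trans with (2 * d); [|lra].
  replace (H (ray t psi) * cis (n * psi) / Hr t - 1)%C with (g 1 - 1)%C
   by (unfold g, z; rewrite !Rmult_1_r; reflexivity).
  apply (near_one_of_log_derivative g k d ltac:(lra)).
  + unfold g, z; rewrite !Rmult_0_r, cis_0; fold (Hr t); field; easy.
  + intros s Hs; destruct (K t (psi * s) Ht (C1 s Hs)) as [U [N _]]; fold (z s) in U, N.
    assert (Dz : curve_diff z s (- RtoC t * (Ci * RtoC psi * cis (psi * s)))%C).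
    { apply (curve_diff_comp (fun s => cis (psi * s)) (fun y => 1 - RtoC t * y)%C); [apply curve_diff_cis_scal|].
      eapply cdiff_eq; [apply cdiff_minus; [apply cdiff_const|apply cdiff_mult; [apply cdiff_const|apply cdiff_id]]|cbv beta; ring]. }
    assert (DH := curve_diff_comp z H s _ _ Dz (H_diff _ U)).
    eapply curve_diff_eq.
    * apply curve_diff_mult; [apply curve_diff_mult; [exact DH|apply curve_diff_cis_scal]|apply curve_diff_const].
    * cbv beta; unfold k, g.
      assert (Ez : (z s - 1)%C = (- RtoC t * cis (psi * s))%C) by (unfold z, ray; ring).
      rewrite Ez, RtoC_mult, RtoC_opp; field; auto.
  + intros s Hs; destruct (K t (psi * s) Ht (C1 s Hs)) as [_ [_ Q]]; fold (z s) in Q.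
    unfold k; rewrite !Cmod_mult, Cmod_Ci, Cmod_R, Rmult_1_l.
    apply Rle_trans with (2 * (d / 2)); [|lra].
    apply Rmult_le_compat; try apply Rabs_pos; try apply Cmod_ge_0; lra.
Qed.

Definition radial_direction (t : R) : C := (Hr t / RtoC (Cmod (Hr t)))%C.

Lemma Cmod_radial_direction t : Hr t <> 0%C -> Cmod (radial_direction t) = 1.
Proof.
intros N; apply Cmod_gt_0 in N; unfold radial_direction; rewrite Cmod_div, Cmod_R, Rabs_pos_eq; [field; lra|lra|].
intros E; apply RtoC_inj in E; lra.
Qed.

Definition cluster_direction (theta : R) : Prop := forall eps t0, 0 < eps -> 0 < t0 ->
  exists t, 0 < t < t0 /\ Cmod (radial_direction t - cis theta)%C < eps.

Lemma cis_opp_mult (x : R) : (cis x * cis (- x))%C = 1%C.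
Proof. rewrite <- cis_plus, Rplus_opp_r; apply cis_0. Qed.

(** When [H (ray t 0)] points nearly in the direction [theta], the argument of
    [H (ray t phi)] is nearly [theta - n phi], so the intermediate value theorem
    gives a [phi] for which it is exactly the argument of [w], at a modulus
    that [blow_up] makes larger than [|w|]. *)
Lemma wedge_of_cluster_direction (theta : R) : cluster_direction theta ->
  forall w, wedge theta (n * PI / 2) w -> disk_image H w.
Proof.
intros CD w [alpha [[Nw Ew] L]]; change (w = (RtoC (Cmod w) * cis alpha)%C) in Ew.
assert (PP := PI_RGT_0).
set (ps := (theta - alpha) / n).
assert (Eps : n * ps = theta - alpha) by (unfold ps; field; lra).
assert (Ps : Rabs ps < PI / 2).
{ unfold ps; rewrite Rabs_div, (Rabs_pos_eq n) by lra; apply Rlt_div_l; [lra|].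
  rewrite Rabs_minus_sym; lra. }
set (ga := Rmin ((PI / 2 - Rabs ps) / 2) (1 / n)).
assert (G0 : 0 < ga) by (apply Rmin_pos; [lra|apply Rdiv_lt_0_compat; lra]).
assert (G1 : ga <= (PI / 2 - Rabs ps) / 2) by apply Rmin_l.
assert (G2 : n * ga <= 1) by (rewrite Rmult_comm; apply Rle_div_r; [lra|apply Rmin_r]).
clearbody ga; assert (G3 : 0 < n * ga) by nra.
assert (P3 : 3 < PI) by (generalize PI2_3_2; lra).
assert (Sg : 0 < sin (n * ga)) by (apply sin_gt_0; lra).
set (eta := Rmin (1 / 4) (sin (n * ga) / 2)).
assert (E0 : 0 < eta) by (apply Rmin_pos; lra).
assert (E1 : eta <= 1 / 4) by apply Rmin_l; assert (E2 : eta <= sin (n * ga) / 2) by apply Rmin_r; clearbody eta.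
destruct (values_on_arc (Rabs ps + ga) (eta / 2)) as [t0 [Ht0 A]]; [generalize (Rabs_pos ps); lra|lra|].
destruct (blow_up (4 * Cmod w)) as [t1 [Ht1 B]].
destruct (CD (eta / 2) (Rmin t0 t1)) as [t [Ht Dt]]; [lra|now apply Rmin_pos|].
assert (T0 : t < t0) by (generalize (Rmin_l t0 t1); lra).
assert (T1 : t < t1) by (generalize (Rmin_r t0 t1); lra).
specialize (B t ltac:(lra)).
assert (N0 : Hr t <> 0%C) by (apply (A t 0); [lra|rewrite Rabs_R0; generalize (Rabs_pos ps); lra]).
assert (P0 := proj1 (Cmod_gt_0 _) N0).
assert (NR : RtoC (Cmod (Hr t)) <> 0%C) by (intros E; apply RtoC_inj in E; lra).
set (X := fun phi => (H (ray t phi) * (cis (- alpha) / RtoC (Cmod (Hr t))))%C).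
assert (IA : forall phi, ps - ga <= phi <= ps + ga -> Rabs phi <= Rabs ps + ga).
{ intros phi Hphi; replace phi with (ps + (phi - ps)) by ring; eapply Rle_trans; [apply Rabs_triang|].
  apply Rplus_le_compat_l, Rabs_le; lra. }
assert (XC : forall phi, ps - ga <= phi <= ps + ga -> Cmod (X phi - cis (n * (ps - phi)))%C < eta).
{ intros phi Hphi; destruct (A t phi ltac:(lra) (IA phi Hphi)) as [_ [_ Q]].
  set (g := (H (ray t phi) * cis (n * phi) / Hr t)%C) in *.
  assert (EX : (X phi - cis (n * (ps - phi)))%C = (cis (- alpha) * cis (- (n * phi)) * ((g - 1) * radial_direction t + (radial_direction t - cis theta)))%C).
  { replace (cis (n * (ps - phi))) with (cis theta * cis (- alpha) * cis (- (n * phi)))%C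
      by (rewrite <- !cis_plus; f_equal; lra).
    assert (Eg : H (ray t phi) = (g * Hr t * cis (- (n * phi)))%C).
    { unfold g; transitivity (H (ray t phi) * (cis (n * phi) * cis (- (n * phi))))%C; [rewrite cis_opp_mult; ring|field; easy]. }
    unfold X; rewrite Eg; unfold radial_direction; field; easy. }
  rewrite EX, !Cmod_mult, !Cmod_cis, !Rmult_1_l.
  eapply Rle_lt_trans; [apply Cmod_triangle|]; rewrite Cmod_mult, (Cmod_radial_direction t N0); lra. }
assert (Cont : forall phi, ps - ga <= phi <= ps + ga -> curve_cont X phi).
{ intros phi Hphi; destruct (A t phi ltac:(lra) (IA phi Hphi)) as [_ [U _]].
  apply (curve_cont_comp (fun phi => ray t phi) (fun z => H z * (cis (- alpha) / RtoC (Cmod (Hr t))))%C).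
  - apply (curve_cont_comp cis (fun y => 1 - RtoC t * y)%C); [eapply curve_diff_cont, curve_diff_cis|].
    apply ccont_minus; [apply ccont_const|apply ccont_scal].
  - apply ccont_mult; [eapply cdiff_ccont; now apply H_diff|apply ccont_const]. }
destruct (IVT_interv (fun phi => - Im (X phi)) (ps - ga) (ps + ga)) as [phi [Hphi Ephi]].
- intros a Ha; apply continuity_pt_filterlim, (continuous_opp (V := R_NormedModule) (fun phi => Im (X phi))), curve_cont_im; now apply Cont.
- lra.
- assert (Q := XC (ps - ga) ltac:(lra)); replace (n * (ps - (ps - ga))) with (n * ga) in Q by ring.
  assert (Q' := im_le_Cmod (X (ps - ga)%R - cis (n * ga))%C); rewrite im_minus in Q'.
  change (Im (cis (n * ga))) with (sin (n * ga)) in Q'; apply Rabs_le_between in Q'; lra.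
- assert (Q := XC (ps + ga) ltac:(lra)); replace (n * (ps - (ps + ga))) with (- (n * ga)) in Q by ring.
  assert (Q' := im_le_Cmod (X (ps + ga)%R - cis (- (n * ga)))%C); rewrite im_minus in Q'.
  change (Im (cis (- (n * ga)))) with (sin (- (n * ga))) in Q'; rewrite sin_neg in Q'; apply Rabs_le_between in Q'; lra.
- assert (I0 : Im (X phi) = 0) by lra.
  assert (R0 : 1 / 4 <= Re (X phi)).
  { assert (Q := XC phi Hphi); assert (Q' := re_le_Cmod (X phi - cis (n * (ps - phi)))%C); rewrite re_minus in Q'.
    change (Re (cis (n * (ps - phi)))) with (cos (n * (ps - phi))) in Q'.
    assert (cos (PI / 3) <= cos (n * (ps - phi))).
    { apply cos_ge_of_abs; split; [|lra]; apply Rle_trans with 1; [|lra].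
      rewrite Rabs_mult, (Rabs_pos_eq n) by lra; apply Rle_trans with (n * ga); [|easy].
      apply Rmult_le_compat_l; [lra|apply Rabs_le; lra]. }
    rewrite cos_PI3 in H0; apply Rabs_le_between in Q'; lra. }
  destruct (A t phi ltac:(lra) (IA phi Hphi)) as [_ [U _]].
  set (rho := Cmod (Hr t) * Re (X phi)).
  assert (Rp : 0 < rho) by (unfold rho; apply Rmult_lt_0_compat; lra).
  assert (Pw := proj1 (Cmod_gt_0 _) Nw).
  assert (EH : H (ray t phi) = (RtoC rho * cis alpha)%C).
  { assert (EX : X phi = RtoC (Re (X phi))) by (apply C_ext; [now rewrite re_RtoC|now rewrite im_RtoC]).
    unfold rho; rewrite RtoC_mult, <- EX; unfold X.
    transitivity (H (ray t phi) * (cis alpha * cis (- alpha)))%C; [rewrite cis_opp_mult; ring|field; easy]. }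
  replace w with (RtoC (Cmod w / rho) * H (ray t phi))%C.
  + apply H_star; [easy|]; split; [now apply Rdiv_lt_0_compat|].
    apply Rle_div_l; [lra|]; unfold rho; nra.
  + rewrite EH, Ew at 1. rewrite RtoC_div by lra.
    rewrite Cmod_mult, Cmod_cis, Cmod_R, Rabs_pos_eq, Rmult_1_r by lra.
    rewrite Ew at 2; field; intros E; apply RtoC_inj in E; lra.
Qed.

End Growth.

(** * The principal logarithm *)

Definition clog (u : C) : C := (ln (Cmod u), atan (Im u / Re u)).

Lemma cexp_clog (u : C) : 0 < Re u -> cexp (clog u) = u.
Proof.
intros Hu.
assert (P : 0 < Cmod u) by (generalize (re_le_Cmod u) (Rle_abs (Re u)); lra).
assert (S : sqrt (1 + Rsqr (Im u / Re u)) = Cmod u / Re u).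
{ replace (1 + Rsqr (Im u / Re u)) with ((Cmod u / Re u) * (Cmod u / Re u)).
  - apply sqrt_square, Rdiv_le_0_compat; lra.
  - replace (Cmod u / Re u * (Cmod u / Re u)) with (Cmod u * Cmod u / (Re u * Re u)) by (field; lra).
    rewrite Cmod_sqr; unfold Rsqr; field; lra. }
unfold cexp, cis, clog; simpl; rewrite exp_ln, cos_atan, sin_atan, S by easy.
apply C_ext; [rewrite re_scal_l|rewrite im_scal_l]; simpl; field; lra.
Qed.

Lemma clog_cexp (s : C) : Rabs (Im s) < PI / 2 -> clog (cexp s) = s.
Proof.
intros Hs; apply Rabs_def2 in Hs; unfold clog; rewrite Cmod_cexp, ln_exp.
assert (0 < cos (Im s)) by (apply cos_gt_0; lra); assert (E := exp_pos (Re s)).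
unfold cexp, cis; rewrite re_scal_l, im_scal_l; simpl.
replace (exp (Re s) * sin (Im s) / (exp (Re s) * cos (Im s))) with (tan (Im s)) by (unfold tan; field; lra).
rewrite atan_tan by lra; apply C_ext; easy.
Qed.

Definition rcont (f : C -> R) (a : C) : Prop := forall eps, 0 < eps ->
  exists d, 0 < d /\ forall w, Cmod (w - a)%C < d -> Rabs (f w - f a) < eps.

Lemma rcont_comp (f : C -> R) (g : R -> R) a : rcont f a -> continuous g (f a) -> rcont (fun z => g (f z)) a.
Proof.
intros F G eps He; rewrite continuous_eps in G; destruct (G eps He) as [d [Hd K]]; destruct (F d Hd) as [d' [Hd' K']].
exists d'; auto.
Qed.

Lemma rcont_re (f : C -> C) a : ccont f a -> rcont (fun z => Re (f z)) a.
Proof.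
intros F eps He; destruct (F eps He) as [d [Hd K]]; exists d; split; [easy|]; intros w Hw.
eapply Rle_lt_trans; [|apply (K w Hw)]; rewrite <- re_minus; apply re_le_Cmod.
Qed.

Lemma rcont_im (f : C -> C) a : ccont f a -> rcont (fun z => Im (f z)) a.
Proof.
intros F eps He; destruct (F eps He) as [d [Hd K]]; exists d; split; [easy|]; intros w Hw.
eapply Rle_lt_trans; [|apply (K w Hw)]; rewrite <- im_minus; apply im_le_Cmod.
Qed.

Lemma ccont_parts (f g : C -> R) a : rcont f a -> rcont g a -> ccont (fun z => (f z, g z)) a.
Proof.
intros F G eps He; destruct (F (eps / 2)) as [d [Hd K]]; [lra|]; destruct (G (eps / 2)) as [d' [Hd' K']]; [lra|].
exists (Rmin d d'); split; [now apply Rmin_pos|]; intros w Hw.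
eapply Rle_lt_trans; [apply Cmod_le_re_im|]; rewrite re_minus, im_minus; simpl.
generalize (K w) (K' w) (Rmin_l d d') (Rmin_r d d'); intros; lra.
Qed.

Lemma ccont_RtoC (f : C -> R) a : rcont f a -> ccont (fun z => RtoC (f z)) a.
Proof.
intros F eps He; destruct (F eps He) as [d [Hd K]]; exists d; split; [easy|]; intros w Hw.
rewrite <- RtoC_minus, Cmod_R; auto.
Qed.

Lemma ccont_clog (u : C) : 0 < Re u -> ccont clog u.
Proof.
intros Hu.
assert (P : 0 < Cmod u) by (generalize (re_le_Cmod u) (Rle_abs (Re u)); lra).
apply ccont_parts.
- apply (rcont_comp Cmod ln).
  + intros eps He; apply (Cmod_continuous (fun z => z)); [apply ccont_id|easy].
  + apply (ex_derive_continuous ln); eexists; now apply is_derive_ln.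
- apply (rcont_comp (fun u => Im u / Re u) atan).
  + intros eps He.
    assert (N : RtoC (Re u) <> 0%C) by (intros E; apply RtoC_inj in E; lra).
    destruct (rcont_re (fun z => RtoC (Im z) * / RtoC (Re z))%C u) with (eps := eps) as [d [Hd K]]; try easy.
    * apply ccont_mult; [apply ccont_RtoC, (rcont_im (fun z => z)), ccont_id|].
      apply ccont_inv; [apply ccont_RtoC, (rcont_re (fun z => z)), ccont_id|easy].
    * exists (Rmin d (Re u)); split; [now apply Rmin_pos|]; intros w Hw.
      assert (H1 : Cmod (w - u)%C < d) by (generalize (Rmin_l d (Re u)); lra).
      assert (H2 : Cmod (w - u)%C < Re u) by (generalize (Rmin_r d (Re u)); lra).
      assert (Rw : 0 < Re w).
      { generalize (re_le_Cmod (w - u)%C); rewrite re_minus; intros Q; apply Rabs_le_between in Q; lra. }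
      specialize (K w H1); rewrite !re_scal_l, <- !RtoC_inv, !re_RtoC in K by lra; exact K.
  + apply (ex_derive_continuous atan); eexists; apply is_derive_atan.
Qed.

Lemma hol_clog (u : C) : 0 < Re u -> hol_at clog u.
Proof.
intros Hu; exists (/ cexp (clog u))%C.
apply (cdiff_inverse cexp clog u _ (Re u) Hu).
- intros w Hw; apply cexp_clog.
  generalize (re_le_Cmod (w - u)%C); rewrite re_minus; intros Q; apply Rabs_le_between in Q; lra.
- now apply ccont_clog.
- apply cexp_cdiff.
- apply cexp_neq_0.
Qed.

Lemma unit_cis_clog (u : C) : Cmod u = 1 -> 0 < Re u -> u = cis (Im (clog u)).
Proof.
intros U P; rewrite <- (cexp_clog u P) at 1; unfold cexp.
replace (Re (clog u)) with 0; [rewrite exp_0; ring|]; unfold clog; simpl; now rewrite U, ln_1.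
Qed.

Lemma clog_1 : clog 1%C = 0%C.
Proof. unfold clog; rewrite Cmod_1, ln_1; simpl; unfold Rdiv; rewrite Rmult_0_l, atan_0; easy. Qed.

Lemma near_1_re (u : C) : Cmod (u - 1)%C < 1 -> 0 < Re u.
Proof.
intros Hu; generalize (re_le_Cmod (u - 1)%C); rewrite re_minus, re_RtoC; intros Q; apply Rabs_le_between in Q; lra.
Qed.

Lemma Cmod_mult_cis_minus (q : C) (x : R) : Cmod (q * cis (- x) - 1)%C = Cmod (q - cis x)%C.
Proof.
rewrite <- (cis_opp_mult x); replace (q * cis (- x) - cis x * cis (- x))%C with ((q - cis x) * cis (- x))%C by ring.
rewrite Cmod_mult, Cmod_cis; ring.
Qed.

(** The principal argument of [q cis (- theta)] is a continuous branch of
    [arg q - theta] for [q] close to [cis theta]. *)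
Lemma near_cis_arg (eps : R) : 0 < eps -> exists d, 0 < d <= 1 /\ forall theta q, Cmod q = 1 ->
  Cmod (q - cis theta)%C < d -> Rabs (Im (clog (q * cis (- theta))%C)) < eps /\
  q = cis (theta + Im (clog (q * cis (- theta))%C)).
Proof.
intros He; destruct (rcont_im clog 1%C (ccont_clog 1%C ltac:(rewrite re_RtoC; lra)) eps He) as [d [Hd K]].
exists (Rmin d 1); split; [split; [apply Rmin_pos; lra|apply Rmin_r]|]; intros theta q Hq L.
rewrite <- Cmod_mult_cis_minus in L; set (u := (q * cis (- theta))%C) in *.
assert (L1 : Cmod (u - 1)%C < d) by (generalize (Rmin_l d 1); lra).
assert (L2 : Cmod (u - 1)%C < 1) by (generalize (Rmin_r d 1); lra).
split.
- specialize (K u L1); rewrite clog_1 in K; change (Im (RtoC 0)) with 0 in K; now rewrite Rminus_0_r in K.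
- rewrite cis_plus, <- (unit_cis_clog u); [|unfold u; rewrite Cmod_mult, Cmod_cis, Hq; ring|now apply near_1_re].
  unfold u; transitivity (q * (cis theta * cis (- theta)))%C; [rewrite cis_opp_mult|]; ring.
Qed.

Lemma unit_cis (q : C) : Cmod q = 1 -> exists theta, q = cis theta.
Proof.
intros U; assert (S := Cmod_sqr q); rewrite U in S.
assert (B : -1 <= Re q <= 1) by nra.
assert (Q : sin (acos (Re q)) * sin (acos (Re q)) = Im q * Im q).
{ generalize (cos2_sin2 (acos (Re q))); rewrite cos_acos by easy; lra. }
assert (T : (sin (acos (Re q)) - Im q) * (sin (acos (Re q)) + Im q) = 0) by lra.
apply Rmult_integral in T; destruct T as [T|T].
- exists (acos (Re q)); apply C_ext; unfold cis; simpl; [now rewrite cos_acos|lra].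
- exists (- acos (Re q)); apply C_ext; unfold cis; simpl; [rewrite cos_neg; now rewrite cos_acos|rewrite sin_neg; lra].
Qed.

(** * Sharpness of the wedge and convergence of the argument *)

Section Sharp.

Variables H dH : C -> C.
Variable n : R.
Hypothesis n_pos : 0 < n.
Hypothesis H_diff : forall z, Cmod z < 1 -> cdiff H z (dH z).
Hypothesis H_inj : forall z w, Cmod z < 1 -> Cmod w < 1 -> H z = H w -> z = w.
Hypothesis H_star : forall z s, Cmod z < 1 -> 0 < s <= 1 -> disk_image H (RtoC s * H z)%C.
Hypothesis H_ray : forall c eps, 0 < c -> 0 < eps -> exists t0, 0 < t0 /\ forall t phi,
  0 < t < t0 -> c <= cos phi -> Cmod (ray t phi) < 1 /\ H (ray t phi) <> 0%C /\
  Cmod ((ray t phi - 1) * dH (ray t phi) / H (ray t phi) - RtoC (- n))%C < eps.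

Section Power.

Variables theta beta : R.
Hypothesis beta_pos : 0 < beta.
Hypothesis H_wedge : forall w, wedge theta beta w -> disk_image H w.

Let lam : R := 2 * beta / PI.

Lemma lam_pos : 0 < lam.
Proof. unfold lam; apply Rdiv_lt_0_compat; [lra|apply PI_RGT_0]. Qed.

(** [cis theta * u^lam] with [u = (1 + z) / (1 - z)] in the right half-plane.
    For [beta > PI] it is not injective. *)
Definition to_wedge (z : C) : C := cexp (Ci * RtoC theta + RtoC lam * clog ((1 + z) / (1 - z)))%C.

Lemma re_cayley_pos (z : C) : Cmod z < 1 -> (1 - z)%C <> 0%C /\ 0 < Re ((1 + z) / (1 - z))%C.
Proof.
intros Hz.
assert (N : (1 - z)%C <> 0%C) by (apply Cminus_neq_0; intros E; rewrite <- E, Cmod_1 in Hz; lra).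
split; [easy|]; assert (E := re_cayley z N); apply Cmod_gt_0 in N.
assert (0 < 1 - Cmod z * Cmod z) by (generalize (Cmod_ge_0 z); nra).
apply Rnot_le_lt; intros L; assert (0 < Cmod (1 - z) * Cmod (1 - z)) by nra; nra.
Qed.

Lemma to_wedge_image (z : C) : Cmod z < 1 -> disk_image H (to_wedge z).
Proof.
intros Hz; destruct (re_cayley_pos z Hz) as [N P]; apply H_wedge.
set (L := clog ((1 + z) / (1 - z))%C).
exists (theta + lam * Im L); split; [split|].
- apply cexp_neq_0.
- unfold to_wedge; fold L; rewrite Cmod_cexp; unfold cexp at 1.
  f_equal; change (cos (theta + lam * Im L), sin (theta + lam * Im L)) with (cis (theta + lam * Im L)); f_equal.
  rewrite im_plus, im_scal_l, im_mult, re_RtoC, im_RtoC; simpl; ring.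
- replace (theta + lam * Im L - theta) with (lam * Im L) by ring.
  assert (B := atan_bound (Im ((1 + z) / (1 - z)) / Re ((1 + z) / (1 - z)))); change (- PI / 2 < Im L < PI / 2) in B.
  assert (LP := lam_pos); assert (PP := PI_RGT_0).
  rewrite Rabs_mult, (Rabs_pos_eq lam) by lra.
  replace beta with (lam * (PI / 2)) by (unfold lam; field; lra).
  apply Rmult_lt_compat_l; [easy|]; apply Rabs_def1; lra.
Qed.

Let k (z : C) : C := disk_inverse H (to_wedge z).

Lemma wedge_preimage_disk z : Cmod z < 1 -> Cmod (k z) < 1.
Proof. intros Hz; now apply (disk_inverse_spec H), to_wedge_image. Qed.

Lemma wedge_preimage_hol z : Cmod z < 1 -> hol_at k z.
Proof.
intros Hz; destruct (re_cayley_pos z Hz) as [N P].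
apply (hol_comp to_wedge (disk_inverse H)); [|now apply (disk_inverse_hol H dH H_diff H_inj), to_wedge_image].
apply (hol_comp (fun z => Ci * RtoC theta + RtoC lam * clog ((1 + z) / (1 - z)))%C cexp); [|eexists; apply cexp_cdiff].
apply hol_plus; [apply hol_const|]; apply hol_mult; [apply hol_const|].
apply (hol_comp (fun z => (1 + z) / (1 - z))%C clog); [|now apply hol_clog].
apply hol_div; [apply hol_plus; [apply hol_const|apply hol_id]|apply hol_minus; [apply hol_const|apply hol_id]|easy].
Qed.

(** The Schwarz-Pick inequality for the inverse of [H] composed with
    [to_wedge], between 0 and a preimage [y] of [H z], bounds [1 - |z|] below by
    a multiple of [1 - |y|].  Away from the sides of the wedge, the latter is
    of order [|H z|^(- 1 / lam)]. *)
Lemma boundary_distance_bound (b : R) : 0 <= b < beta -> exists c, 0 < c /\ forall (z : C) (alpha : R), Cmod z < 1 ->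
  1 <= Cmod (H z) -> H z = (RtoC (Cmod (H z)) * cis alpha)%C -> Rabs (alpha - theta) <= b ->
  c <= (1 - Cmod z) * exp (ln (Cmod (H z)) / lam).
Proof.
intros Hb; assert (LP := lam_pos); assert (PP := PI_RGT_0).
assert (Bl : b / lam < PI / 2).
{ apply Rlt_div_l; [easy|]; replace (PI / 2 * lam) with beta by (unfold lam; field; lra); lra. }
assert (B0 : 0 <= b / lam) by (apply Rdiv_le_0_compat; lra).
set (c := cos (b / lam)); assert (Hc : 0 < c) by (apply cos_gt_0; lra).
assert (K0 := wedge_preimage_disk 0%C ltac:(rewrite Cmod_0; lra)).
set (k0 := k 0%C) in *; assert (K0' := Cmod_ge_0 k0).
exists ((1 - Cmod k0) * (1 - Cmod k0) * c / 2); split; [apply Rdiv_lt_0_compat; [|lra]; repeat apply Rmult_lt_0_compat; lra|].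
intros z alpha Uz RH EH La.
set (R := Cmod (H z)) in *.
assert (LR : 0 <= ln R) by (rewrite <- ln_1; apply ln_le; lra).
set (s := (ln R / lam, (alpha - theta) / lam) : C).
assert (Is : Rabs ((alpha - theta) / lam) <= b / lam).
{ rewrite Rabs_div, (Rabs_pos_eq lam) by lra; apply Rmult_le_compat_r; [left; now apply Rinv_0_lt_compat|easy]. }
set (u := cexp s).
assert (Mu : Cmod u = exp (ln R / lam)) by apply Cmod_cexp.
assert (Mu1 : 1 <= Cmod u).
{ rewrite Mu, <- exp_0; destruct (Rle_lt_or_eq_dec 0 (ln R / lam)) as [l|e]; [apply Rdiv_le_0_compat; lra| |].
  - left; now apply exp_increasing.
  - rewrite <- e; lra. }
assert (Ru : c * Cmod u <= Re u).
{ unfold u at 2; unfold cexp, cis; rewrite re_scal_l; simpl; rewrite Mu, Rmult_comm.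
  apply Rmult_le_compat_l; [left; apply exp_pos|]; unfold c; apply cos_ge_of_abs; lra. }
assert (Ru0 : 0 < Re u) by nra.
set (y := half_plane_line u 0).
assert (Ny := half_plane_line_den u (Rlt_le _ _ Ru0) 0 (Rle_refl 0)); assert (Py := proj1 (Cmod_gt_0 _) Ny).
assert (Ey := half_plane_line_Cmod u (Rlt_le _ _ Ru0) 0 (Rle_refl 0)); fold y in Ey.
assert (N2 : Cmod (u + RtoC 0 + 1)%C <= 2 * Cmod u).
{ rewrite Cplus_0_r; eapply Rle_trans; [apply Cmod_triangle|]; rewrite Cmod_1; lra. }
assert (Dy : c / Cmod u <= 1 - Cmod y * Cmod y).
{ rewrite Ey, Rplus_0_r; apply -> Rle_div_r; [|nra].
  apply Rle_trans with (c / Cmod u * ((2 * Cmod u) * (2 * Cmod u))).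
  - apply Rmult_le_compat_l; [apply Rdiv_le_0_compat; lra|]; apply Rmult_le_compat; lra.
  - replace (c / Cmod u * (2 * Cmod u * (2 * Cmod u))) with (4 * (c * Cmod u)) by (field; lra); lra. }
assert (Dp : 0 < c / Cmod u) by (apply Rdiv_lt_0_compat; lra).
assert (Uy : Cmod y < 1) by (generalize (Cmod_ge_0 y); nra).
assert (Ky : k y = z).
{ assert (Eu : ((1 + y) / (1 - y))%C = u).
  { unfold y, half_plane_line; rewrite Cplus_0_r in *; field; split; [easy|].
    intros E; assert (E' : (2 : C) = 0%C) by (rewrite <- E; ring); apply RtoC_inj in E'; lra. }
  unfold k, to_wedge; rewrite Eu; unfold u; rewrite clog_cexp by (simpl; lra).
  rewrite <- (disk_inverse_of_image H H_inj z Uz); f_equal; rewrite EH.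
  assert (Es : (Ci * RtoC theta + RtoC lam * s)%C = ((ln R, alpha) : C)).
  { apply C_ext; rewrite ?re_plus, ?im_plus, ?re_scal_l, ?im_scal_l, ?re_scal_r, ?im_scal_r; simpl; field; lra. }
  rewrite Es; unfold cexp; simpl; rewrite exp_ln by lra; reflexivity. }
assert (SP := schwarz_pick k wedge_preimage_hol wedge_preimage_disk y 0%C Uy ltac:(rewrite Cmod_0; lra)).
rewrite Ky in SP; fold k0 in SP.
replace (1 - Cconj 0 * y)%C with (RtoC 1) in SP by (apply C_ext; simpl; ring).
replace (y - 0)%C with y in SP by ring; rewrite Cmod_1, Rmult_1_r in SP.
assert (I := pseudo_hyperbolic_identity k0 z).
set (D := Cmod (1 - Cconj k0 * z)%C) in *.
assert (DL : 1 - Cmod k0 <= D).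
{ generalize (Cmod_triangle_inv 1%C (Cconj k0 * z)%C); fold D; rewrite Cmod_1, Cmod_mult, Cmod_conj; generalize (Cmod_ge_0 z); nra. }
assert (S2 : Cmod (z - k0) * Cmod (z - k0) <= (Cmod y * D) * (Cmod y * D)) by (apply Rmult_le_compat; try apply Cmod_ge_0; easy).
assert (X : D * D * (1 - Cmod y * Cmod y) <= (1 - Cmod z * Cmod z) * (1 - Cmod k0 * Cmod k0)) by nra.
assert (X2 : (1 - Cmod z * Cmod z) * (1 - Cmod k0 * Cmod k0) <= 2 * (1 - Cmod z)).
{ generalize (Cmod_ge_0 z); intros; assert (0 <= 1 - Cmod z * Cmod z <= 2 * (1 - Cmod z)) by nra.
  assert (0 <= Cmod k0 * Cmod k0 <= 1) by nra; nra. }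
assert (X3 : (1 - Cmod k0) * (1 - Cmod k0) * (c / Cmod u) <= D * D * (1 - Cmod y * Cmod y)).
{ apply Rmult_le_compat; try lra; [apply Rmult_le_pos; lra|apply Rmult_le_compat; lra]. }
rewrite <- Mu.
apply Rmult_le_reg_r with (2 / Cmod u); [apply Rdiv_lt_0_compat; lra|].
replace ((1 - Cmod k0) * (1 - Cmod k0) * c / 2 * (2 / Cmod u)) with ((1 - Cmod k0) * (1 - Cmod k0) * (c / Cmod u)) by (field; lra).
replace ((1 - Cmod z) * Cmod u * (2 / Cmod u)) with (2 * (1 - Cmod z)) by (field; lra).
lra.
Qed.

End Power.

Let Hr (t : R) : C := H (ray t 0).

Lemma ray_0 (t : R) : ray t 0 = RtoC (1 - t).
Proof. unfold ray; rewrite cis_0, RtoC_minus; ring. Qed.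

(** At the points [ray t 0] whose image points well into the wedge, [|H|] is at
    least a multiple of [t^(- lam)] with [lam = 2 beta / PI], and
    [radial_growth] allows no exponent above [n]. *)
Lemma wedge_sharp (theta0 theta beta : R) : cluster_direction H theta0 -> Rabs (theta0 - theta) < beta ->
  (forall w, wedge theta beta w -> disk_image H w) -> beta <= n * PI / 2.
Proof.
intros CD Lb HW; apply Rnot_lt_le; intros L.
assert (PP := PI_RGT_0); assert (A0 := Rabs_pos (theta0 - theta)).
assert (Bp : 0 < beta) by lra.
set (lam := 2 * beta / PI); assert (LP : 0 < lam) by (unfold lam; apply Rdiv_lt_0_compat; lra).
assert (Ll : n < lam) by (apply Rlt_div_r; lra).
set (e := (beta - Rabs (theta0 - theta)) / 2).
destruct (boundary_distance_bound theta beta Bp HW (Rabs (theta0 - theta) + e)) as [c [Hc D]]; [unfold e; lra|]; fold lam in D.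
destruct (near_cis_arg e) as [d [Hd N]]; [unfold e; lra|].
destruct (radial_growth H dH n H_diff H_ray ((lam - n) / 2)) as [t1 [K [Ht1 G]]]; [lra|].
destruct (blow_up H dH n n_pos H_diff H_ray 1) as [t2 [Ht2 B]].
set (b := 2 * lam / (lam - n) * (ln c - K / lam)).
set (t0 := Rmin (Rmin t1 t2) (Rmin (exp b) 1)).
assert (T0 : 0 < t0) by (repeat apply Rmin_pos; try easy; try apply exp_pos; lra).
assert (L1 := Rmin_l (Rmin t1 t2) (Rmin (exp b) 1)); assert (L2 := Rmin_r (Rmin t1 t2) (Rmin (exp b) 1)).
assert (L3 := Rmin_l t1 t2); assert (L4 := Rmin_r t1 t2); assert (L5 := Rmin_l (exp b) 1); assert (L6 := Rmin_r (exp b) 1).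
fold t0 in L1, L2.
destruct (CD d t0) as [t [Ht Dt]]; [easy|easy|].
destruct (G t) as [N0 [_ G2]]; [lra|].
specialize (B t ltac:(lra)).
destruct (N theta0 (radial_direction H t)) as [N1 N2]; [now apply Cmod_radial_direction|easy|].
set (a := Im (clog (radial_direction H t * cis (- theta0))%C)) in *.
assert (M : Cmod (ray t 0) = 1 - t) by (rewrite ray_0, Cmod_R, Rabs_pos_eq; lra).
assert (Q := D (ray t 0) (theta0 + a) ltac:(lra) B).
rewrite M in Q; replace (1 - (1 - t)) with t in Q by ring.
assert (Q' : c <= t * exp (ln (Cmod (H (ray t 0))) / lam)).
{ apply Q.
  - rewrite <- N2; unfold radial_direction; field; intros E; apply RtoC_inj in E; lra.
  - replace (theta0 + a - theta) with ((theta0 - theta) + a) by ring; eapply Rle_trans; [apply Rabs_triang|lra]. }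
assert (LQ : ln c <= ln t + ln (Cmod (H (ray t 0))) / lam).
{ rewrite <- (ln_exp (ln (Cmod (H (ray t 0))) / lam)), <- ln_mult by (try apply exp_pos; lra); apply ln_le; lra. }
assert (ln t < b) by (rewrite <- (ln_exp b); apply ln_increasing; lra).
assert (LQ2 : ln (Cmod (H (ray t 0))) / lam <= (K - (n + (lam - n) / 2) * ln t) / lam).
{ apply Rmult_le_compat_r; [left; now apply Rinv_0_lt_compat|easy]. }
assert (E1 : ln t + (K - (n + (lam - n) / 2) * ln t) / lam = (lam - n) / (2 * lam) * ln t + K / lam) by (field; lra).
assert (E2 : (lam - n) / (2 * lam) * b = ln c - K / lam) by (unfold b; field; lra).
assert (0 < (lam - n) / (2 * lam)) by (apply Rdiv_lt_0_compat; lra).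
nra.
Qed.

Lemma radial_direction_cont : exists t1, 0 < t1 <= 1 /\ forall t, 0 < t < t1 -> Hr t <> 0%C /\ curve_cont (radial_direction H) t.
Proof.
destruct (H_ray 1 1 Rlt_0_1 Rlt_0_1) as [t1 [Ht1 K]]; exists (Rmin t1 1).
split; [split; [apply Rmin_pos; lra|apply Rmin_r]|]; intros t Ht.
destruct (K t 0) as [U [N _]]; [generalize (Rmin_l t1 1); lra|rewrite cos_0; lra|].
split; [easy|].
apply (curve_cont_comp (fun t => ray t 0) (fun z => H z / RtoC (Cmod (H z)))%C).
- apply (curve_diff_cont _ _ (- cis 0)%C), (curve_diff_ext (fun t => 1 + RtoC t * - cis 0)%C); [intros s; unfold ray; ring|apply curve_diff_segment].
- assert (CH := cdiff_ccont _ _ _ (H_diff _ U)); apply Cmod_gt_0 in N.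
  apply ccont_div; [easy|apply ccont_RtoC; intros eps He; now apply (Cmod_continuous H)|].
  intros E; apply RtoC_inj in E; lra.
Qed.

(** The direction has a cluster value [cis th1].  Without convergence it
    would, by continuity, come arbitrarily often to a given small distance from
    it, hence have a second cluster direction [th3].  The two wedges overlap,
    and their union contradicts [wedge_sharp]. *)
Lemma radial_direction_converges : exists theta, forall eps, 0 < eps -> exists t0, 0 < t0 /\ forall t,
  0 < t < t0 -> Hr t <> 0%C /\ Cmod (radial_direction H t - cis theta)%C < eps.
Proof.
destruct radial_direction_cont as [t1 [Ht1 DC]].
assert (Unit : forall t, 0 < t < t1 -> Cmod (radial_direction H t) = 1) by (intros t Ht; apply Cmod_radial_direction; now apply DC).
assert (CL : forall S : C -> Prop, (forall t0, 0 < t0 -> exists t, 0 < t < Rmin t0 t1 /\ S (radial_direction H t)) ->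
  exists theta, forall eps t0, 0 < eps -> 0 < t0 -> exists t, 0 < t < Rmin t0 t1 /\ S (radial_direction H t) /\ Cmod (radial_direction H t - cis theta)%C < eps).
{ intros S HS; destruct (cluster_point (fun t p => p = radial_direction H t /\ S p /\ 0 < t < t1) 1 Rlt_0_1) as [q [Hq Q]].
  - intros t0 Ht0; destruct (HS t0 Ht0) as [t [T ST]]; exists t, (radial_direction H t).
    generalize (Rmin_l t0 t1) (Rmin_r t0 t1); intros; repeat split; try easy; try lra; rewrite Unit; lra.
  - assert (Uq : Cmod q = 1).
    { apply Rle_antisym; [easy|]; apply Rnot_lt_le; intros L.
      destruct (Q (1 - Cmod q) 1) as [t [p [_ [_ [P1 [P2 [_ P3]]]]]]]; [lra|lra|].
      rewrite P2 in P1; generalize (Cmod_triangle_inv (radial_direction H t) q); rewrite Unit by easy; lra. }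
    destruct (unit_cis q Uq) as [theta Et]; exists theta; intros eps t0 He Ht0.
    destruct (Q eps (Rmin t0 t1)) as [t [p [T1 [_ [P1 [P2 [P3 P4]]]]]]]; [easy|apply Rmin_pos; lra|].
    exists t; rewrite <- P2, <- Et; auto. }
assert (TM : forall t0, 0 < t0 -> 0 < Rmin t0 t1 / 2 < Rmin t0 t1).
{ intros t0 Ht0; assert (0 < Rmin t0 t1) by (apply Rmin_pos; lra); lra. }
destruct (CL (fun _ => True)) as [th1 C1].
{ intros t0 Ht0; exists (Rmin t0 t1 / 2); auto. }
exists th1.
apply NNPP; intros NC; apply not_all_ex_not in NC; destruct NC as [e0 NC]; apply imply_to_and in NC; destruct NC as [E0 NC].
assert (Far : forall t0, 0 < t0 -> exists t, 0 < t < Rmin t0 t1 /\ e0 <= Cmod (radial_direction H t - cis th1)%C).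
{ intros t0 Ht0; apply NNPP; intros NF; apply NC; exists (Rmin t0 t1); split; [apply Rmin_pos; lra|]; intros t Ht.
  split; [apply DC; generalize (Rmin_r t0 t1); lra|].
  apply Rnot_le_lt; intros L; apply NF; now exists t. }
assert (PP := PI_RGT_0).
destruct (curve_diff_cont _ _ _ (curve_diff_cis 0) e0 E0) as [d [Hd Dc]].
set (s0 := Rmin (d / 2) (Rmin (n * PI / 2) (PI / 2))).
assert (S0 : 0 < s0) by (repeat apply Rmin_pos; nra).
assert (S1 : s0 <= d / 2) by apply Rmin_l.
assert (S2 : s0 <= n * PI / 2) by (eapply Rle_trans; [apply Rmin_r|apply Rmin_l]).
assert (S3 : s0 <= PI / 2) by (eapply Rle_trans; [apply Rmin_r|apply Rmin_r]).
clearbody s0; assert (Ds := Dc s0 ltac:(rewrite Rminus_0_r, Rabs_pos_eq; lra)); rewrite cis_0 in Ds.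
set (e := Cmod (cis s0 - 1)%C) in *.
assert (Ep : 0 < e).
{ apply Cmod_gt_0, Cminus_neq_0; intros E; assert (F := f_equal Im E); change (sin s0 = 0) in F.
  generalize (sin_gt_0 s0); lra. }
destruct (CL (fun p => Cmod (p - cis th1)%C = e)) as [th2 C2].
{ intros t0 Ht0; destruct (C1 e t0 Ep Ht0) as [ta [Ta [_ Da]]]; destruct (Far t0 Ht0) as [tb [Tb Db]].
  set (f := fun t => Cmod (radial_direction H t - cis th1)%C - e).
  assert (Fc : forall t, 0 < t < Rmin t0 t1 -> continuity_pt f t).
  { intros t Ht; apply continuity_pt_filterlim.
    assert (Q := Cmod_continuous (fun z => z - cis th1)%C (radial_direction H t)).
    apply continuous_eps; intros eps He; destruct (Q ltac:(apply ccont_minus; [apply ccont_id|apply ccont_const]) eps He) as [d1 [Hd1 K1]].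
    destruct (proj2 (DC t ltac:(generalize (Rmin_r t0 t1); lra)) d1 Hd1) as [d2 [Hd2 K2]].
    exists d2; split; [easy|]; intros y Hy; unfold f.
    match goal with |- Rabs ?x < _ => replace x with (Cmod (radial_direction H y - cis th1) - Cmod (radial_direction H t - cis th1)) by ring end; auto. }
  assert (Z : exists t, 0 < t < Rmin t0 t1 /\ f t = 0).
  { destruct (Rtotal_order ta tb) as [Lt|[Eq|Lt]].
    - destruct (IVT_interv f ta tb) as [t [T F]]; [intros; apply Fc; lra|easy|unfold f; lra|unfold f; lra|exists t; split; [lra|easy]].
    - rewrite Eq in Da; lra.
    - destruct (IVT_interv (fun t => - f t) tb ta) as [t [T F]]; [|easy|unfold f; lra|unfold f; lra|exists t; split; lra].
      intros a Ha; apply (continuity_pt_opp f), Fc; lra. }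
  destruct Z as [t [T F]]; exists t; split; [easy|unfold f in F; lra]. }
assert (Dist : Cmod (cis (th2 - th1) - 1)%C = e).
{ assert (ED : Cmod (cis (th2 - th1) - 1)%C = Cmod (cis th2 - cis th1)%C).
  { rewrite <- (Cmod_mult_cis_minus (cis th2) th1), <- cis_plus; reflexivity. }
  rewrite ED; apply (cclosed_circle (cis th1) e); intros eps He; destruct (C2 eps 1 He Rlt_0_1) as [t [_ [T1 T2]]].
  now exists (radial_direction H t). }
assert (C0 : cos (th2 - th1) = cos s0).
{ assert (F : forall x, Cmod (cis x - 1)%C * Cmod (cis x - 1)%C = 2 - 2 * cos x).
  { intros x; rewrite Cmod_sqr, !re_minus, !im_minus, re_RtoC, im_RtoC; unfold cis; simpl; generalize (cos2_sin2 x); nra. }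
  generalize (F (th2 - th1)) (F s0); fold e; rewrite Dist; lra. }
assert (SI : exists th3, cis th3 = cis th2 /\ Rabs (th3 - th1) = s0).
{ assert (T : (sin (th2 - th1) - sin s0) * (sin (th2 - th1) + sin s0) = 0).
  { generalize (cos2_sin2 (th2 - th1)) (cos2_sin2 s0); rewrite C0; lra. }
  assert (E3 : forall x, cis (th2 - th1) = cis x -> cis (th1 + x) = cis th2).
  { intros x Ex; rewrite cis_plus, <- Ex, <- cis_plus; f_equal; ring. }
  apply Rmult_integral in T; destruct T as [T|T].
  - exists (th1 + s0); split; [apply E3; unfold cis; f_equal; lra|].
    replace (th1 + s0 - th1) with s0 by ring; apply Rabs_pos_eq; lra.
  - exists (th1 + - s0); split; [apply E3; unfold cis; rewrite cos_neg, sin_neg; f_equal; lra|].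
    replace (th1 + - s0 - th1) with (- s0) by ring; rewrite Rabs_Ropp; apply Rabs_pos_eq; lra. }
destruct SI as [th3 [T3 R3]].
assert (CD1 : cluster_direction H th1).
{ intros eps t0 He Ht0; destruct (C1 eps t0 He Ht0) as [t [T [_ Q]]]; exists t; split; [generalize (Rmin_l t0 t1); lra|easy]. }
assert (CD3 : cluster_direction H th3).
{ intros eps t0 He Ht0; destruct (C2 eps t0 He Ht0) as [t [T [_ Q]]]; exists t; split; [generalize (Rmin_l t0 t1); lra|now rewrite T3]. }
assert (W1 := wedge_of_cluster_direction H dH n n_pos H_diff H_star H_ray th1 CD1).
assert (W3 := wedge_of_cluster_direction H dH n n_pos H_diff H_star H_ray th3 CD3).
assert (X : n * PI / 2 + s0 / 2 <= n * PI / 2); [|lra].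
apply (wedge_sharp th1 ((th1 + th3) / 2)); [easy| |].
- replace (th1 - (th1 + th3) / 2) with (- (th3 - th1) / 2) by field.
  rewrite Rabs_div, Rabs_Ropp, R3, (Rabs_pos_eq 2) by lra; nra.
- intros w [alpha [Aw La]].
  apply Rabs_def2 in La.
  destruct (Rlt_le_dec (Rabs (alpha - th1)) (n * PI / 2)) as [l|l]; [apply W1; now exists alpha|].
  apply W3; exists alpha; split; [easy|].
  unfold Rabs in R3, l; destruct (Rcase_abs (th3 - th1)), (Rcase_abs (alpha - th1)); apply Rabs_def1; lra.
Qed.

End Sharp.

(** * Rotation and conclusion *)

Lemma angular_lim_eps (f : C -> C) (zeta l : C) : is_angular_lim f zeta l ->
  forall M eps, 1 < M -> 0 < eps -> exists d, 0 < d /\ forall z,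
    Cmod (z - zeta)%C < d -> Cmod (z - zeta)%C < M * (1 - Cmod z) -> Cmod (f z - l)%C < eps.
Proof.
intros L M eps HM He; assert (S : 0 < sqrt 2) by (apply sqrt_lt_R0; lra).
assert (E : 0 < eps / sqrt 2) by now apply Rdiv_lt_0_compat.
destruct (proj1 (filterlim_locally f l) (L M HM) (mkposreal _ E)) as [d K].
exists d; split; [apply cond_pos|]; intros z Hz Sz.
assert (B : @ball C_UniformSpace l (eps / sqrt 2) (f z)).
{ apply K; [now apply C_NormedModule_mixin_compat1|exact Sz]. }
assert (Q := C_NormedModule_mixin_compat2 l (f z) (mkposreal _ E) B).
change (Cmod (f z - l)%C < sqrt 2 * (eps / sqrt 2)) in Q.
replace (sqrt 2 * (eps / sqrt 2)) with eps in Q by (field; lra); easy.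
Qed.

Lemma at_left_1 (P : R -> Prop) : at_left 1 P <->
  exists t0, 0 < t0 /\ forall t, 0 < t < t0 -> P (1 - t).
Proof.
split.
- intros [d K]; exists d; split; [apply cond_pos|]; intros t Ht; apply K; [|lra].
  change (Rabs ((1 - t) - 1) < d); replace (1 - t - 1) with (- t) by ring; rewrite Rabs_Ropp, Rabs_pos_eq; lra.
- intros [t0 [Ht0 K]]; exists (mkposreal t0 Ht0); intros r Hr L.
  change (Rabs (r - 1) < t0) in Hr; apply Rabs_def2 in Hr.
  replace r with (1 - (1 - r)) by ring; apply K; lra.
Qed.

Section Rotation.

Variables (h : C -> C) (eta : C).
Hypothesis heta : Cmod eta = 1.

Definition rot (z : C) : C := h (eta * z)%C.
Definition drot (z : C) : C := (eta * C_derive h (eta * z))%C.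

Lemma eta_neq_0 : eta <> 0%C.
Proof. apply Cmod_gt_0; lra. Qed.

Lemma Cmod_rot (z : C) : Cmod (eta * z)%C = Cmod z.
Proof. rewrite Cmod_mult, heta; ring. Qed.

Lemma Cmod_rot_div (z : C) : Cmod (z / eta)%C = Cmod z.
Proof. rewrite Cmod_div, heta; [field|apply eta_neq_0]. Qed.

Lemma eta_mult_div (z : C) : (eta * (z / eta))%C = z.
Proof. field; apply eta_neq_0. Qed.

Lemma rot_image (w : C) : disk_image rot w <-> disk_image h w.
Proof.
split; intros [z [Hz E]]; unfold unit_disk in Hz.
- exists (eta * z)%C; split; [unfold unit_disk; now rewrite Cmod_rot|easy].
- exists (z / eta)%C; split; [unfold unit_disk; now rewrite Cmod_rot_div|unfold rot; now rewrite eta_mult_div].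
Qed.

Lemma rot_minus (z s : C) : Cmod (eta * z - s)%C = Cmod (z - s / eta)%C.
Proof. rewrite <- (Cmod_rot (z - s / eta)%C); f_equal; field; apply eta_neq_0. Qed.

Lemma rot_diff z : univalent h -> Cmod z < 1 -> cdiff rot z (drot z).
Proof.
intros [D _] Hz; eapply cdiff_eq.
- apply (cdiff_comp (fun z => eta * z)%C h).
  + apply cdiff_mult; [apply cdiff_const|apply cdiff_id].
  + apply cdiff_ex_derive, D; unfold unit_disk; now rewrite Cmod_rot.
- cbv beta; unfold drot; ring.
Qed.

Lemma rot_inj z w : univalent h -> Cmod z < 1 -> Cmod w < 1 -> rot z = rot w -> z = w.
Proof.
intros [_ I] Hz Hw E; apply I in E; try (unfold unit_disk; now rewrite Cmod_rot).
assert (F := f_equal (fun x => x / eta)%C E); cbv beta in F.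
replace (eta * z / eta)%C with z in F by (field; apply eta_neq_0).
now replace (eta * w / eta)%C with w in F by (field; apply eta_neq_0).
Qed.

Lemma rot_star z s : starlike h -> Cmod z < 1 -> 0 < s <= 1 -> disk_image rot (RtoC s * rot z)%C.
Proof.
intros [_ [mu [Hmu S]]] Hz Hs; apply rot_image.
assert (L : ln s <= 0) by (rewrite <- ln_1; apply ln_le; lra).
assert (Q := S (eta * z)%C ltac:(unfold unit_disk; now rewrite Cmod_rot) (- ln s / mu) ltac:(apply Rdiv_le_0_compat; lra)).
replace (- mu * (- ln s / mu)) with (ln s) in Q by (field; lra); rewrite exp_ln in Q by lra; exact Q.
Qed.

Lemma rot_Q nu : is_Q h eta nu -> forall M eps, 1 < M -> 0 < eps -> exists d, 0 < d /\ forall z,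
  Cmod (z - 1)%C < d -> Cmod (z - 1)%C < M * (1 - Cmod z) ->
  Cmod ((z - 1) * drot z / rot z - nu)%C < eps.
Proof.
intros Q M eps HM He; destruct (angular_lim_eps _ _ _ Q M eps HM He) as [d [Hd K]].
exists d; split; [easy|]; intros z Z1 Z2.
specialize (K (eta * z)%C); rewrite rot_minus, Cmod_rot in K.
replace (eta / eta)%C with (RtoC 1) in K by (field; apply eta_neq_0).
specialize (K Z1 Z2); unfold drot, rot.
replace ((z - 1) * (eta * C_derive h (eta * z)) / h (eta * z))%C
 with ((eta * z - eta) * C_derive h (eta * z) / h (eta * z))%C by (unfold Cdiv; ring); easy.
Qed.

End Rotation.

Theorem lemma4 (tau eta nu : C) (h : C -> C)
  (htau : (Cmod tau <= 1)%R)
  (heta : Cmod eta = 1%R)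
  (hne : eta <> tau)
  (hstar : Star_at tau eta h)
  (hQ : is_Q h eta nu) :
  (exists theta : R, is_radial_arg_lim h eta theta) /\
  (forall theta : R, is_radial_arg_lim h eta theta ->
     (forall w : C, wedge theta (Cmod nu * PI / 2)%R w -> disk_image h w) /\
     (forall beta : R, (Cmod nu * PI / 2 < beta)%R ->
        ~ (forall w : C, wedge theta beta w -> disk_image h w))).
Proof.
destruct hstar as [[S [Tin Tbd]] [nu' [Nnu' Q']]].
assert (U : univalent h) by apply S.
set (H := rot h eta); set (dH := drot h eta).
assert (H_diff : forall z, Cmod z < 1 -> cdiff H z (dH z)) by (intros; now apply rot_diff).
assert (H_inj : forall z w, Cmod z < 1 -> Cmod w < 1 -> H z = H w -> z = w) by (intros z w; now apply rot_inj).
assert (H_star : forall z s, Cmod z < 1 -> 0 < s <= 1 -> disk_image H (RtoC s * H z)%C) by (intros; now apply rot_star).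
assert (H_Q := rot_Q h eta heta nu hQ); fold H in H_Q; fold dH in H_Q.
(* The angular limit is unique, so [nu] is the nonzero one of the hypothesis. *)
assert (Nnu : nu <> 0%C).
{ intros E; apply Nnu'; apply Cmod_eq_0.
  apply Rle_antisym; [|apply Cmod_ge_0]; apply Rle_of_near; intros eps He.
  destruct (rot_Q h eta heta nu' Q' 4 (eps / 2)) as [d1 [Hd1 K1]]; [lra|lra|].
  destruct (H_Q 4 (eps / 2)) as [d2 [Hd2 K2]]; [lra|lra|].
  set (t := Rmin (Rmin d1 d2) 1 / 2).
  assert (T0 : 0 < Rmin (Rmin d1 d2) 1) by (repeat apply Rmin_pos; lra).
  assert (L1 := Rmin_l (Rmin d1 d2) 1); assert (L2 := Rmin_r (Rmin d1 d2) 1); assert (L3 := Rmin_l d1 d2); assert (L4 := Rmin_r d1 d2).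
  assert (T : 0 < t) by (unfold t; lra).
  assert (C1 : 0 < 1 <= cos 0) by (rewrite cos_0; lra).
  assert (M1 := ray_minus_1 t 0 ltac:(lra)); assert (M2 := ray_stolz 1 t 0 C1 ltac:(unfold t; lra)).
  assert (M3 := ray_in_disk 1 t 0 C1 ltac:(unfold t; lra)).
  assert (M4 : Cmod (ray t 0 - 1)%C < 4 * (1 - Cmod (ray t 0))) by lra.
  specialize (K1 (ray t 0) ltac:(unfold t in *; lra) M4); specialize (K2 (ray t 0) ltac:(unfold t in *; lra) M4).
  fold H dH in K1; set (q := ((ray t 0 - 1) * dH (ray t 0) / H (ray t 0))%C) in *.
  rewrite E in K2; replace (q - 0)%C with q in K2 by ring.
  generalize (Cmod_triangle_inv nu' q); rewrite (Cmod_minus_sym nu'); lra. }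
assert (Neta := eta_neq_0 eta heta).
destruct (nu_real_negative H dH nu H_diff H_inj H_star Nnu H_Q (tau / eta)%C) as [n [n_pos En]].
{ rewrite (Cmod_rot_div eta heta); easy. }
{ intros E; apply hne; rewrite <- (eta_mult_div eta heta tau), E; ring. }
{ rewrite (Cmod_rot_div eta heta); intros T; unfold H, rot; rewrite (eta_mult_div eta heta); auto. }
{ rewrite (Cmod_rot_div eta heta); intros T M eps HM He.
  destruct (angular_lim_eps _ _ _ (Tbd T) M eps HM He) as [d [Hd K]]; exists d; split; [easy|]; intros z Z1 Z2.
  specialize (K (eta * z)%C); rewrite (rot_minus eta heta), (Cmod_rot eta heta) in K; specialize (K Z1 Z2).
  replace (h (eta * z) - 0)%C with (H z) in K by (unfold H, rot; ring); easy. }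
assert (Mnu : Cmod nu = n) by (rewrite En, Cmod_R, Rabs_Ropp, Rabs_pos_eq; lra); rewrite Mnu.
assert (H_ray := Q_ray H dH nu Nnu H_Q); rewrite En in H_ray.
assert (Hr : forall r, h (RtoC r * eta)%C = H (ray (1 - r) 0)).
{ intros r; unfold H, rot; rewrite ray_0; replace (1 - (1 - r)) with r by ring; f_equal; ring. }
split.
- destruct (radial_direction_converges H dH n n_pos H_diff H_inj H_star H_ray) as [theta K].
  exists theta; set (a := fun r => theta + Im (clog (radial_direction H (1 - r) * cis (- theta))%C)).
  destruct (radial_direction_cont H dH n H_diff H_ray) as [t1 [Ht1 DC]].
  exists a; split.
  + apply at_left_1; destruct (near_cis_arg 1 Rlt_0_1) as [d [Hd N]].
    destruct (K d) as [t0 [Ht0 K0]]; [lra|]; exists (Rmin t0 t1); split; [apply Rmin_pos; lra|]; intros t Ht.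
    destruct (K0 t) as [NH Kd]; [generalize (Rmin_l t0 t1); lra|].
    destruct (DC t) as [_ Cd]; [generalize (Rmin_r t0 t1); lra|].
    assert (Ud := Cmod_radial_direction H t NH); destruct (N theta _ Ud Kd) as [_ N2].
    split.
    * unfold a; apply (continuous_plus (V := R_NormedModule) (fun _ => theta)); [apply continuous_const|].
      apply (curve_cont_im (fun r => clog (radial_direction H (1 - r) * cis (- theta))%C)).
      apply (curve_cont_comp (fun r => radial_direction H (1 - r)) (fun q => clog (q * cis (- theta))%C)).
      -- intros eps He; destruct (Cd eps He) as [d' [Hd' D']]; exists d'; split; [easy|]; intros s Hs.
         replace (1 - (1 - t)) with t by ring; apply D'.
         replace (1 - s - t) with (- (s - (1 - t))) by ring; now rewrite Rabs_Ropp.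
      -- replace (1 - (1 - t)) with t by ring.
         apply (ccont_comp (fun q => q * cis (- theta))%C clog).
         ++ apply ccont_mult; [apply ccont_id|apply ccont_const].
         ++ apply ccont_clog, near_1_re; rewrite Cmod_mult_cis_minus; lra.
    * rewrite Hr; unfold a; replace (1 - (1 - t)) with t by ring; split; [easy|].
      change (H (ray t 0) = RtoC (Cmod (H (ray t 0))) * cis (theta + Im (clog (radial_direction H t * cis (- theta)))))%C.
      rewrite <- N2; unfold radial_direction; apply Cmod_gt_0 in NH; field; intros E; apply RtoC_inj in E; lra.
  + apply filterlim_locally; intros [eps He]; apply at_left_1; destruct (near_cis_arg eps He) as [d [Hd N]].
    destruct (K d) as [t0 [Ht0 K0]]; [lra|]; exists t0; split; [easy|]; intros t Ht.
    destruct (K0 t Ht) as [NH Kd]; destruct (N theta _ (Cmod_radial_direction H t NH) Kd) as [N1 _].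
    change (Rabs (a (1 - t) - theta) < eps); unfold a; replace (1 - (1 - t)) with t by ring.
    now replace (theta + Im (clog (radial_direction H t * cis (- theta))) - theta) with (Im (clog (radial_direction H t * cis (- theta)))) by ring.
- intros theta [a [A L]].
  assert (CD : cluster_direction H theta).
  { intros eps t0 He Ht0.
    destruct (curve_diff_cont _ _ _ (curve_diff_cis theta) eps He) as [d [Hd D]].
    apply at_left_1 in A; destruct A as [t1 [Ht1 A]].
    assert (L' := proj1 (filterlim_locally a theta) L (mkposreal d Hd)).
    apply at_left_1 in L'; destruct L' as [t2 [Ht2 L']].
    set (t := Rmin (Rmin t0 t1) t2 / 2).
    assert (T0 : 0 < Rmin (Rmin t0 t1) t2) by (repeat apply Rmin_pos; lra).
    assert (L1 := Rmin_l (Rmin t0 t1) t2); assert (L2 := Rmin_r (Rmin t0 t1) t2); assert (L3 := Rmin_l t0 t1); assert (L4 := Rmin_r t0 t1).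
    assert (T : 0 < t /\ t < t0 /\ t < t1 /\ t < t2) by (unfold t; lra).
    exists t; split; [lra|].
    destruct (A t ltac:(lra)) as [_ [NH EH]]; specialize (L' t ltac:(lra)).
    rewrite Hr in NH, EH; replace (1 - (1 - t)) with t in NH, EH by ring.
    change (H (ray t 0) = RtoC (Cmod (H (ray t 0))) * cis (a (1 - t)%R))%C in EH.
    replace (radial_direction H t) with (cis (a (1 - t))); [now apply D|].
    unfold radial_direction; rewrite EH at 1; apply Cmod_gt_0 in NH; field; intros E; apply RtoC_inj in E; lra. }
  split.
  + intros w Hw; apply (rot_image h eta heta); now apply (wedge_of_cluster_direction H dH n n_pos H_diff H_star H_ray theta CD).
  + intros beta Hb W; assert (PP := PI_RGT_0).
    assert (X : beta <= n * PI / 2); [|lra].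
    apply (wedge_sharp H dH n n_pos H_diff H_inj H_ray theta theta beta CD).
    * rewrite Rminus_diag, Rabs_R0; assert (0 < n * PI) by nra; lra.
    * intros w Hw; now apply (rot_image h eta heta), W.
Qed.
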